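(* Let $\beta>0$, $m\ge1$ an integer and $\lambda_m>0$ with $\lambda_m^2:=e^{-m\beta/2}$. Then the generator $(H_{X_m}^{\lambda_m},D(H_{X_m}^{\lambda_m}))$ of the Dirichlet form $(\mathcal E_{X_m}^{\lambda_m},\mathcal F_{X_m}^{\lambda_m})$ on $L^2(h)$, $h=l^2(\mathbb N)$, has discrete spectrum and subexponential spectral growth rate: $${\rm Tr}(e^{-tH_{X_m}^{\lambda_m}})<+\infty\qquad t>0.$$
   Context: $\mathbb N=\{0,1,2,\dots\}$, $h=l^2(\mathbb N)$ with natural basis $\{e_k\}_{k\in\mathbb N}$. $M=B(h)$ acts by left composition on $L^2(M)=L^2(h)$, the Hilbert-Schmidt operators on $h$, with cone $L^2_+(h)$ of positive Hilbert-Schmidt operators and $J\eta=\eta^*$. $N$ is the Number Operator, $Ne_k=ke_k$, $D(N)=\{\sum c_ke_k:\sum k^2|c_k|^2<\infty\}$. $\rho_\beta=(1-e^{-\beta})e^{-\beta N}$ is the density matrix of the state $\omega_\beta(x)={\rm Tr}(x\rho_\beta)$, represented by $\xi_0=\rho_\beta^{1/2}\in L^2_+(h)$. Annihilation and creation operators: on $D(A)=D(A^* )=D(\sqrt N)$, $Ae_0=0$, $Ae_k=\sqrt k\,e_{k-1}$ ($k\ge1$), $A^*e_k=\sqrt{k+1}\,e_{k+1}$. $X_m:=(A^* )^m$ with $D(X_m)=D(N^{m/2})$; all such operators on $h$ are also viewed as operators on $L^2(h)$ affiliated to $M$, acting by left composition (on the natural domain, i.e. as $X\otimes I$ under $L^2(h)\cong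 h\otimes\bar h$). For an operator $X$ affiliated to $M$, $j(X):=JXJ$ with domain $JD(X)$ (domains in $L^2(h)$). $(\mathcal E_{X_m}^{\lambda_m},\mathcal F_{X_m}^{\lambda_m})$ is the closure of the closable form $\eta\mapsto\|(\lambda_mX_m-\lambda_m^{-1}j(X_m^* ))\eta\|^2+\|(\lambda_m^{-1}X_m^*-\lambda_mj(X_m))\eta\|^2$ on $D(X_m)\cap D(X_m^* )\cap J(D(X_m)\cap D(X_m^* ))$; it is a completely Dirichlet form with respect to $(M,\omega_\beta)$ and $H_{X_m}^{\lambda_m}\ge0$ is its associated self-adjoint operator on $L^2(h)$. Discrete spectrum means that the spectrum consists of isolated eigenvalues of finite multiplicity. *)

(* Defs.v *)
From HB Require Import structures.
From mathcomp Require Import all_boot all_order all_algebra.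
From mathcomp Require Import complex.
From mathcomp Require Import all_classical all_reals all_analysis.
From mathcomp Require Import ring.

Set Implicit Arguments.
Unset Strict Implicit.
Unset Printing Implicit Defensive.

Import Order.TTheory GRing.Theory Num.Theory.
Import numFieldNormedType.Exports.
Local Open Scope classical_set_scope.
Local Open Scope ring_scope.
Local Open Scope complex_scope.

(** * Operators and quadratic forms on a complex inner product space

    The inner product [dot] is conjugate-linear in its first argument.
    A possibly unbounded operator is given by its graph, and a quadratic form
    [q : D(q) -> R] by the graph of [q]. *)

Definition op (V : Type) := V -> V -> Prop.

Definition qform (R : realType) (V : Type) := V -> R -> Prop.

Definition dom (V W : Type) (S : V -> W -> Prop) : set V :=
  [set u | exists w, S u w].

Definition opcomp (V : Type) (S T : op V) : op V :=
  fun u w => exists2 v, T u v & S v w.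

Definition opexp (V : Type) (S : op V) (n : nat) : op V :=
  iter n (opcomp S) (fun u v => v = u).

Definition adjoint (R : realType) (V : Type) (dot : V -> V -> R[i]) (S : op V)
    : op V :=
  fun v w => forall x y, S x y -> dot v y = dot w x.

Definition nrm2 (R : realType) (V : Type) (dot : V -> V -> R[i]) (u : V) : R :=
  complex.Re (dot u u).

Definition nrm (R : realType) (V : Type) (dot : V -> V -> R[i]) (u : V) : R :=
  Num.sqrt (nrm2 dot u).

Definition bounded_linear (R : realType) (V : lmodType R[i])
    (dot : V -> V -> R[i]) (T : V -> V) : Prop :=
  linear T /\ exists K : R, forall u, nrm dot (T u) <= K * nrm dot u.

Definition orthonormal_basis (R : realType) (V : lmodType R[i])
    (dot : V -> V -> R[i]) (b : nat -> V) : Prop :=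
  (forall i j, dot (b i) (b j) = (i == j)%:R) /\
  (forall u, (forall i, dot (b i) u = 0) -> u = 0).

Definition form_closure (R : realType) (V : lmodType R[i])
    (dot : V -> V -> R[i]) (q : qform R V) : qform R V :=
  fun u r => exists (w : nat -> V) (s : nat -> R),
    [/\ forall n, q (w n) (s n),
        nrm dot (w n - u) @[n --> \oo] --> (0 : R),
        forall e : R, 0 < e -> exists N, forall n p, (N <= n)%N -> (N <= p)%N ->
          exists2 d, q (w n - w p) d & d < e
      & s n @[n --> \oo] --> r].

(** [polar q u v z] : the polarization of [q], conjugate-linear in its first
    argument like [dot], has value [z] at [(u, v)]. *)
Definition polar (R : realType) (V : lmodType R[i]) (q : qform R V) (u v : V)
    (z : R[i]) : Prop :=
  exists a b c d : R,
    [/\ q (u + v) a, q (u - v) b, q (u - (0 +i* 1) *: v) c, q (u + (0 +i* 1) *: v) d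
      & z = ((a - b) / 4) +i* ((c - d) / 4)].

(** The operator [H] of the first representation theorem: [u \in D(H)] and
    [H u = v] iff [u \in D(q)] and [q(w, u) = <w, v>] for all [w \in D(q)]. *)
Definition form_operator (R : realType) (V : lmodType R[i])
    (dot : V -> V -> R[i]) (q : qform R V) : op V :=
  fun u v => dom q u /\ forall w, dom q w -> polar q w u (dot w v).

Definition resolvent_set (R : realType) (V : lmodType R[i])
    (dot : V -> V -> R[i]) (H : op V) : set R[i] :=
  [set z | exists2 B : V -> V, bounded_linear dot B &
     forall u v, B v = u <-> exists2 w, H u w & z *: u - w = v].

Definition spectrum (R : realType) (V : lmodType R[i])
    (dot : V -> V -> R[i]) (H : op V) : set R[i] :=
  ~` resolvent_set dot H.

Definition isolated_point (R : realType) (S : set R[i]) (z : R[i]) : Prop :=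
  exists2 e : R, 0 < e & forall z', S z' -> `|z' - z| < e%:C -> z' = z.

Definition finite_multiplicity_eigenvalue (R : realType) (V : lmodType R[i])
    (H : op V) (z : R[i]) : Prop :=
  (exists2 u, u != 0 & H u (z *: u)) /\
  (exists (n : nat) (b : 'I_n -> V), forall u, H u (z *: u) ->
     exists c : 'I_n -> R[i], u = \sum_i c i *: b i).

Definition discrete_spectrum (R : realType) (V : lmodType R[i])
    (dot : V -> V -> R[i]) (H : op V) : Prop :=
  forall z, spectrum dot H z ->
    isolated_point (spectrum dot H) z /\ finite_multiplicity_eigenvalue H z.

(** [T t = e^{-tH}] for all [t >= 0]: [T] is the strongly continuous semigroup
    of bounded operators with infinitesimal generator [- H]. A strongly
    continuous semigroup is determined by its generator. *)
Definition exp_semigroup (R : realType) (V : lmodType R[i])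
    (dot : V -> V -> R[i]) (H : op V) (T : R -> V -> V) : Prop :=
  [/\ forall t, 0 <= t -> bounded_linear dot (T t),
      forall u, T 0 u = u,
      forall s t u, 0 <= s -> 0 <= t -> T (s + t) u = T s (T t u),
      forall u, nrm dot (T t u - u) @[t --> 0^'+] --> (0 : R)
    & forall u v, H u v <->
        nrm dot (t^-1%:C *: (u - T t u) - v) @[t --> 0^'+] --> (0 : R)].

(** The trace, in the orthonormal basis [b], of a positive operator [T]. *)
Definition trace (R : realType) (V : Type) (dot : V -> V -> R[i])
    (b : nat -> V) (T : V -> V) : \bar R :=
  \esum_(k in [set: nat]) (complex.Re (dot (b k) (T (b k))))%:E.

(** * The Hilbert space l^2(N) *)

Definition sqnormc (R : realType) (z : R[i]) : R :=
  complex.Re z ^+ 2 + complex.Im z ^+ 2.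

Definition csum (R : realType) (z : nat -> R[i]) : R[i] :=
  limn (series (fun k => complex.Re (z k))) +i*
  limn (series (fun k => complex.Im (z k))).

Definition square_summable (R : realType) : {pred nat -> R[i]} :=
  fun x => `[< (\sum_(k <oo) (sqnormc (x k))%:E < +oo)%E >].

Lemma sqnormc_ge0 (R : realType) (z : R[i]) : 0 <= sqnormc z.
Proof. by rewrite addr_ge0 ?sqr_ge0. Qed.

Lemma sqnormcD_le (R : realType) (a z w : R[i]) :
  sqnormc (a * z + w) <= 2 * sqnormc a * sqnormc z + 2 * sqnormc w.
Proof.
case: a z w => [a b] [c d] [e f]; rewrite /sqnormc /= -subr_ge0.
set p := a * c - b * d; set q := a * d + b * c.
rewrite (_ : _ - _ = (p - e) ^+ 2 + (q - f) ^+ 2); last by rewrite /p /q; ring.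
by rewrite addr_ge0 ?sqr_ge0.
Qed.

Lemma nneseries_comb_lt (R : realType) (f g h : nat -> R) (a : R) :
  0 <= a -> (forall k, 0 <= f k) -> (forall k, 0 <= g k) ->
  (forall k, 0 <= h k) -> (forall k, h k <= a * f k + 2 * g k) ->
  (\sum_(k <oo) (f k)%:E < +oo)%E -> (\sum_(k <oo) (g k)%:E < +oo)%E ->
  (\sum_(k <oo) (h k)%:E < +oo)%E.
Proof.
move=> a0 f0 g0 h0 hle foo goo.
have : (\sum_(k <oo) (h k)%:E <=
        \sum_(k <oo) (a%:E * (f k)%:E + 2%:E * (g k)%:E))%E.
  by apply: lee_nneseries => k *; rewrite ?lee_fin //.
move=> /le_lt_trans; apply.
rewrite nneseriesD; last 2 first.
- by move=> k _ _; rewrite -EFinM lee_fin mulr_ge0.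
- by move=> k _ _; rewrite -EFinM lee_fin mulr_ge0.
rewrite !nneseriesZl; try by move=> k _; rewrite lee_fin.
by rewrite lte_add_pinfty // lte_mul_pinfty ?lee_fin.
Qed.

Fact square_summable_submod (R : realType) :
  submod_closed (@square_summable R).
Proof.
split=> [|a x y /asboolP xoo /asboolP yoo]; apply/asboolP.
  rewrite eseries0 ?ltry // => k _ _.
  by rewrite /sqnormc /= expr0n addr0.
apply: (@nneseries_comb_lt _ _ _ _ (2 * sqnormc a) _ _ _ _ _ xoo yoo) => *.
- by rewrite mulr_ge0 ?sqnormc_ge0.
- exact: sqnormc_ge0.
- exact: sqnormc_ge0.
- exact: sqnormc_ge0.
- exact: sqnormcD_le.
Qed.

HB.instance Definition _ (R : realType) :=
  GRing.isSubmodClosed.Build R[i] (nat -> R[i]) (@square_summable R)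
    (@square_summable_submod R).

Record l2 (R : realType) := L2 {
  l2val :> nat -> R[i];
  l2P : l2val \in @square_summable R }.

HB.instance Definition _ (R : realType) := [isSub for @l2val R].
HB.instance Definition _ (R : realType) := [Choice of l2 R by <:].
HB.instance Definition _ (R : realType) :=
  [SubChoice_isSubLmodule of l2 R by <:].

Definition l2dot (R : realType) (x y : l2 R) : R[i] :=
  csum (fun k => conjc (x k) * y k).

Lemma l2_nrm2E (R : realType) (x : l2 R) :
  ((nrm2 (@l2dot R) x)%:E = \sum_(k <oo) (sqnormc (x k))%:E)%E.
Proof.
have xoo : (\sum_(k <oo) (sqnormc (x k))%:E < +oo)%E by apply/asboolP/l2P.
have snd : nondecreasing_seq (series (fun k => sqnormc (x k))).
  by apply/nondecreasing_series => k *; exact: sqnormc_ge0.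
have sE n : (\sum_(0 <= k < n) (sqnormc (x k))%:E)%E =
            (series (fun k => sqnormc (x k)) n)%:E by rewrite sumEFin.
have scvg : cvgn (series (fun k => sqnormc (x k))).
  apply: nondecreasing_is_cvgn => //.
  exists (fine (\sum_(k <oo) (sqnormc (x k))%:E)) => _ [n _ <-].
  have sge0 k : (0 <= (sqnormc (x k))%:E :> \bar R)%E.
    by rewrite lee_fin sqnormc_ge0.
  rewrite -lee_fin fineK; last first.
    by rewrite ge0_fin_numE //; apply: nneseries_ge0 => *; exact: sge0.
  by rewrite -sE; apply: nneseries_lim_ge => *; exact: sge0.
rewrite /nrm2 /l2dot /csum /=.
have -> : (\sum_(k <oo) (sqnormc (x k))%:E)%E =
    limn (EFin \o series (fun k => sqnormc (x k))).
  by apply/congr_lim/funext => n /=; rewrite sE.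
rewrite EFin_lim //; congr (limn _ )%:E; congr series; apply/funext => k.
by case: (x k) => a b; rewrite /sqnormc /=; ring.
Qed.

Lemma l2_nrm2_ge0 (R : realType) (x : l2 R) : 0 <= nrm2 (@l2dot R) x.
Proof.
rewrite -lee_fin l2_nrm2E; apply: nneseries_ge0 => k _ _.
by rewrite lee_fin sqnormc_ge0.
Qed.

Lemma l2_nrm2D_le (R : realType) (a : R[i]) (x y : l2 R) :
  nrm2 (@l2dot R) (a *: x + y) <=
  2 * sqnormc a * nrm2 (@l2dot R) x + 2 * nrm2 (@l2dot R) y.
Proof.
have a0 : 0 <= 2 * sqnormc a by rewrite mulr_ge0 ?sqnormc_ge0.
have nn (f : nat -> R[i]) k : (0 <= (sqnormc (f k))%:E :> \bar R)%E.
  by rewrite lee_fin sqnormc_ge0.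
rewrite -lee_fin EFinD [(_ * nrm2 _ x)%:E]EFinM [(_ * nrm2 _ y)%:E]EFinM.
rewrite !l2_nrm2E -!nneseriesZl; try by move=> k _; exact: nn.
rewrite -nneseriesD; last 2 first.
- by move=> k _ _; rewrite mule_ge0 // lee_fin.
- by move=> k _ _; rewrite mule_ge0 // lee_fin.
apply: lee_nneseries => k *; first exact: nn.
by rewrite -!EFinM -EFinD lee_fin; exact: sqnormcD_le.
Qed.

Lemma l2_nrm2_0 (R : realType) : nrm2 (@l2dot R) 0 = 0.
Proof.
apply: EFin_inj; rewrite l2_nrm2E eseries0 // => k _ _.
by rewrite /sqnormc /= expr0n addr0.
Qed.

Fact l2_basis_subproof (R : realType) (k : nat) :
  (fun i : nat => (i == k)%:R : R[i]) \in @square_summable R.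
Proof.
apply/asboolP; rewrite (nneseries_split 0 k.+1) ?add0n; last first.
  by move=> i _; rewrite lee_fin sqnormc_ge0.
rewrite [X in (_ + X)%E]eseries0 ?adde0; first by rewrite sumEFin ltry.
move=> i ki _; rewrite gtn_eqF // /sqnormc /=.
by rewrite expr0n addr0.
Qed.

Definition l2_basis (R : realType) (k : nat) : l2 R :=
  L2 (l2_basis_subproof R k).

(** * The Hilbert space L^2(h) of Hilbert-Schmidt operators on h = l^2(N) *)

Definition hilbert_schmidt (R : realType) : {pred l2 R -> l2 R} :=
  fun T => `[< bounded_linear (@l2dot R) T /\
               (\sum_(k <oo) (nrm2 (@l2dot R) (T (l2_basis R k)))%:E < +oo)%E >].

Fact hilbert_schmidt_submod (R : realType) : submod_closed (@hilbert_schmidt R).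
Proof.
split=> [|a S T /asboolP[[Slin [K1 SK]] Soo] /asboolP[[Tlin [K2 TK]] Too]];
    apply/asboolP.
  split; first split.
  - by move=> c x y; rewrite scaler0 addr0.
  - by exists 0 => x; rewrite /nrm l2_nrm2_0 sqrtr0 mul0r.
  - by rewrite eseries0 ?ltry // => k _ _; rewrite l2_nrm2_0.
have nrmE x : nrm (@l2dot R) x ^+ 2 = nrm2 (@l2dot R) x.
  by rewrite sqr_sqrtr // l2_nrm2_ge0.
split; first split.
- move=> c x y.
  rewrite (_ : (a *: S + T) x = a *: S x + T x) //.
  rewrite (_ : (a *: S + T) y = a *: S y + T y) //.
  rewrite (_ : (a *: S + T) _ = a *: S (c *: x + y) + T (c *: x + y)) //.
  by rewrite Slin Tlin !scalerDr !scalerA addrACA [a * c]mulrC.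
- have bnd U K x : nrm (@l2dot R) (U x) <= K * nrm (@l2dot R) x ->
      nrm2 (@l2dot R) (U x) <= K ^+ 2 * nrm2 (@l2dot R) x.
    move=> UK; rewrite -!nrmE -exprMn lerXn2r // ?nnegrE ?sqrtr_ge0 //.
    by apply: le_trans UK; exact: sqrtr_ge0.
  exists (Num.sqrt (2 * sqnormc a * K1 ^+ 2 + 2 * K2 ^+ 2)) => x.
  have a0 : 0 <= 2 * sqnormc a by rewrite mulr_ge0 ?sqnormc_ge0.
  rewrite /nrm -sqrtrM; last first.
    by rewrite addr_ge0 // mulr_ge0 // sqr_ge0.
  apply: ler_wsqrtr; apply: le_trans (l2_nrm2D_le _ _ _) _.
  rewrite [leRHS]mulrDl -(mulrA _ (K1 ^+ 2)) -(mulrA 2 (K2 ^+ 2)).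
  by rewrite lerD // ler_wpM2l // bnd.
- apply: (@nneseries_comb_lt _ _ _ _ (2 * sqnormc a) _ _ _ _ _ Soo Too) => *.
  + by rewrite mulr_ge0 ?sqnormc_ge0.
  + exact: l2_nrm2_ge0.
  + exact: l2_nrm2_ge0.
  + exact: l2_nrm2_ge0.
  + exact: l2_nrm2D_le.
Qed.

HB.instance Definition _ (R : realType) :=
  GRing.isSubmodClosed.Build R[i] (l2 R -> l2 R) (@hilbert_schmidt R)
    (@hilbert_schmidt_submod R).

Record hs (R : realType) := HS {
  hsval :> l2 R -> l2 R;
  hsP : hsval \in @hilbert_schmidt R }.

HB.instance Definition _ (R : realType) := [isSub for @hsval R].
HB.instance Definition _ (R : realType) := [Choice of hs R by <:].
HB.instance Definition _ (R : realType) :=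
  [SubChoice_isSubLmodule of hs R by <:].

(** [<eta, zeta> = Tr (eta^* zeta)] *)
Definition hsdot (R : realType) (eta zeta : hs R) : R[i] :=
  csum (fun k => l2dot (eta (l2_basis R k)) (zeta (l2_basis R k))).

(** The graph of [J eta = eta^*]. *)
Definition modular_conj (R : realType) : op (hs R) :=
  fun eta zeta => forall x y, l2dot (eta x) y = l2dot x (zeta y).

(** The operator [S] on [h], as an operator on [L^2(h)] by left composition. *)
Definition left_comp (R : realType) (S : op (l2 R)) : op (hs R) :=
  fun eta zeta => forall x, S (eta x) (zeta x).

(** [j(X) = J X J] *)
Definition right_op (R : realType) (X : op (hs R)) : op (hs R) :=
  opcomp (@modular_conj R) (opcomp X (@modular_conj R)).

(** * Powers of the creation operator and the Dirichlet form *)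

(** [D(N^{m/2})] *)
Definition dom_number_half (R : realType) (m : nat) : set (l2 R) :=
  [set x | (\sum_(k <oo) (k%:R ^+ m * sqnormc (x k))%:E < +oo)%E].

Definition creation (R : realType) : op (l2 R) :=
  fun x y => [/\ dom_number_half 1 x, y 0%N = 0
    & forall k, y k.+1 = (Num.sqrt (k.+1%:R : R))%:C * x k].

Definition creation_pow (R : realType) (m : nat) : op (l2 R) :=
  fun x y => dom_number_half m x /\ opexp (@creation R) m x y.

Definition dirichlet_preform (R : realType) (lam : R) (S : op (l2 R)) :
    qform R (hs R) :=
  fun eta r =>
    let X := left_comp S in
    let Xs := left_comp (adjoint (@l2dot R) S) in
    let D := dom X `&` dom Xs in
    [/\ D eta, (exists2 zeta, modular_conj eta zeta & D zeta) &
      exists a b c d, [/\ X eta a, right_op Xs eta b, Xs eta c,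
        right_op X eta d &
        r = nrm2 (@hsdot R) (lam%:C *: a - lam^-1%:C *: b) +
            nrm2 (@hsdot R) (lam^-1%:C *: c - lam%:C *: d)]].

Definition dirichlet_form (R : realType) (lam : R) (S : op (l2 R)) :
    qform R (hs R) :=
  form_closure (@hsdot R) (dirichlet_preform lam S).

Definition dirichlet_generator (R : realType) (lam : R) (S : op (l2 R)) :
    op (hs R) :=
  form_operator (@hsdot R) (dirichlet_form lam S).

(* Main.v *)
(** In matrix coordinates [eta i j], writing [c i ^ 2 = (i + m)! / i!] and [theta = lam ^ 2],
    the four terms of the form have squared norms [N1 = sum c_i^2 |eta_{i,j}|^2],
    [N2 = sum c_j^2 |eta_{i,j+m}|^2], [N3 = sum c_i^2 |eta_{i+m,j}|^2] and
    [N4 = sum c_j^2 |eta_{i,j}|^2]. Completing squares bounds the form from below by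
    [(1 - theta) (theta^-1 (N2 + N3) - (N1 + N4))]. As [theta < 1] and [c_{i+m}^2 / c_i^2] tends
    to 1, this dominates a multiple of [N1 + N4] up to a multiple of [|eta|^2]. So the form is
    already closed on the weighted l^2 space with weights [c_i^2 + c_j^2], which embeds
    compactly. Successive minimization of the Rayleigh quotient then gives an orthonormal
    eigenbasis. By Jensen's inequality the trace of [exp (- t H)] is at most a constant times
    the sum of [exp (- s (c_i^2 + c_j^2))] for some [s > 0], which is finite because
    [c_i^2 >= i + 1]. *)

Require Import Defs.
From mathcomp Require Import all_boot all_order all_algebra.
From mathcomp Require Import complex.
From mathcomp Require Import all_classical all_reals all_analysis.
From mathcomp Require Import ring lra.
From Stdlib Require Cantor.

Set Implicit Arguments.
Unset Strict Implicit.
Unset Printing Implicit Defensive.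

Import Order.TTheory GRing.Theory Num.Theory.
Import numFieldNormedType.Exports.
Local Open Scope classical_set_scope.
Local Open Scope ring_scope.
Local Open Scope complex_scope.

(** The two squares of the form cannot be bounded below one at a time. Once completed, each
    contributes a gain and a loss, and the gain [N3] that offsets the loss [N1] sits in the other
    square, as does the gain [N2] that offsets [N4]. Gains carry the factor theta^-1 - 1 and losses
    the factor 1 - theta, and the ratio of these is theta^-1. A comparison N1 <= mu N3 + C |eta|^2
    with mu strictly between 1 and theta^-1 therefore leaves a positive surplus; this is where beta
    > 0 enters. The spectral part is independent of the model: it takes a Hilbert basis, weights [W]
    with exp (- t W) summable for every t > 0, and a form comparable with these weights up to the
    norm. Its eigenbasis turns the generator into multiplication by a real sequence, and the
    resolvent, the semigroup and the trace are then computed in coordinates. *)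

Local Notation Re := (@complex.Re _).
Local Notation Im := (@complex.Im _).

(** * Squared modulus of complex numbers *)

Section SquaredModulus.
Variable R : realType.
Implicit Types (z w : R[i]) (x : R).

Lemma sqnormcM z w : sqnormc (z * w) = sqnormc z * sqnormc w.
Proof. by case: z w => [a b] [c d]; rewrite /sqnormc /=; ring. Qed.

Lemma sqnormc_conj z : sqnormc (conjc z) = sqnormc z.
Proof. by case: z => a b; rewrite /sqnormc /=; ring. Qed.

Lemma sqnormcN z : sqnormc (- z) = sqnormc z.
Proof. by case: z => a b; rewrite /sqnormc /=; ring. Qed.

Lemma sqnormc0 : sqnormc (0 : R[i]) = 0.
Proof. by rewrite /sqnormc /= expr0n addr0. Qed.

Lemma sqnormc_real x : sqnormc x%:C = x ^+ 2.
Proof. by rewrite /sqnormc /= expr0n addr0. Qed.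

Lemma sqnormc_eq0 z : (sqnormc z == 0) = (z == 0).
Proof. by rewrite paddr_eq0 ?sqr_ge0 // !sqrf_eq0 eq_complex. Qed.

Lemma mulJc z : conjc z * z = (sqnormc z)%:C.
Proof. by case: z => a b; rewrite /sqnormc /=; congr (_ +i* _); ring. Qed.

Lemma ReD z w : Re (z + w) = Re z + Re w. Proof. by case: z w => [? ?] []. Qed.
Lemma ImD z w : Im (z + w) = Im z + Im w. Proof. by case: z w => [? ?] []. Qed.
Lemma ReN z : Re (- z) = - Re z. Proof. by case: z. Qed.
Lemma ImN z : Im (- z) = - Im z. Proof. by case: z. Qed.
Lemma Re_conj z : Re (conjc z) = Re z. Proof. by case: z. Qed.
Lemma ReMl x z : Re (x%:C * z) = x * Re z.
Proof. by case: z => a b /=; rewrite mul0r subr0. Qed.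
Lemma Re_sum (I : Type) (r : seq I) (P : pred I) (F : I -> R[i]) :
  Re (\sum_(i <- r | P i) F i) = \sum_(i <- r | P i) Re (F i).
Proof. by elim/big_rec2: _ => // i x y _ <-; rewrite ReD. Qed.

Lemma Im_sum (I : Type) (r : seq I) (P : pred I) (F : I -> R[i]) :
  Im (\sum_(i <- r | P i) F i) = \sum_(i <- r | P i) Im (F i).
Proof. by elim/big_rec2: _ => // i x y _ <-; rewrite ImD. Qed.

Lemma sqr_Re_le z : Re z ^+ 2 <= sqnormc z.
Proof. by rewrite /sqnormc lerDl sqr_ge0. Qed.

Lemma sqr_Im_le z : Im z ^+ 2 <= sqnormc z.
Proof. by rewrite /sqnormc lerDr sqr_ge0. Qed.

Lemma le_sqnormcD z w : sqnormc (z + w) <= 2 * sqnormc z + 2 * sqnormc w.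
Proof. by have := sqnormcD_le 1 z w; rewrite mul1r sqnormc_real expr1n mulr1. Qed.

Lemma complex_ext z w : Re z = Re w -> Im z = Im w -> z = w.
Proof. by case: z w => [? ?] [? ?] /= -> ->. Qed.

End SquaredModulus.

(** * Semi-inner products on a subspace *)

Section SemiInner.
Variables (R : realType) (V : lmodType R[i]).
Implicit Types (u v w : V) (B : V -> V -> R[i]).

(* Off the subspace [D], [B] is arbitrary. *)
Record semi_inner (D : set V) B := SemiInner {
  si_dom0 : D 0;
  si_domP : forall a u v, D u -> D v -> D (a *: u + v);
  si_linear : forall a u v w, D u -> D v -> D w ->
    B u (a *: v + w) = a * B u v + B u w;
  si_conj : forall u v, D u -> D v -> B v u = conjc (B u v);
  si_ge0 : forall u, D u -> 0 <= nrm2 B u }.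

Variables (D : set V) (B : V -> V -> R[i]).
Hypothesis siB : semi_inner D B.

Lemma si_domD u v : D u -> D v -> D (u + v).
Proof. by move=> Du Dv; have := si_domP siB 1 Du Dv; rewrite scale1r. Qed.

Lemma si_domZ a u : D u -> D (a *: u).
Proof. by move=> Du; have := si_domP siB a Du (si_dom0 siB); rewrite addr0. Qed.

Lemma si_domN u : D u -> D (- u).
Proof. by move=> Du; rewrite -scaleN1r; exact: si_domZ. Qed.

Lemma si_domB u v : D u -> D v -> D (u - v).
Proof. by move=> Du Dv; apply: si_domD => //; exact: si_domN. Qed.

Lemma si_dom_sum n (F : nat -> V) :
  (forall k, D (F k)) -> D (\sum_(k < n) F k).
Proof.
by move=> DF; elim/big_ind: _ => //; [exact: si_dom0 siB|move=> *; exact: si_domD].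
Qed.

Let dom0 := si_dom0 siB.
Hint Resolve dom0 si_domD si_domZ si_domN si_domB si_dom_sum : core.

Lemma siDr u v w : D u -> D v -> D w -> B u (v + w) = B u v + B u w.
Proof. by move=> *; rewrite -[v]scale1r (si_linear siB)// mul1r scale1r. Qed.

Lemma si0r u : D u -> B u 0 = 0.
Proof. by move=> Du; apply: (addrI (B u 0)); rewrite -siDr// !addr0. Qed.

Lemma siZr a u v : D u -> D v -> B u (a *: v) = a * B u v.
Proof. by move=> *; rewrite -[_ *: v]addr0 (si_linear siB)// si0r// addr0. Qed.

Lemma siNr u v : D u -> D v -> B u (- v) = - B u v.
Proof. by move=> *; rewrite -scaleN1r siZr// mulN1r. Qed.

Lemma siBr u v w : D u -> D v -> D w -> B u (v - w) = B u v - B u w.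
Proof. by move=> *; rewrite siDr ?siNr//; exact: si_domN. Qed.

Lemma siDl u v w : D u -> D v -> D w -> B (v + w) u = B v u + B w u.
Proof.
move=> *; rewrite (si_conj siB)//; last exact: si_domD.
by rewrite siDr// rmorphD /= -!(si_conj siB).
Qed.

Lemma siZl a u v : D u -> D v -> B (a *: v) u = conjc a * B v u.
Proof.
move=> *; rewrite (si_conj siB)//; last exact: si_domZ.
by rewrite siZr// rmorphM /= -(si_conj siB).
Qed.

Lemma siNl u v : D u -> D v -> B (- v) u = - B v u.
Proof.
by move=> *; rewrite -scaleN1r siZl// rmorphN1 mulN1r.
Qed.

Lemma siBl u v w : D u -> D v -> D w -> B (v - w) u = B v u - B w u.
Proof. by move=> *; rewrite siDl ?siNl//; exact: si_domN. Qed.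

Lemma si_sumr n (F : nat -> V) u : D u -> (forall k, D (F k)) ->
  B u (\sum_(k < n) F k) = \sum_(k < n) B u (F k).
Proof.
move=> Du DF; elim: n => [|n IH]; first by rewrite !big_ord0 si0r.
by rewrite !big_ord_recr /= siDr// ?IH//; exact: si_dom_sum.
Qed.

Lemma si_suml n (F : nat -> V) u : D u -> (forall k, D (F k)) ->
  B (\sum_(k < n) F k) u = \sum_(k < n) B (F k) u.
Proof.
move=> Du DF; rewrite (si_conj siB)//; last exact: si_dom_sum.
rewrite si_sumr// rmorph_sum /=; apply: eq_bigr => k _.
by rewrite -(si_conj siB).
Qed.

Lemma si_diag u : D u -> B u u = (nrm2 B u)%:C.
Proof.
move=> Du; have := si_conj siB Du Du; rewrite /nrm2; case: (B u u) => a b /= [h].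
by congr (_ +i* _); apply/eqP; rewrite -[_ == _](mulrn_eq0 b 2) mulr2n {2}h subrr.
Qed.

Lemma nrm2Z a u : D u -> nrm2 B (a *: u) = sqnormc a * nrm2 B u.
Proof.
move=> Du; rewrite {1}/nrm2 siZr ?siZl//; last exact: si_domZ.
by rewrite mulrA [a * _]mulrC mulJc ReMl.
Qed.

Lemma nrm2D u v : D u -> D v ->
  nrm2 B (u + v) = nrm2 B u + nrm2 B v + 2 * Re (B u v).
Proof.
move=> Du Dv; rewrite {1}/nrm2 siDr ?siDl//; last exact: si_domD.
by rewrite !ReD (si_conj siB Du Dv) Re_conj /nrm2; ring.
Qed.

Lemma nrm2N u : D u -> nrm2 B (- u) = nrm2 B u.
Proof.
by move=> Du; rewrite -scaleN1r nrm2Z// sqnormcN sqnormc_real expr1n mul1r.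
Qed.

Lemma nrm2B u v : D u -> D v ->
  nrm2 B (u - v) = nrm2 B u + nrm2 B v - 2 * Re (B u v).
Proof.
move=> Du Dv; rewrite nrm2D//; last exact: si_domN.
by rewrite nrm2N// siNr// ReN mulrN.
Qed.

Lemma nrm2_subC u v : D u -> D v -> nrm2 B (u - v) = nrm2 B (v - u).
Proof. by move=> Du Dv; rewrite -opprB nrm2N//; exact: si_domB. Qed.

Lemma nrm20 : nrm2 B 0 = 0.
Proof. by rewrite /nrm2 si0r. Qed.

Lemma nrm2_parallelogram u v : D u -> D v ->
  nrm2 B (u + v) + nrm2 B (u - v) = 2 * nrm2 B u + 2 * nrm2 B v.
Proof. by move=> Du Dv; rewrite nrm2D// nrm2B//; ring. Qed.

Lemma nrm2D_le u v : D u -> D v ->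
  nrm2 B (u + v) <= 2 * nrm2 B u + 2 * nrm2 B v.
Proof.
by move=> Du Dv; rewrite -nrm2_parallelogram// lerDl (si_ge0 siB)//; exact: si_domB.
Qed.

Lemma nrm2B_le u v w : D u -> D v -> D w ->
  nrm2 B (u - w) <= 2 * nrm2 B (u - v) + 2 * nrm2 B (v - w).
Proof.
move=> Du Dv Dw; rewrite (_ : u - w = (u - v) + (v - w)); last by rewrite addrA subrK.
by apply: nrm2D_le; exact: si_domB.
Qed.

(* The case [nrm2 B u = 0] needs unbounded multiples, hence the parameter [t]. *)
Lemma si_cauchy_schwarz u v : D u -> D v ->
  sqnormc (B u v) <= nrm2 B u * nrm2 B v.
Proof.
move=> Du Dv; set z := B u v; set p := nrm2 B u; set q := nrm2 B v.
have p0 : 0 <= p by exact: (si_ge0 siB).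
have q0 : 0 <= q by exact: (si_ge0 siB).
have key (t : R) : 0 <= q + t ^+ 2 * sqnormc z * p - 2 * t * sqnormc z.
  have : 0 <= nrm2 B (v - (t%:C * z) *: u).
    by apply: (si_ge0 siB) => //; apply: si_domB => //; exact: si_domZ.
  rewrite nrm2B//; last exact: si_domZ.
  rewrite nrm2Z// sqnormcM sqnormc_real siZr// (si_conj siB Du Dv) -/z -/p -/q.
  by rewrite -(mulrA t%:C) ReMl [z * _]mulrC mulJc /= mulrA.
have z0 := sqnormc_ge0 z.
have [p_eq0|p_neq0] := eqVneq p 0.
  have := key (q + 1); rewrite p_eq0 mulr0 addr0 mul0r.
  have [-> //|zn0] := eqVneq (sqnormc z) 0.
  have zgt0 : 0 < sqnormc z by rewrite lt_neqAle eq_sym zn0.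
  (* For this multiple, positivity would read 2 (q + 1) <= q. *)
  have := key ((q + 1) / sqnormc z); rewrite p_eq0 mulr0 addr0.
  by rewrite -mulrA divfK//; lra.
have pgt0 : 0 < p by rewrite lt_neqAle eq_sym p_neq0.
have := key p^-1; rewrite -(ler_pM2r pgt0) mul0r.
have -> : (q + p^-1 ^+ 2 * sqnormc z * p - 2 * p^-1 * sqnormc z) * p =
  p * q - sqnormc z by field.
by rewrite subr_ge0.
Qed.

Lemma nrm_triangle u v : D u -> D v -> nrm B (u + v) <= nrm B u + nrm B v.
Proof.
move=> Du Dv; have pu := si_ge0 siB Du; have pv := si_ge0 siB Dv.
rewrite -(@ler_pXn2r _ 2)// ?nnegrE ?addr_ge0 ?sqrtr_ge0//.
rewrite sqrrD /nrm !sqr_sqrtr// ?(si_ge0 siB)//; last exact: si_domD.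
rewrite nrm2D// -sqrtrM//.
have : Re (B u v) <= Num.sqrt (nrm2 B u * nrm2 B v).
  apply: le_trans (ler_norm _) _; rewrite -sqrtr_sqr; apply: ler_wsqrtr.
  exact: le_trans (sqr_Re_le _) (si_cauchy_schwarz Du Dv).
lra.
Qed.

Lemma nrm_dist u v : D u -> D v -> `|nrm B u - nrm B v| <= nrm B (u - v).
Proof.
move=> Du Dv; rewrite ler_norml; apply/andP; split.
  have := nrm_triangle Du (si_domB Dv Du); rewrite subrKC.
  by rewrite {1}/nrm /nrm nrm2_subC//; lra.
have := nrm_triangle Dv (si_domB Du Dv); rewrite subrKC; lra.
Qed.

(** [polar] evaluates [q] only at combinations of u and v, so membership of u and v in [D] is
    recovered from u = ((u + v) + (u - v)) / 2. As B u (i v) = i B u v, subtracting the value at u +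
    i v from that at u - i v yields four times the imaginary part. *)
Lemma polarE (q : qform R V) u v z :
  (forall u r, q u r <-> D u /\ r = nrm2 B u) ->
  polar q u v z <-> [/\ D u, D v & z = B u v].
Proof.
move=> qE; pose i : R[i] := 0 +i* 1.
have aux : D u -> D v -> forall a b c d,
  a = nrm2 B (u + v) -> b = nrm2 B (u - v) -> c = nrm2 B (u - i *: v) ->
  d = nrm2 B (u + i *: v) -> ((a - b) / 4) +i* ((c - d) / 4) = B u v.
  move=> Du Dv a b c d -> -> -> ->; have Div := si_domZ i Dv.
  rewrite !nrm2B// !nrm2D// siZr//.
  by case: (B u v) => x y /=; congr (_ +i* _); field.
split=> [[a [b [c [d [/qE[Da ea] /qE[Db eb] /qE[_ ec] /qE[_ ed] ->]]]]]|].
  have two : (2 : R[i]) != 0 by rewrite pnatr_eq0.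
  have Du : D u.
    have -> : u = (2 : R[i])^-1 *: ((u + v) + (u - v)).
      rewrite addrACA subrr addr0 -mulr2n -[u *+ 2]scaler_nat scalerA mulVf// scale1r//.
    by apply: si_domZ; exact: si_domD.
  have Dv : D v by rewrite -(addKr u v); apply: si_domD => //; exact: si_domN.
  by split=> //; exact: aux.
case=> Du Dv ->; have Div := si_domZ i Dv.
exists (nrm2 B (u + v)), (nrm2 B (u - v)), (nrm2 B (u - i *: v)), (nrm2 B (u + i *: v)).
by split; [apply/qE; split=> //; auto ..|rewrite (aux Du Dv)].
Qed.

End SemiInner.

(** * Nonnegative series through bounded partial sums *)

Section NonnegSeries.
Variable R : realType.
Implicit Types a b : nat -> R.

Lemma squeeze0 (T : Type) (F : set_system T) {FF : Filter F} (a b : T -> R) :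
  (forall n, 0 <= a n <= b n) -> b n @[n --> F] --> 0 -> a n @[n --> F] --> 0.
Proof.
by move=> ab b0; apply: (squeeze_cvgr _ (cvg_cst 0) b0); near=> n; exact: ab.
Unshelve. all: by end_near. Qed.

Lemma cvg_ext (T : Type) (F : set_system T) (a b : T -> R) (l : R) :
  a =1 b -> a n @[n --> F] --> l -> b n @[n --> F] --> l.
Proof. by move=> /funext ->. Qed.

Lemma cvg0_addZ (T : Type) (F : set_system T) {FF : Filter F} (x y : R)
    (a b : T -> R) :
  a n @[n --> F] --> 0 -> b n @[n --> F] --> 0 ->
  (x * a n + y * b n) @[n --> F] --> 0.
Proof.
move=> a0 b0; rewrite -[X in _ --> X](_ : x * 0 + y * 0 = 0); last by rewrite !mulr0 addr0.
by apply: cvgD; apply: cvgMr.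
Qed.

Lemma psum_nd a : (forall k, 0 <= a k) ->
  {homo (fun n => \sum_(k < n) a k) : n p / (n <= p)%N >-> n <= p}.
Proof.
move=> a0; apply: homo_leq => // [x y z|n]; first exact: le_trans.
by rewrite big_ord_recr /= lerDl.
Qed.

Lemma psum_cvg_ex a (M : R) : (forall k, 0 <= a k) ->
  (forall n, \sum_(k < n) a k <= M) ->
  exists2 l, \sum_(k < n) a k @[n --> \oo] --> l & l <= M.
Proof.
move=> a0 aM; have nd := psum_nd a0.
have cv : cvgn (fun n => \sum_(k < n) a k).
  by apply: nondecreasing_is_cvgn => //; exists M => _ [n _ <-].
exists (limn (fun n => \sum_(k < n) a k)) => //.
by apply: limr_le => //; near=> n; exact: aM.
Unshelve. all: by end_near. Qed.

Lemma psum_le_lim a (l : R) : (forall k, 0 <= a k) ->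
  \sum_(k < n) a k @[n --> \oo] --> l -> forall n, \sum_(k < n) a k <= l.
Proof.
move=> a0 al n; rewrite -(cvg_lim _ al)//.
apply: (@nondecreasing_cvgn_le _ (fun n => \sum_(k < n) a k)).
  exact: psum_nd.
by apply/cvg_ex; exists l.
Qed.

Lemma psum_lim_le a (l M : R) : \sum_(k < n) a k @[n --> \oo] --> l ->
  (forall n, \sum_(k < n) a k <= M) -> l <= M.
Proof.
move=> al aM; rewrite -(cvg_lim _ al)//; apply: limr_le; first by apply/cvg_ex; exists l.
by near=> n; exact: aM.
Unshelve. all: by end_near. Qed.

Lemma term_le_psum a k n : (forall k, 0 <= a k) -> (k < n)%N ->
  a k <= \sum_(i < n) a i.
Proof.
by move=> a0 kn; rewrite (bigD1 (Ordinal kn)) //= lerDl sumr_ge0.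
Qed.

Lemma nneseries_leP a (M : R) : (forall k, 0 <= a k) ->
  (\sum_(k <oo) (a k)%:E <= M%:E)%E <-> forall n, \sum_(k < n) a k <= M.
Proof.
move=> a0; have a0' k : (0 <= k)%N -> true -> (0 <= (a k)%:E)%E by rewrite lee_fin.
split=> [aM n|aM].
  rewrite -lee_fin -sumEFin -(big_mkord xpredT (fun k => (a k)%:E)).
  by apply: le_trans aM; exact: nneseries_lim_ge.
apply: lime_le; first exact: is_cvg_nneseries.
by near=> n; rewrite big_mkord sumEFin lee_fin.
Unshelve. all: by end_near. Qed.

(** Trades finiteness of an extended-real sum, in which square summability is defined, for a real
    bound on partial sums, in which all estimates are made. *)
Lemma nneseries_ltP a : (forall k, 0 <= a k) ->
  (\sum_(k <oo) (a k)%:E < +oo)%E <-> exists M, forall n, \sum_(k < n) a k <= M.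
Proof.
move=> a0; split=> [lt|[M /(nneseries_leP M a0) aM]]; last exact: le_lt_trans aM (ltry _).
exists (fine (\sum_(k <oo) (a k)%:E)%E); apply/nneseries_leP => //.
by rewrite fineK// ge0_fin_numE//; apply: nneseries_ge0 => k _ _; rewrite lee_fin.
Qed.

End NonnegSeries.

(** * Limits of complex sequences *)

Section ComplexLimits.
Variable R : realType.

Lemma cauchy_real (x : nat -> R) :
  (forall eps : R, 0 < eps -> exists N, forall n p, (N <= n)%N -> (N <= p)%N ->
    `|x n - x p| <= eps) -> exists l : R, x n @[n --> \oo] --> l.
Proof.
move=> cx; suff : cvgn x by move=> /cvg_ex.
apply: cauchy_cvg; apply: cauchy_exP => eps eps0.
have e2 : 0 < eps / 2 by rewrite divr_gt0.
have [N xN] := cx _ e2; exists (x N); exists N => // n /= nN; rewrite -ball_normE /ball_ /=.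
by apply: (le_lt_trans (xN N n (leqnn N) nN)); lra.
Qed.

Lemma sqr_cvg0 (T : Type) (F : set_system T) {FF : Filter F} (x : T -> R) (a : R) :
  (x n - a) ^+ 2 @[n --> F] --> 0 <-> x n @[n --> F] --> a.
Proof.
split=> [h|h].
  have s0 : Num.sqrt ((x n - a) ^+ 2) @[n --> F] --> 0.
    rewrite -[X in _ --> X](@sqrtr0 R).
    exact: (continuous_cvg _ (@sqrt_continuous R _) h).
  apply/cvgrPdist_le => e e0; have /cvgrPdist_le/(_ e e0) := s0.
  by apply: filterS => n; rewrite sub0r normrN sqrtr_sqr normr_id distrC.
have h0 : (x n - a) @[n --> F] --> 0.
  by rewrite -(subrr a); apply: cvgB => //; exact: cvg_cst.
rewrite -[X in _ --> X](mulr0 0) (_ : (fun n => _) = (fun n => (x n - a) * (x n - a))).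
  exact: cvgM.
by apply/funext => n; rewrite expr2.
Qed.

(** Complex convergence is always expressed by the squared modulus of the difference, since that is
    what Cauchy-Schwarz controls. *)
Lemma sqnormc_cvg0 (T : Type) (F : set_system T) {FF : Filter F}
    (z : T -> R[i]) (a : R[i]) :
  sqnormc (z n - a) @[n --> F] --> 0 <->
  Re (z n) @[n --> F] --> Re a /\ Im (z n) @[n --> F] --> Im a.
Proof.
split=> [h|[/sqr_cvg0 h1 /sqr_cvg0 h2]].
  split; apply/sqr_cvg0; apply: squeeze0 _ h => n; rewrite sqr_ge0 /=.
    by rewrite -ReN -ReD sqr_Re_le.
  by rewrite -ImN -ImD sqr_Im_le.
apply: cvg_ext (cvg0_addZ 1 1 h1 h2) => n.
by rewrite !mul1r /sqnormc ReD ImD ReN ImN.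
Qed.

Lemma sqnormc_cvg (T : Type) (F : set_system T) {FF : Filter F}
    (z : T -> R[i]) (a b : R[i]) : sqnormc (z n - a) @[n --> F] --> 0 ->
  sqnormc (z n - b) @[n --> F] --> sqnormc (a - b).
Proof.
move=> /sqnormc_cvg0[h1 h2]; rewrite /sqnormc !ReD !ImD !ReN !ImN.
apply: (@cvg_ext _ _ _ (fun n => (Re (z n) - Re b) * (Re (z n) - Re b) +
   (Im (z n) - Im b) * (Im (z n) - Im b))).
  by move=> n; rewrite ReD ImD ReN ImN !expr2.
by rewrite !expr2; apply: cvgD; apply: cvgM; apply: cvgB => //; exact: cvg_cst.
Qed.

Lemma cauchy_complex (z : nat -> R[i]) :
  (forall eps : R, 0 < eps -> exists N, forall n p, (N <= n)%N -> (N <= p)%N ->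
    sqnormc (z n - z p) <= eps) ->
  exists a, sqnormc (z n - a) @[n --> \oo] --> 0.
Proof.
move=> cz.
have sq (x y : R) : 0 < y -> x ^+ 2 <= y ^+ 2 -> `|x| <= y.
  move=> y0; rewrite -real_normK ?num_real// ler_pXn2r// ?nnegrE// ltW//.
have [a ha] : exists a : R, Re (z n) @[n --> \oo] --> a.
  apply: cauchy_real => eps e0; have [|N zN] := cz (eps ^+ 2); first by rewrite exprn_gt0.
  exists N => n p nN pN; apply: sq => //; apply: le_trans (zN n p nN pN).
  by rewrite -ReN -ReD sqr_Re_le.
have [b hb] : exists b : R, Im (z n) @[n --> \oo] --> b.
  apply: cauchy_real => eps e0; have [|N zN] := cz (eps ^+ 2); first by rewrite exprn_gt0.
  exists N => n p nN pN; apply: sq => //; apply: le_trans (zN n p nN pN).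
  by rewrite -ImN -ImD sqr_Im_le.
by exists (a +i* b); apply/sqnormc_cvg0.
Qed.

(** The finite form of Fatou's lemma: for fixed [K] the bound passes to the limit term by term. The
    filter is arbitrary because both [\oo] and an ultrafilter occur. *)
Lemma weighted_sum_lim (T : Type) (F : set_system T) {FF : ProperFilter F} (W : nat -> R)
    (z : T -> nat -> R[i]) (a b : nat -> R[i]) K (M : R) :
  (forall k, sqnormc (z n k - a k) @[n --> F] --> 0) ->
  (\forall n \near F, \sum_(k < K) W k * sqnormc (z n k - b k) <= M) ->
  \sum_(k < K) W k * sqnormc (a k - b k) <= M.
Proof.
move=> za zM.
have c : \sum_(k < K) W k * sqnormc (z n k - b k) @[n --> F] -->
         \sum_(k < K) W k * sqnormc (a k - b k).
  apply: cvg_big => [|k _]; first exact: add_continuous.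
  by apply: cvgMr; exact: sqnormc_cvg.
rewrite -(cvg_lim _ c)//; apply: limr_le => //.
by apply/cvg_ex; eexists; exact: c.
Qed.

End ComplexLimits.

(** * Continuity of a semi-inner product along convergent families *)

Section FormLimits.
Variables (R : realType) (V : lmodType R[i]) (D : set V) (B : V -> V -> R[i]).
Hypothesis siB : semi_inner D B.

Lemma sqnormc_cvg_unique (T : Type) (F : set_system T) {FF : ProperFilter F}
    (z : T -> R[i]) (a b : R[i]) :
  sqnormc (z n - a) @[n --> F] --> 0 -> sqnormc (z n - b) @[n --> F] --> 0 ->
  a = b.
Proof.
move=> za zb; apply/eqP; rewrite -subr_eq0 -sqnormc_eq0; apply/eqP.
have c : sqnormc (a - b) @[_ --> F] --> (0 : R).
  apply: squeeze0 _ (cvg0_addZ 2 2 za zb) => n; rewrite sqnormc_ge0 /=.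
  rewrite -[sqnormc (z n - a)]sqnormcN (_ : a - b = - (z n - a) + (z n - b)).
    exact: le_sqnormcD.
  by rewrite opprB addrA subrK.
by have := cvg_unique _ c (cvg_cst (sqnormc (a - b))) => ->.
Qed.

Variables (T : Type) (F : set_system T).
Context {FF : ProperFilter F}.
Variables (s : T -> V) (u : V).
Hypotheses (Ds : forall n, D (s n)) (Du : D u).
Hypothesis su : nrm2 B (s n - u) @[n --> F] --> 0.

Lemma form_cvg w : D w -> sqnormc (B w (s n) - B w u) @[n --> F] --> 0.
Proof.
move=> Dw; apply: squeeze0 _ (cvg0_addZ (nrm2 B w) 0 su su) => n.
rewrite sqnormc_ge0 mul0r addr0 -(siBr siB)//.
by apply: (si_cauchy_schwarz siB) => //; exact: (si_domB siB).
Qed.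

Lemma nrm2_cvg : nrm2 B (s n) @[n --> F] --> nrm2 B u.
Proof.
have s0 : nrm B (s n - u) @[n --> F] --> 0.
  rewrite -[X in _ --> X](@sqrtr0 R).
  exact: (continuous_cvg _ (@sqrt_continuous R _) su).
have c : nrm B (s n) @[n --> F] --> nrm B u.
  apply/cvgrPdist_le => e e0; have /cvgrPdist_le/(_ e e0) := s0.
  apply: filterS => n; rewrite sub0r normrN ger0_norm ?sqrtr_ge0//.
  by apply: le_trans; rewrite distrC; exact: (nrm_dist siB).
have sq v : D v -> nrm2 B v = nrm B v * nrm B v.
  by move=> Dv; rewrite -expr2 sqr_sqrtr ?(si_ge0 siB).
rewrite sq// (_ : (fun n => _) = (fun n => nrm B (s n) * nrm B (s n))); first exact: cvgM.
by apply/funext => n; rewrite sq.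
Qed.

End FormLimits.

(** * Finite sums of orthogonal vectors *)

Section OrthogonalSums.
Variables (R : realType) (V : lmodType R[i]) (D : set V) (B : V -> V -> R[i]).
Hypothesis siB : semi_inner D B.
Variables (f : nat -> V) (l : nat -> R).
Hypothesis Df : forall k, D (f k).
Hypothesis Bf : forall i j, B (f i) (f j) = if i == j then (l i)%:C else 0.
Implicit Type x : nat -> R[i].

Let Dxf x k : D (x k *: f k). Proof. exact: (si_domZ siB). Qed.

(** The squared lengths [l] are kept general: they are 1 for the Hilbert space product and the
    eigenvalues for the form. *)
Lemma orth_coord x n i :
  B (f i) (\sum_(k < n) x k *: f k) = if (i < n)%N then (l i)%:C * x i else 0.
Proof.
rewrite (si_sumr siB n (F := fun k => x k *: f k))//.
have E (k : 'I_n) : B (f i) (x k *: f k) = if i == k then (l i)%:C * x i else 0.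
  rewrite (siZr siB)// Bf; case: eqP => [->|_]; last by rewrite mulr0.
  by rewrite mulrC.
rewrite (eq_bigr _ (fun k _ => E k)); case: ifPn => [lt|ge].
  rewrite (bigD1 (Ordinal lt)) //= eqxx big1 ?addr0// => k /negP h.
  by case: eqP => // ik; case: h; apply/eqP/val_inj.
rewrite big1// => k _; case: eqP => // ik; move: ge; by rewrite ik ltn_ord.
Qed.

Lemma orth_nrm2 x n :
  nrm2 B (\sum_(k < n) x k *: f k) = \sum_(k < n) l k * sqnormc (x k).
Proof.
rewrite /nrm2 (si_suml siB n (F := fun k => x k *: f k))//; last first.
  by apply: (si_dom_sum siB n (F := fun k => x k *: f k)).
rewrite Re_sum; apply: eq_bigr => k _.
rewrite (siZl siB)//; last exact: (si_dom_sum siB n (F := fun k => x k *: f k)).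
by rewrite orth_coord ltn_ord mulrCA mulJc ReMl.
Qed.

(** Pythagoras. The coefficients are given by a product rather than a quotient, so a vanishing [l k]
    is allowed. *)
Lemma orth_sub_nrm2 u x n : D u -> (forall k, B (f k) u = (l k)%:C * x k) ->
  nrm2 B (u - \sum_(k < n) x k *: f k) = nrm2 B u - \sum_(k < n) l k * sqnormc (x k).
Proof.
move=> Du fu; have Ds := si_dom_sum siB n (Dxf x).
rewrite (nrm2B siB)// orth_nrm2 (si_conj siB (u := \sum_(k < n) x k *: f k))// Re_conj.
rewrite (si_suml siB n (F := fun k => x k *: f k))// Re_sum.
rewrite [\sum_(k < n) Re _](eq_bigr (fun k : 'I_n => l k * sqnormc (x k))); first by ring.
by move=> k _; rewrite (siZl siB)// fu mulrCA mulJc ReMl.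
Qed.

End OrthogonalSums.

(** Padding with zeros makes a block of terms a partial sum again, to which the norm formula for
    orthogonal sums applies. *)
Lemma psum_diff (W : zmodType) (F : nat -> W) p n : (p <= n)%N ->
  \sum_(k < n) F k - \sum_(k < p) F k = \sum_(k < n) (if (p <= k)%N then F k else 0).
Proof.
move=> pn; rewrite (big_ord_widen n F pn) [X in _ - X]big_mkcond /= -sumrB.
by apply: eq_bigr => k _; rewrite [(p <= k)%N]leqNgt; case: (k < p)%N; rewrite /= ?subrr ?subr0.
Qed.

(** * Hilbert bases, Bessel's inequality and completeness *)

Section HilbertBasis.
Variables (R : realType) (V : lmodType R[i]) (dot : V -> V -> R[i]).

Definition orthonormal (f : nat -> V) := forall i j, dot (f i) (f j) = (i == j)%:R.

(* [hb_ex] is the Riesz-Fischer property. *)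
Record hilbert_basis (e : nat -> V) := HilbertBasis {
  hb_si : semi_inner setT dot;
  hb_orth : orthonormal e;
  hb_parseval : forall u,
    \sum_(k < n) sqnormc (dot (e k) u) @[n --> \oo] --> nrm2 dot u;
  hb_ex : forall (x : nat -> R[i]) (M : R), (forall n, \sum_(k < n) sqnormc (x k) <= M) ->
    exists u, forall k, dot (e k) u = x k;
  hb_nondeg : forall u, nrm2 dot u = 0 -> u = 0 }.

Section Bessel.
Hypothesis siD : semi_inner setT dot.
Variable f : nat -> V.
Hypothesis of_ : orthonormal f.

Lemma orthonormal_if i j : dot (f i) (f j) = if i == j then (1 : R)%:C else 0.
Proof. by rewrite of_; case: eqP. Qed.

Lemma onb_nrm2 (x : nat -> R[i]) n :
  nrm2 dot (\sum_(k < n) x k *: f k) = \sum_(k < n) sqnormc (x k).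
Proof.
rewrite (orth_nrm2 siD _ orthonormal_if)//.
by apply: eq_bigr => k _; rewrite mul1r.
Qed.

Lemma onb_coord (x : nat -> R[i]) n i :
  dot (f i) (\sum_(k < n) x k *: f k) = if (i < n)%N then x i else 0.
Proof. by rewrite (orth_coord siD _ orthonormal_if)// mul1r. Qed.

Lemma onb_sub_nrm2 u n :
  nrm2 dot (u - \sum_(k < n) dot (f k) u *: f k) =
  nrm2 dot u - \sum_(k < n) sqnormc (dot (f k) u).
Proof.
rewrite (orth_sub_nrm2 (x := fun k => dot (f k) u) siD _ orthonormal_if)//; last by move=> k; rewrite mul1r.
by congr (_ - _); apply: eq_bigr => k _; rewrite mul1r.
Qed.

Lemma bessel u n : \sum_(k < n) sqnormc (dot (f k) u) <= nrm2 dot u.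
Proof. by rewrite -subr_ge0 -onb_sub_nrm2 (si_ge0 siD). Qed.

End Bessel.

Section Complete.
Variable e : nat -> V.
Hypothesis hbe : hilbert_basis e.
Let siD := hb_si hbe.

Lemma hb_ext u v : (forall k, dot (e k) u = dot (e k) v) -> u = v.
Proof.
move=> uv; apply/eqP; rewrite -subr_eq0; apply/eqP/(hb_nondeg hbe).
have /cvg_unique := @hb_parseval _ hbe (u - v); apply => //.
apply: cvg_ext (cvg_cst 0) => n; rewrite big1// => k _.
by rewrite (siBr siD)// uv subrr sqnormc0.
Qed.

Definition cauchy_nrm2 (q : V -> R) (s : nat -> V) :=
  forall eps : R, 0 < eps -> exists N, forall n p, (N <= n)%N -> (N <= p)%N ->
    q (s n - s p) <= eps.

(* Lower semicontinuity: a partial sum of [nrm2 (u - s p)] is the limit of those of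
   [nrm2 (s n - s p)]. *)
Lemma hb_complete s : cauchy_nrm2 (nrm2 dot) s ->
  exists u, nrm2 dot (s n - u) @[n --> \oo] --> 0.
Proof.
move=> cs.
have [a ha] : {a : nat -> R[i] &
    forall k, sqnormc (dot (e k) (s n) - a k) @[n --> \oo] --> 0}.
  apply: (@choice _ _ (fun k a => sqnormc (dot (e k) (s n) - a) @[n --> \oo] --> 0)) => k.
  apply: cauchy_complex => eps e0; have [N sN] := cs _ e0.
  exists N => n p nN pN; rewrite -(siBr siD)//; apply: le_trans (sN n p nN pN).
  apply: le_trans (bessel siD (hb_orth hbe) _ k.+1).
  by apply: (term_le_psum (a := fun k => sqnormc (dot (e k) _))) => // i; exact: sqnormc_ge0.
have fat eps N p : (forall n, (N <= n)%N -> nrm2 dot (s n - s p) <= eps) ->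
    forall K, \sum_(k < K) sqnormc (a k - dot (e k) (s p)) <= eps.
  move=> sN K; under eq_bigr do rewrite -[sqnormc _]mul1r.
  apply: (@weighted_sum_lim _ _ \oo _ (fun=> 1) (fun n k => dot (e k) (s n)) a
    (fun k => dot (e k) (s p))) => //.
  near=> n; apply: le_trans (sN n _); last by near: n; exact: nbhs_infty_ge.
  apply: le_trans (bessel siD (hb_orth hbe) _ K); apply: ler_sum => k _.
  by rewrite mul1r (siBr siD).
(* One Cauchy index is enough for the limit coordinates to be square summable: they lie at squared
   distance at most 1 from those of [s N]. *)
have [N sN] := cs 1 ltr01.
have [u hu] : exists u, forall k, dot (e k) u = a k.
  apply: (hb_ex hbe (M := 2 * 1 + 2 * nrm2 dot (s N))) => K.
  apply: le_trans (_ : \sum_(k < K) (2 * sqnormc (a k - dot (e k) (s N)) +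
     2 * sqnormc (dot (e k) (s N))) <= _).
    by apply: ler_sum => k _; rewrite -{1}(subrK (dot (e k) (s N)) (a k)) le_sqnormcD.
  rewrite big_split /= -!mulr_sumr lerD ?ler_pM2l//; last exact: bessel (hb_orth hbe) _ _.
  by apply: (fat _ N) => n nN; exact: sN.
exists u; apply/cvgrPdist_le => eps e0; have [N1 sN1] := cs _ e0.
near=> p; rewrite sub0r normrN ger0_norm ?(si_ge0 siD)//.
rewrite (nrm2_subC siD)//; apply: (@psum_lim_le _ (fun k => sqnormc (dot (e k) (u - s p))) _ _ (@hb_parseval _ hbe (u - s p))) => K.
under eq_bigr => k _ do rewrite (siBr siD)// hu.
apply: (fat _ N1) => n nN; apply: sN1 => //.
by near: p; exact: nbhs_infty_ge.
Unshelve. all: by end_near. Qed.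

End Complete.

End HilbertBasis.

(** * Convergence of orthogonal series *)

Section OrthogonalSeries.
Variables (R : realType) (V : lmodType R[i]).

Lemma psum_cauchy (a : nat -> R) (M : R) : (forall k, 0 <= a k) ->
  (forall n, \sum_(k < n) a k <= M) -> forall eps : R, 0 < eps ->
  exists N, forall n p, (N <= p)%N -> (p <= n)%N ->
    \sum_(k < n) a k - \sum_(k < p) a k <= eps.
Proof.
move=> a0 aM eps e0; have [l al _] := psum_cvg_ex a0 aM.
have /cvgrPdist_le/(_ _ e0)[N _ aN] := al; exists N => n p Np pn.
have := aN p Np; have := psum_le_lim a0 al n; have := psum_le_lim a0 al p => /=.
by move=> h1 h2; rewrite ger0_norm; lra.
Qed.

(** By Pythagoras the squared norm of a block is a block of a convergent real series. It is used for
    the Hilbert space product and, in the description of the generator, for the form. *)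
Lemma orth_cauchy (D : set V) (B : V -> V -> R[i]) (f : nat -> V) (l : nat -> R)
    (x : nat -> R[i]) (M : R) :
  semi_inner D B -> (forall k, D (f k)) ->
  (forall i j, B (f i) (f j) = if i == j then (l i)%:C else 0) ->
  (forall k, 0 <= l k) -> (forall n, \sum_(k < n) l k * sqnormc (x k) <= M) ->
  cauchy_nrm2 (nrm2 B) (fun n => \sum_(k < n) x k *: f k).
Proof.
move=> siB Df Bf l0 xM eps e0.
have a0 k : 0 <= l k * sqnormc (x k) by rewrite mulr_ge0 ?sqnormc_ge0.
have Dxf k : D (x k *: f k) by exact: (si_domZ siB).
have [N xN] := psum_cauchy a0 xM e0; exists N.
suff le n p : (N <= p)%N -> (p <= n)%N ->
    nrm2 B (\sum_(k < n) x k *: f k - \sum_(k < p) x k *: f k) <= eps.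
  move=> n p Nn Np; have [pn|/ltnW np] := leqP p n; first exact: le.
  by rewrite (nrm2_subC siB); [exact: le|exact: (si_dom_sum siB _ Dxf)..].
move=> Np pn; apply: le_trans (xN n p Np pn).
rewrite (psum_diff (fun k => x k *: f k))// (psum_diff (fun k => l k * sqnormc (x k)))//.
rewrite (eq_bigr (fun k : 'I_n => (if (p <= k)%N then x k else 0) *: f k)).
  rewrite (orth_nrm2 siB Df Bf (fun k => if (p <= k)%N then x k else 0)).
  by apply: ler_sum => k _; case: ifP; rewrite ?sqnormc0 ?mulr0.
by move=> k _; case: ifP => //; rewrite scale0r.
Qed.

Variables (dot : V -> V -> R[i]) (e : nat -> V).
Hypothesis hbe : hilbert_basis dot e.
Let siD := hb_si hbe.

Lemma onb_series_ex (f : nat -> V) (x : nat -> R[i]) (M : R) : orthonormal dot f ->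
  (forall n, \sum_(k < n) sqnormc (x k) <= M) ->
  exists2 u, forall k, dot (f k) u = x k &
    nrm2 dot (\sum_(k < n) x k *: f k - u) @[n --> \oo] --> 0.
Proof.
move=> of_ xM.
have [u su] : exists u, nrm2 dot (\sum_(k < n) x k *: f k - u) @[n --> \oo] --> 0.
  apply: (hb_complete hbe (s := fun n => \sum_(k < n) x k *: f k)).
  apply: (@orth_cauchy _ _ f (fun=> 1) x M siD _ (orthonormal_if of_)) => // n.
  by under eq_bigr do rewrite mul1r.
exists u => // k.
have h := form_cvg siD (FF := eventually_filter) (fun=> I) I su (w := f k) I.
apply: (sqnormc_cvg_unique h (F := \oo)).
apply: cvg_near_cst; exists k.+1 => // n /= kn.
by rewrite (onb_coord siD of_) kn subrr sqnormc0.
Qed.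

(** The space is complete because it has the basis [e]; hence the Fourier series of u along [f]
    converges, its sum has the coefficients of u, and totality identifies the two. *)
Lemma total_hilbert_basis (f : nat -> V) : orthonormal dot f ->
  (forall u, (forall k, dot (f k) u = 0) -> u = 0) -> hilbert_basis dot f.
Proof.
move=> of_ tot; split=> //.
- move=> u; have [v vu sv] := onb_series_ex (x := fun k => dot (f k) u) of_ (bessel siD of_ u).
  have <- : v = u.
    apply/eqP; rewrite -subr_eq0; apply/eqP/tot => k.
    by rewrite (siBr siD)// vu subrr.
  apply: cvg_ext (nrm2_cvg siD (fun=> I) I sv) => n.
  by rewrite (onb_nrm2 siD of_ (fun k => dot (f k) u)); apply: eq_bigr => k _; rewrite vu.
- by move=> x M xM; have [u xu _] := onb_series_ex of_ xM; exists u.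
- exact: (hb_nondeg hbe).
Qed.

Lemma hb_expansion u :
  nrm2 dot (\sum_(k < n) dot (e k) u *: e k - u) @[n --> \oo] --> 0.
Proof.
have [v vu] := onb_series_ex (x := fun k => dot (e k) u) (hb_orth hbe) (bessel siD (hb_orth hbe) u).
by rewrite (hb_ext hbe vu).
Qed.

Lemma nrm2_le_coord u (M : R) :
  (forall n, \sum_(k < n) sqnormc (dot (e k) u) <= M) -> nrm2 dot u <= M.
Proof. by move=> h; exact: (@psum_lim_le _ (fun k => sqnormc (dot (e k) u)) _ _ (@hb_parseval _ _ _ _ hbe u)). Qed.

End OrthogonalSeries.

(** * Operators diagonal in a Hilbert basis, and their spectrum *)

Section DiagonalOperator.
Variables (R : realType) (V : lmodType R[i]) (dot : V -> V -> R[i]) (f : nat -> V).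
Hypothesis hbf : hilbert_basis dot f.
Let siD := hb_si hbf.

Lemma diag_mult_ex (g : nat -> R[i]) (K : R) : (forall n, sqnormc (g n) <= K) ->
  exists2 T : V -> V, bounded_linear dot T &
    forall u n, dot (f n) (T u) = g n * dot (f n) u.
Proof.
move=> gK.
have bd u n : \sum_(k < n) sqnormc (g k * dot (f k) u) <= K * nrm2 dot u.
  apply: le_trans (_ : K * \sum_(k < n) sqnormc (dot (f k) u) <= _).
    rewrite mulr_sumr; apply: ler_sum => k _.
    by rewrite sqnormcM ler_wpM2r// sqnormc_ge0.
  by rewrite ler_wpM2l ?(bessel siD (hb_orth hbf))// (le_trans _ (gK 0%N))// sqnormc_ge0.
have [T TE] := choice (fun u => hb_ex hbf (x := fun k => g k * dot (f k) u) (bd u)).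
exists T => //; split.
  move=> a u v; apply: (hb_ext hbf) => k.
  by rewrite TE !(si_linear siD)// !TE mulrDr mulrCA.
exists (Num.sqrt K) => u; rewrite /nrm -sqrtrM; last first.
  by rewrite (le_trans _ (gK 0%N))// sqnormc_ge0.
apply: ler_wsqrtr; apply: (nrm2_le_coord hbf) => n.
by apply: le_trans (bd u n); apply: ler_sum => k _; rewrite TE.
Qed.

(** Dominated convergence: beyond some [N] the tail is below eps / 2 uniformly in t thanks to [a],
    and the finitely many earlier coordinates tend to 0. *)
Lemma dominated_nrm (F : set_system R) (FF : ProperFilter F) (w : R -> V)
    (a : nat -> R) (M : R) :
  (forall n, \sum_(k < n) a k <= M) ->
  (\forall t \near F, forall n, sqnormc (dot (f n) (w t)) <= a n) ->
  (forall n, sqnormc (dot (f n) (w t)) @[t --> F] --> 0) ->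
  nrm dot (w t) @[t --> F] --> 0.
Proof.
move=> aM wa w0.
have a0 n : 0 <= a n.
  by have [t ta] := filter_ex wa; exact: le_trans (sqnormc_ge0 _) (ta n).
suff h : nrm2 dot (w t) @[t --> F] --> 0.
  rewrite -[X in _ --> X](@sqrtr0 R).
  exact: (continuous_cvg _ (@sqrt_continuous R _) h).
apply/cvgrPdist_le => eps e0; have e2 : 0 < eps / 2 by rewrite divr_gt0.
have [N aN] := psum_cauchy a0 aM e2.
have : \sum_(k < N) sqnormc (dot (f k) (w t)) @[t --> F] --> 0.
  rewrite [X in _ --> X](_ : _ = \sum_(k < N) (0 : R)); last by rewrite big1.
  by apply: cvg_big => [|k _]; [exact: add_continuous|exact: w0].
move=> /cvgrPdist_le/(_ _ e2) hN; near=> t.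
rewrite sub0r normrN ger0_norm ?(si_ge0 siD)//.
have ba : forall k, sqnormc (dot (f k) (w t)) <= a k by near: t.
pose b k := sqnormc (dot (f k) (w t)).
have b0 k : 0 <= b k by exact: sqnormc_ge0.
have bN : \sum_(k < N) b k <= eps / 2.
  have : `|0 - \sum_(k < N) sqnormc (dot (f k) (w t))| <= eps / 2 by near: t.
  by rewrite sub0r normrN ger0_norm//; apply: sumr_ge0 => k _; exact: b0.
apply: (nrm2_le_coord hbf) => K; have := psum_nd b0 (leq_maxl K N); have := aN (maxn K N) N (leqnn _) (leq_maxr _ _).
have := psum_diff b (leq_maxr K N); have := psum_diff a (leq_maxr K N) => -> h1 h2 h3.
have : \sum_(k < maxn K N) (if (N <= k)%N then b k else 0) <=
       \sum_(k < maxn K N) (if (N <= k)%N then a k else 0).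
  by apply: ler_sum => k _; case: ifP => // _; exact: ba.
by move=> h4; apply: le_trans h3 _; lra.
Unshelve. all: by end_near. Qed.

Lemma inner_series u v :
  \sum_(k < n) Re (conjc (dot (f k) u) * dot (f k) v) @[n --> \oo] --> Re (dot u v).
Proof.
have h := form_cvg siD (FF := eventually_filter) (fun=> I) I (hb_expansion hbf v) (w := u) I.
have /sqnormc_cvg0[hR _] := h; apply: cvg_ext hR => n.
rewrite (si_sumr siD n (F := fun k => dot (f k) v *: f k))// Re_sum.
by apply: eq_bigr => k _; rewrite (siZr siD)// mulrC (si_conj siD (u := f k)).
Qed.

Variables (l : nat -> R) (H : op V).
Hypothesis l_ge0 : forall n, 0 <= l n.
Hypothesis HE : forall u v, H u v <-> forall n, dot (f n) v = (l n)%:C * dot (f n) u.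
Hypothesis exp_sum : forall t : R, 0 < t ->
  exists M, forall n, \sum_(k < n) expR (- (t * l k)) <= M.

(** The terms exp (- l n) of a convergent series are eventually at most exp (- M). It is applied to
    the weights [W] as well as to eigenvalues. *)
Lemma eigenvalues_infty (M : R) : exists N, forall n, (N <= n)%N -> M <= l n.
Proof.
have [S sS] := exp_sum ltr01.
have [N hN] := psum_cauchy (fun k => expR_ge0 (- (1 * l k))) sS (expR_gt0 (- M)).
exists N => n Nn; have := hN n.+1 n Nn (leqnSn n).
by rewrite big_ord_recr /= addrAC subrr add0r mul1r ler_expR lerN2.
Qed.

(** The multipliers 1 / (z - l n) are bounded: beyond [N] the real part of l n - z is at least 1,
    and only finitely many indices remain. *)
Lemma resolvent_diag z : (forall n, z != (l n)%:C) -> resolvent_set dot H z.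
Proof.
move=> zl; have [N lN] := eigenvalues_infty (Re z + 1).
pose d n := z - (l n)%:C.
have d0 n : d n != 0 by rewrite subr_eq0.
have sV w : w != 0 -> sqnormc (w^-1) = (sqnormc w)^-1 :> R.
  move=> w0; have w0' : sqnormc w != 0 by rewrite sqnormc_eq0.
  by apply: (mulfI w0'); rewrite -sqnormcM !mulfV// sqnormc_real expr1n.
have sV0 n : 0 <= sqnormc (d n)^-1 by exact: sqnormc_ge0.
have [n|B Bbl BE] := @diag_mult_ex (fun n => (d n)^-1) (1 + \sum_(k < N) sqnormc (d k)^-1).
  have [Nn|nN] := leqP N n; last first.
    by apply: le_trans (term_le_psum (a := fun k => sqnormc (d k)^-1) sV0 nN) _; rewrite lerDr.
  apply: le_trans (_ : 1 <= _); last by rewrite lerDl sumr_ge0.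
  have h : 1 <= sqnormc (d n).
    apply: le_trans (sqr_Re_le _); rewrite /d ReD ReN /= -sqrrN expr_ge1//.
      by have := lN n Nn; lra.
    by have := lN n Nn; lra.
  by rewrite sV// invf_le1// (lt_le_trans ltr01).
exists B => // u v; split=> [<-|[w /HE wE <-]].
  exists (z *: B v - v); last by rewrite opprB addrCA subrr addr0.
  apply/HE => n; rewrite (siBr siD)// (siZr siD)// BE.
  apply/eqP; rewrite subr_eq; apply/eqP.
  have -> : dot (f n) v = d n * ((d n)^-1 * dot (f n) v) by rewrite mulrA mulfV// mul1r.
  by rewrite mulKf// /d; ring.
apply: (hb_ext hbf) => n; rewrite BE (siBr siD)// (siZr siD)// wE.
by rewrite -mulrBl mulrA mulVf ?mul1r.
Qed.

(** Only finitely many indices n have l n < l m + 1. This gives a gap around l m and also confines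
    its eigenspace to the span of finitely many basis vectors. *)
Lemma diagonal_discrete : discrete_spectrum dot H.
Proof.
have specP z : spectrum dot H z -> exists n, z = (l n)%:C.
  move=> sz; apply: contrapT => nz; apply: sz; apply: resolvent_diag => n.
  by apply/eqP => h; apply: nz; exists n.
move=> z /[dup] sz /specP[m zE]; have [N lN] := eigenvalues_infty (l m + 1).
(* Several indices may share the value l m, so the gap separates values and not indices. *)
have gap : exists2 eps : R, 0 < eps & forall n, (n < N)%N -> `|l n - l m| < eps -> l n = l m.
  elim: N {lN} => [|N [eps e0 IH]]; first by exists 1.
  have [E|nE] := eqVneq (l N) (l m).
    exists eps => // n; rewrite ltnS leq_eqVlt => /predU1P[-> //|]; exact: IH.
  exists (Num.min eps `|l N - l m|).
    by rewrite lt_min e0 normr_gt0 subr_eq0.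
  move=> n; rewrite ltnS leq_eqVlt lt_min => /predU1P[->|nN] /andP[h1 h2].
    by rewrite ltxx in h2.
  exact: IH.
split.
  have [eps e0 he] := gap; exists (Num.min eps 1); first by rewrite lt_min e0 ltr01.
  move=> _ /specP[n ->]; rewrite zE -rmorphB /= => h; congr (_%:C).
  have {}h : `|l n - l m| < Num.min eps 1.
    move: h; rewrite normc_def /= expr0n addr0 sqrtr_sqr ltcR//.
  have [Nn|nN] := leqP N n; last by apply: he => //; move: h; rewrite lt_min => /andP[].
  move: h; rewrite lt_min => /andP[_]; have := lN n Nn; rewrite ltr_norml; lra.
split.
  exists (f m).
    apply/eqP => f0; have := hb_orth hbf m m; rewrite eqxx f0 (si0r siD)// => /eqP.
    by rewrite eq_sym oner_eq0.
  by apply/HE => n; rewrite (siZr siD)// zE (hb_orth hbf); case: eqP => [->//|_]; rewrite !mulr0.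
exists N, (fun i : 'I_N => f i) => u /HE uE; exists (fun i => dot (f i) u).
apply: (hb_ext hbf) => n.
rewrite (onb_coord siD (hb_orth hbf) (fun i => dot (f i) u)); case: ltnP => // Nn.
apply/eqP; have /eqP := uE n; rewrite (siZr siD)// zE -subr_eq0 -mulrBl mulf_eq0.
case/orP => //; rewrite -rmorphB /= => /eqP[] h.
by have := lN n Nn; lra.
Qed.

End DiagonalOperator.

(** * The semigroup generated by a diagonal operator, and its trace *)

Section DiagonalSemigroup.
Variables (R : realType) (V : lmodType R[i]) (dot : V -> V -> R[i]) (f : nat -> V).
Hypothesis hbf : hilbert_basis dot f.
Let siD := hb_si hbf.
Variables (l : nat -> R) (H : op V).
Hypothesis l_ge0 : forall n, 0 <= l n.
Hypothesis HE : forall u v, H u v <-> forall n, dot (f n) v = (l n)%:C * dot (f n) u.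

(** The upper bound [a] dominates the difference quotients by the coefficients of the generator; the
    lower bound gives convergence in each coordinate with error O(t). *)
Lemma expRN_quotient_bounds (t a : R) : 0 < t -> 0 <= a ->
  [/\ 0 <= t^-1 * (1 - expR (- (t * a))), t^-1 * (1 - expR (- (t * a))) <= a
    & a - t * a ^+ 2 <= t^-1 * (1 - expR (- (t * a)))].
Proof.
move=> t0 a0; set x := t * a; have x0 : 0 <= x by rewrite mulr_ge0// ltW.
have h1 : expR (- x) <= 1 by rewrite -[leRHS]expR0 ler_expR oppr_le0.
have h2 : 1 - x <= expR (- x) by exact: expR_ge1Dx.
(* Compare (1 + x) exp (- x) <= 1 with (1 + x) (1 - x + x^2) = 1 + x^3 >= 1. *)
have h3 : expR (- x) <= 1 - x + x ^+ 2.
  have e0 := expR_gt0 (- x); have := expR_ge1Dx x.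
  have : expR x * expR (- x) = 1 by rewrite -expRD subrr expR0.
  move: (expR x) (expR (- x)) e0 => y z z0 yz yx.
  have h : (1 + x) * z <= 1 by rewrite -[leRHS]yz ler_wpM2r// ltW.
  have h' : 1 <= (1 + x) * (1 - x + x ^+ 2).
    have -> : (1 + x) * (1 - x + x ^+ 2) = 1 + x ^+ 3 by ring.
    by rewrite lerDl exprn_ge0.
  by rewrite -(@ler_pM2l _ (1 + x)) ?(le_trans h)//; lra.
have tV : t^-1 * x = a by rewrite /x mulKf// gt_eqF.
have tV0 : 0 <= t^-1 by rewrite invr_ge0 ltW.
split.
- by rewrite mulr_ge0// subr_ge0.
- by rewrite -[leRHS]tV ler_wpM2l//; lra.
- have -> : a - t * a ^+ 2 = t^-1 * (x - x ^+ 2).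
    by rewrite /x; field; rewrite gt_eqF.
  by rewrite ler_wpM2l//; lra.
Qed.

Lemma expRN_le1 (t a : R) : 0 <= t -> 0 <= a -> expR (- (t * a)) <= 1.
Proof. by move=> t0 a0; rewrite -[leRHS]expR0 ler_expR oppr_le0 mulr_ge0. Qed.

(** The absolute value keeps all multipliers at most 1, so that [T] is bounded at every real t; for
    t >= 0 it is the intended semigroup. *)
Lemma exp_mult_ex : exists T : R -> V -> V,
  (forall t, bounded_linear dot (T t)) /\
  forall t u n, dot (f n) (T t u) = (expR (- (`|t| * l n)))%:C * dot (f n) u.
Proof.
have ex (t : R) : exists T : V -> V, bounded_linear dot T /\
    forall u n, dot (f n) (T u) = (expR (- (`|t| * l n)))%:C * dot (f n) u.
  have [|T Tbl TE] := @diag_mult_ex _ _ _ _ hbf (fun n => (expR (- (`|t| * l n)))%:C) 1.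
    by move=> n; rewrite sqnormc_real exprn_ile1// ?expR_ge0// expRN_le1.
  by exists T.
have [T TP] := choice ex; exists T; split=> t; first by have [] := TP t.
by have [_] := TP t.
Qed.

Variable T : R -> V -> V.
Hypothesis Tbl : forall t, bounded_linear dot (T t).
Hypothesis TE : forall t u n,
  dot (f n) (T t u) = (expR (- (`|t| * l n)))%:C * dot (f n) u.

(** Domination by [b] is uniform in t, whereas the rate [K n] may depend on the coordinate. Both
    strong continuity and differentiability have this shape. *)
Lemma multiplier_cvg (w : R -> V) (c : R -> nat -> R) (z : nat -> R[i])
    (b K : nat -> R) (M : R) :
  (forall t n, 0 < t -> dot (f n) (w t) = (c t n)%:C * z n) ->
  (forall t n, 0 < t -> `|c t n| <= b n) ->
  (forall t n, 0 < t -> `|c t n| <= t * K n) ->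
  (forall n, \sum_(k < n) sqnormc ((b k)%:C * z k) <= M) ->
  nrm dot (w t) @[t --> 0^'+] --> 0.
Proof.
move=> wE cb cK bM.
have pos0 : \forall t \near (0 : R)^'+, 0 < t by exact: nbhs_right_gt.
have idcvg : t @[t --> (0 : R)^'+] --> (0 : R) by apply: cvg_within_filter; exact: cvg_id.
have sq_le (x y : R) (a : R[i]) : `|x| <= y -> sqnormc (x%:C * a) <= sqnormc (y%:C * a).
  move=> xy; rewrite !sqnormcM !sqnormc_real ler_wpM2r ?sqnormc_ge0//.
  by rewrite -[x ^+ 2]real_normK ?num_real// lerXn2r// ?nnegrE// (le_trans _ xy).
apply: (@dominated_nrm _ _ _ _ hbf (0 : R)^'+ _ w (fun k => sqnormc ((b k)%:C * z k)) M bM) => [|n].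
  by apply: filterS pos0 => t t0 n; rewrite wE// sq_le// cb.
have h : (K n ^+ 2 * sqnormc (z n)) * (t * t) @[t --> (0 : R)^'+] --> 0.
  rewrite -[X in _ --> X](mulr0 (K n ^+ 2 * sqnormc (z n))); apply: cvgMr.
  by rewrite -[X in _ --> X](mulr0 0); apply: cvgM.
apply: (squeeze_cvgr _ (cvg_cst 0) h); apply: filterS pos0 => t t0.
rewrite sqnormc_ge0 wE//=; apply: le_trans (sq_le _ _ _ (cK _ _ t0)) _.
by rewrite sqnormcM sqnormc_real le_eqVlt; apply/orP; left; apply/eqP; ring.
Unshelve. all: by end_near. Qed.

Lemma diagonal_exp_semigroup : exp_semigroup dot H T.
Proof.
have bes u := bessel siD (hb_orth hbf) u.
split.
- by move=> t _.
- by move=> u; apply: (hb_ext hbf) => n; rewrite TE normr0 mul0r oppr0 expR0 mul1r.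
- move=> s t u s0 t0; apply: (hb_ext hbf) => n.
  rewrite !TE mulrA -rmorphM /= -expRD !ger0_norm// ?addr_ge0//.
  by congr ((expR _)%:C * _); ring.
- move=> u.
  apply: (@multiplier_cvg _ (fun t n => expR (- (t * l n)) - 1) (fun n => dot (f n) u)
    (fun=> 1) l (nrm2 dot u)).
  + by move=> t n t0; rewrite (siBr siD)// TE gtr0_norm// rmorphB /= mulrBl mul1r.
  + move=> t n t0; have := expR_ge0 (- (t * l n)).
    by have := expRN_le1 (ltW t0) (l_ge0 n); rewrite ler_norml; lra.
  + move=> t n t0; have h := expRN_le1 (ltW t0) (l_ge0 n).
    rewrite distrC ger0_norm ?subr_ge0//.
    by have := expR_ge1Dx (- (t * l n)); lra.
  + by move=> n; under eq_bigr do rewrite mul1r; exact: bes.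
have QE t u n : 0 < t -> dot (f n) (t^-1%:C *: (u - T t u)) =
    (t^-1 * (1 - expR (- (t * l n))))%:C * dot (f n) u.
  move=> t0; rewrite (siZr siD)// (siBr siD)// TE gtr0_norm//.
  by rewrite rmorphM rmorphB /=; ring.
have Qcvg u v : H u v -> nrm dot (t^-1%:C *: (u - T t u) - v) @[t --> 0^'+] --> 0.
  move=> /HE uv.
  apply: (@multiplier_cvg _ (fun t n => t^-1 * (1 - expR (- (t * l n))) - l n)
    (fun n => dot (f n) u) l (fun n => l n ^+ 2) (nrm2 dot v)).
  + by move=> t n t0; rewrite (siBr siD)// QE// uv rmorphB /= mulrBl.
  + move=> t n t0; have [h1 h2 _] := expRN_quotient_bounds t0 (l_ge0 n).
    by rewrite ler_norml; lra.
  + move=> t n t0; have [h1 h2 h3] := expRN_quotient_bounds t0 (l_ge0 n).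
    by rewrite ler0_norm; lra.
  + by move=> n; under eq_bigr do rewrite -uv; exact: bes.
move=> u v; split; first exact: Qcvg.
move=> huv; apply/HE => n.
have coord w : nrm dot (w t) @[t --> (0 : R)^'+] --> 0 ->
    sqnormc (dot (f n) (w t)) @[t --> (0 : R)^'+] --> 0.
  move=> w0; apply: squeeze0 (_ : nrm dot (w t) * nrm dot (w t) @[t --> (0 : R)^'+] --> 0).
    move=> t; rewrite sqnormc_ge0 -expr2 sqr_sqrtr ?(si_ge0 siD)//=.
    rewrite (le_trans (si_cauchy_schwarz siD (u := f n) I I))//.
    by rewrite /nrm2 (hb_orth hbf) eqxx mul1r.
  by rewrite -[X in _ --> X](mulr0 0); apply: cvgM.
(* The eigenvector [un] has the same n-th difference quotient as u, and the direct implication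
   applies to it. Its limit and the assumed one must agree. *)
pose un := dot (f n) u *: f n.
have hn : H un ((l n)%:C *: un).
  apply/HE => k; rewrite /un !(siZr siD)// (hb_orth hbf).
  by case: eqP => [->//|_]; rewrite !mulr0.
have fn : dot (f n) (f n) = 1 by rewrite (hb_orth hbf) eqxx.
have := coord (fun t => _) (Qcvg _ _ hn); have := coord (fun t => _) huv.
set p := (X in X -> _); set q := (X in _ -> X -> _) => hp hq.
pose c (t : R) := (t^-1 * (1 - expR (- (t * l n))))%:C * dot (f n) u.
have pos0 : \forall t \near (0 : R)^'+, 0 < t by exact: nbhs_right_gt.
have h1 : sqnormc (c t - dot (f n) v) @[t --> (0 : R)^'+] --> 0.
  apply: cvg_trans hp; apply: near_eq_cvg; apply: filterS pos0 => t t0.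
  by rewrite (siBr siD)// QE.
have h2 : sqnormc (c t - (l n)%:C * dot (f n) u) @[t --> (0 : R)^'+] --> 0.
  apply: cvg_trans hq; apply: near_eq_cvg; apply: filterS pos0 => t t0.
  by rewrite (siBr siD)// QE// /un !(siZr siD)// fn !mulr1.
exact: sqnormc_cvg_unique h1 h2.
Qed.

(** After exchanging the two sums, Bessel's inequality for [b] applied to each unit vector f i
    bounds the trace by the sum of exp (- t l i). *)
Lemma diagonal_trace_lt (t : R) (b : nat -> V) (M : R) : 0 < t -> orthonormal dot b ->
  (forall n, \sum_(k < n) expR (- (t * l k)) <= M) ->
  (trace dot b (T t) < +oo)%E.
Proof.
move=> t0 ob tM; rewrite /trace; pose x k := Re (dot (b k) (T t (b k))).
pose d k n := expR (- (t * l n)) * sqnormc (dot (f n) (b k)).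
have d0 k n : 0 <= d k n by rewrite mulr_ge0 ?expR_ge0 ?sqnormc_ge0.
have dx k : \sum_(n < m) d k n @[m --> \oo] --> x k.
  apply: (cvg_ext _ (@inner_series _ _ _ _ hbf (b k) (T t (b k)))) => m; apply: eq_bigr => n _.
  by rewrite TE gtr0_norm// mulrCA mulJc ReMl.
have x0 k : 0 <= x k by have := psum_le_lim (d0 k) (dx k) 0; rewrite big_ord0.
rewrite -nneseries_esumT; last by move=> k; rewrite lee_fin; exact: x0.
apply/nneseries_ltP => //; exists M => n.
have c : \sum_(k < n) \sum_(i < m) d k i @[m --> \oo] --> \sum_(k < n) x k.
  by apply: cvg_big => [|k _]; [exact: add_continuous|exact: dx].
rewrite -(cvg_lim _ c)//; apply: limr_le; first by apply/cvg_ex; eexists; exact: c.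
near=> m; apply: le_trans (tM m); rewrite exchange_big /=; apply: ler_sum => i _.
rewrite -mulr_sumr -[leRHS]mulr1 ler_wpM2l ?expR_ge0//.
have fi : nrm2 dot (f i) = 1 by rewrite /nrm2 (hb_orth hbf) eqxx.
rewrite -fi; apply: le_trans (bessel siD ob (f i) n); apply: ler_sum => k _.
by rewrite -sqnormc_conj (si_conj siD (u := f i))// conjcK.
Unshelve. all: by end_near. Qed.

End DiagonalSemigroup.

(** * Limits of bounded families along an ultrafilter *)

Section UltrafilterLimits.
Variable R : realType.

(** Compactness of a segment yields a cluster point, and for an ultrafilter a cluster point is a
    limit. This takes the place of a diagonal extraction of subsequences. *)
Lemma ultra_bounded_cvg (T : Type) (U : set_system T) (UU : UltraFilter U)
    (x : T -> R) (r : R) : (forall j, `|x j| <= r) ->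
  exists l : R, x j @[j --> U] --> l.
Proof.
move=> xr.
have FA : (x j @[j --> U]) `[(- r), r]%classic.
  change (U (x @^-1` `[(- r), r]%classic)).
  by apply: filterE => j; have := xr j; rewrite ler_norml /= in_itv.
have [l [_ cl]] := segment_compact (fmap_proper_filter x _) FA; exists l => N lN.
have [//|UN] := in_ultra_setVsetC (x @^-1` N) UU.
by have [y [/= nN]] := cl _ _ (UN : (x j @[j --> U]) (~` N)) lN.
Qed.

Lemma ultra_bounded_cvg_complex (T : Type) (U : set_system T) (UU : UltraFilter U)
    (z : T -> R[i]) (r : R) : (forall j, sqnormc (z j) <= r) ->
  exists a : R[i], sqnormc (z j - a) @[j --> U] --> 0.
Proof.
move=> zr; have sq (y : R) : y ^+ 2 <= r -> `|y| <= Num.sqrt r.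
  by move=> h; rewrite -sqrtr_sqr ler_wsqrtr.
have [j|a ha] := ultra_bounded_cvg UU (x := fun j => Re (z j)) (r := Num.sqrt r).
  by apply: sq; apply: le_trans (zr j); exact: sqr_Re_le.
have [j|b hb] := ultra_bounded_cvg UU (x := fun j => Im (z j)) (r := Num.sqrt r).
  by apply: sq; apply: le_trans (zr j); exact: sqr_Im_le.
by exists (a +i* b); apply/sqnormc_cvg0.
Qed.

End UltrafilterLimits.

(** * Spectral theory of a form comparable with weights tending to infinity *)

Section FormSpectrum.
Variables (R : realType) (V : lmodType R[i]) (dot : V -> V -> R[i]) (e : nat -> V).
Hypothesis hbe : hilbert_basis dot e.
Let siD := hb_si hbe.
Variable W : nat -> R.
Hypothesis W_ge0 : forall k, 0 <= W k.
Hypothesis W_exp_sum : forall t : R, 0 < t ->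
  exists M, forall n, \sum_(k < n) expR (- (t * W k)) <= M.

(** The squared norm of a weighted l^2 space, given only through its upper bounds; this form is
    stable under coordinatewise limits. *)
Definition weight_le (u : V) (M : R) :=
  forall n, \sum_(k < n) W k * sqnormc (dot (e k) u) <= M.

Lemma weight_le_lin a u v (M K : R) : weight_le u M -> weight_le v K ->
  weight_le (a *: u + v) (2 * sqnormc a * M + 2 * K).
Proof.
move=> uM vK n; apply: le_trans (_ : \sum_(k < n)
    (2 * sqnormc a * (W k * sqnormc (dot (e k) u)) +
     2 * (W k * sqnormc (dot (e k) v))) <= _).
  apply: ler_sum => k _; rewrite (si_linear siD)// !(mulrCA _ (W k)) -mulrDr ler_wpM2l//.
  exact: sqnormcD_le.
rewrite big_split /= -!mulr_sumr lerD// ler_wpM2l ?mulr_ge0 ?sqnormc_ge0//.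
  exact: uM.
exact: vK.
Qed.

Lemma weight_le_sub u v (M K : R) : weight_le u M -> weight_le v K ->
  weight_le (u - v) (2 * M + 2 * K).
Proof.
move=> uM vK n; rewrite addrC -scaleN1r [2 * M + _]addrC.
have := weight_le_lin (- 1) vK uM n; rewrite sqnormcN sqnormc_real expr1n mulr1; exact.
Qed.

Lemma weight_le_cvg (F : set_system nat) (FF : ProperFilter F) (s : nat -> V) u v (M : R) :
  (forall k, sqnormc (dot (e k) (s j) - dot (e k) u) @[j --> F] --> 0) ->
  (\forall j \near F, weight_le (s j - v) M) -> weight_le (u - v) M.
Proof.
move=> su sM n.
rewrite (eq_bigr (fun k : 'I_n => W k * sqnormc (dot (e k) u - dot (e k) v))).
  apply: (@weighted_sum_lim _ _ F _ W (fun j k => dot (e k) (s j)) (fun k => dot (e k) u)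
    (fun k => dot (e k) v)) => //.
  apply: filterS sM => j /(_ n); congr (_ <= _).
  by apply: eq_bigr => k _; rewrite (siBr siD).
by move=> k _; rewrite (siBr siD).
Qed.

(* Rellich: bounded weights make the sequence precompact because [W] tends to infinity. *)
Lemma weight_compact (s : nat -> V) (M : R) :
  (forall j, nrm2 dot (s j) <= M) -> (forall j, weight_le (s j) M) ->
  exists u (phi : nat -> nat), (forall n, (n <= phi n)%N) /\
    nrm2 dot (s (phi n) - u) @[n --> \oo] --> 0.
Proof.
(* All coordinates converge simultaneously along an ultrafilter finer than [\oo]; a subsequence is
   extracted only at the end. *)
move=> sM sW; have [U [UU ooU]] := ultraFilterLemma (eventually_filter).
have M0 : 0 <= M by apply: le_trans (sM 0%N); exact: (si_ge0 siD).
have [x xP] : {x : nat -> R[i] &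
    forall k, sqnormc (dot (e k) (s j) - x k) @[j --> U] --> 0}.
  apply: (@choice _ _ (fun k a => sqnormc (dot (e k) (s j) - a) @[j --> U] --> 0)) => k.
  apply: (@ultra_bounded_cvg_complex _ _ _ _ _ M) => j; apply: le_trans (sM j).
  apply: le_trans (bessel siD (hb_orth hbe) (s j) k.+1).
  by apply: (term_le_psum (a := fun k => sqnormc (dot (e k) _))) => // i; exact: sqnormc_ge0.
have [u ux] : exists u, forall k, dot (e k) u = x k.
  apply: (hb_ex hbe (M := M)) => n.
  have := @weighted_sum_lim _ _ U _ (fun=> 1) (fun j k => dot (e k) (s j)) x (fun=> 0) n M xP.
  under eq_bigr do rewrite mul1r subr0; apply.
  apply: filterE => j; apply: le_trans (sM j).
  apply: le_trans (bessel siD (hb_orth hbe) (s j) n); apply: ler_sum => k _.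
  by rewrite mul1r subr0.
have su k : sqnormc (dot (e k) (s j) - dot (e k) u) @[j --> U] --> 0 by rewrite ux.
have uW : weight_le u M.
  rewrite -[u]subr0; apply: (weight_le_cvg _ su).
  by apply: filterE => j; rewrite subr0.
have cv : nrm2 dot (s j - u) @[j --> U] --> 0.
  apply/cvgrPdist_le => eps e0.
  (* The weighted sum for s j - u is at most 2 M + 2 M, so beyond [N] its plain sum is at most 4 M /
     w <= eps / 2. The added 1 keeps w positive when M = 0. *)
  have [N WN] := eigenvalues_infty W_exp_sum (8 * M / eps + 1).
  set w := 8 * M / eps + 1 in WN.
  have w0 : 0 < w by rewrite ltr_wpDl// divr_ge0 ?mulr_ge0// ltW.
  have wM : 4 * M <= w * (eps / 2).
    have -> : w * (eps / 2) = 4 * M + eps / 2 by rewrite /w; field; rewrite gt_eqF.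
    by rewrite lerDl divr_ge0// ltW.
  have e2 : 0 < eps / 2 by rewrite divr_gt0.
  have : \sum_(k < N) sqnormc (dot (e k) (s j) - dot (e k) u) @[j --> U] --> 0.
    rewrite [X in _ --> X](_ : _ = \sum_(k < N) (0 : R)); last by rewrite big1.
    by apply: cvg_big => [|k _]; [exact: add_continuous|exact: su].
  move=> /cvgrPdist_le/(_ _ e2); apply: filterS => j.
  rewrite !sub0r !normrN ger0_norm; last by apply: sumr_ge0 => k _; exact: sqnormc_ge0.
  rewrite ger0_norm ?(si_ge0 siD)// => hN; apply: (nrm2_le_coord hbe) => n.
  pose b k := sqnormc (dot (e k) (s j - u)).
  have b0 k : 0 <= b k by exact: sqnormc_ge0.
  have bN : \sum_(k < N) b k <= eps / 2.
    by apply: le_trans hN; apply: ler_sum => k _; rewrite /b (siBr siD).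
  have h1 := psum_nd b0 (leq_maxl n N); have h2 := psum_diff b (leq_maxr n N).
  have h3 : w * \sum_(k < maxn n N) (if (N <= k)%N then b k else 0) <= w * (eps / 2).
    apply: le_trans wM; apply: le_trans (_ : 2 * M + 2 * M <= _); last by lra.
    apply: le_trans (weight_le_sub (sW j) uW (maxn n N)).
    rewrite mulr_sumr; apply: ler_sum => k _; case: ifP => [Nk|_].
      by rewrite ler_wpM2r// WN.
    by rewrite mulr0 mulr_ge0 ?sqnormc_ge0.
  rewrite ler_pM2l// in h3; apply: le_trans h1 _; lra.
(* The ultrafilter contains every tail of the integers, so arbitrarily late indices come arbitrarily
   close to u. *)
have pick n : exists j, (n <= j)%N /\ nrm2 dot (s j - u) <= harmonic n.
  have h0 : 0 < harmonic n :> R by exact: harmonic_gt0.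
  have /cvgrPdist_le/(_ _ h0) := cv => h.
  have hn : U [set j | (n <= j)%N] by apply: ooU; exact: nbhs_infty_ge.
  have [j [hj nj]] := filter_ex (filterI h hn); exists j; split=> //.
  by move: hj; rewrite sub0r normrN ger0_norm ?(si_ge0 siD).
have [phi phiP] := choice pick; exists u, phi; split=> [n|]; first by have [] := phiP n.
apply: squeeze0 cvg_harmonic => n; rewrite (si_ge0 siD)//=.
by have [] := phiP n.
Qed.

Variable B : V -> V -> R[i].
Definition form_dom : set V := [set u | exists M, weight_le u M].
Hypothesis siB : semi_inner form_dom B.
Variable c : R.
Hypothesis c_gt0 : 0 < c.
Hypothesis B_lower : forall u, form_dom u -> weight_le u (c * (nrm2 B u + nrm2 dot u)).
Hypothesis B_upper : forall u M, weight_le u M -> nrm2 B u <= c * M.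

(** Closedness of the form. The lower bound turns Cauchy for [B] into Cauchy for the weights, lower
    semicontinuity passes to the limit in one index, and the upper bound returns to [B]. *)
Lemma form_complete (s : nat -> V) u : (forall n, form_dom (s n)) ->
  cauchy_nrm2 (nrm2 B) s -> nrm2 dot (s n - u) @[n --> \oo] --> 0 ->
  form_dom u /\ nrm2 B (s n - u) @[n --> \oo] --> 0.
Proof.
move=> Ds cs su.
have su' k : sqnormc (dot (e k) (s n) - dot (e k) u) @[n --> \oo] --> 0.
  exact: (form_cvg siD (FF := eventually_filter) (fun=> I) I su (w := e k) I).
have key eps : 0 < eps -> exists N, forall p, (N <= p)%N -> weight_le (u - s p) eps.
  (* The 5 counts d for the form, and 2 d + 2 d for the norm of s n - s p estimated through u. *)
  move=> e0; pose d := eps / (c * 5); have d0 : 0 < d by rewrite divr_gt0// mulr_gt0.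
  have [N1 sN1] := cs _ d0; have /cvgrPdist_le/(_ _ d0)[N2 _ sN2] := su.
  have {}sN2 n : (N2 <= n)%N -> nrm2 dot (s n - u) <= d.
    by move=> /sN2 /=; rewrite sub0r normrN ger0_norm ?(si_ge0 siD).
  exists (maxn N1 N2) => p; rewrite geq_max => /andP[N1p N2p].
  apply: (weight_le_cvg (F := \oo) _ su').
  near=> n; have nN1 : (N1 <= n)%N by near: n; exact: nbhs_infty_ge.
  have nN2 : (N2 <= n)%N by near: n; exact: nbhs_infty_ge.
  move=> K; apply: le_trans (B_lower (si_domB siB (Ds n) (Ds p)) K) _.
  have -> : eps = c * (5 * d) by rewrite /d; field; rewrite gt_eqF.
  rewrite ler_pM2l//; have := sN1 n p nN1 N1p; have := sN2 n nN2.
  have := sN2 p N2p; have := nrm2B_le siD (u := s n) (v := u) (w := s p) I I I.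
  by rewrite [nrm2 dot (u - s p)](nrm2_subC siD)//; lra.
have Du : form_dom u.
  have [N uN] := key 1 ltr01.
  rewrite -(subrK (s N) u); apply: (si_domD siB) => //.
  by exists 1; exact: uN.
split=> //; apply/cvgrPdist_le => eps e0.
have [N uN] := key (eps / c) (divr_gt0 e0 c_gt0).
near=> p; rewrite sub0r normrN ger0_norm ?(si_ge0 siB)//; last exact: (si_domB siB).
rewrite (nrm2_subC siB)//; have /B_upper : weight_le (u - s p) (eps / c).
  by apply: uN; near: p; exact: nbhs_infty_ge.
by rewrite mulrC divfK// gt_eqF.
Unshelve. all: by end_near. Qed.

Variable q : qform R V.
Hypothesis qE : forall u r, q u r <-> form_dom u /\ r = nrm2 B u.

Lemma form_closureE u r : form_closure dot q u r <-> form_dom u /\ r = nrm2 B u.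
Proof.
split=> [[w [s [ws wu wc sr]]]|[Du ->]]; last first.
  exists (fun=> u), (fun=> nrm2 B u); split.
  - by move=> n; apply/qE.
  - by under eq_fun do rewrite subrr /nrm (nrm20 siD) sqrtr0; exact: cvg_cst.
  - move=> eps e0; exists 0%N => n p _ _; exists (nrm2 B (u - u)).
      by apply/qE; split=> //; exact: (si_domB siB).
    by rewrite subrr (nrm20 siB).
  - exact: cvg_cst.
have Dw n : form_dom (w n) by have /qE[] := ws n.
have wu2 : nrm2 dot (w n - u) @[n --> \oo] --> 0.
  apply: (@cvg_ext _ _ _ (fun n => nrm dot (w n - u) * nrm dot (w n - u))).
    by move=> n; rewrite -expr2 sqr_sqrtr// (si_ge0 siD).
  by rewrite -[X in _ --> X](mulr0 0); apply: cvgM.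
have [eps e0|Du wB] := form_complete Dw _ wu2.
  have [N wN] := wc eps e0; exists N => n p nN pN.
  by have [d /qE[_ ->] /ltW] := wN n p nN pN.
split=> //; apply: (cvg_unique _ sr) => //=.
apply: (cvg_ext _ (nrm2_cvg siB (FF := eventually_filter) Dw Du wB)) => n.
by have /qE[] := ws n.
Qed.

Definition orth_dom (s : seq V) : set V :=
  [set u | form_dom u /\ forall v, v \in s -> dot v u = 0].

Lemma basis_dom k : form_dom (e k).
Proof.
exists (W k) => n; have [kn|nk] := ltnP k n.
  rewrite (bigD1 (Ordinal kn)) //= (hb_orth hbe) eqxx sqnormc_real expr1n mulr1.
  rewrite big1 ?addr0// => i /negP ik; rewrite (hb_orth hbe) (_ : (i == k :> nat) = false).
    by rewrite sqnormc0 mulr0.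
  by apply/eqP => h; apply: ik; apply/eqP/val_inj.
rewrite big1// => i _; rewrite (hb_orth hbe) ltn_eqF ?sqnormc0 ?mulr0//.
exact: leq_trans (ltn_ord i) nk.
Qed.

(** Dimension count: n linear conditions on the span of the first n + 1 basis vectors have a nonzero
    solution. Hence every constrained minimization has a competitor. *)
Lemma orth_dom_unit_ex (s : seq V) : exists u, orth_dom s u /\ nrm2 dot u = 1.
Proof.
pose n := size s; pose A : 'M[R[i]]_(n.+1, n) := \matrix_(i, j) dot (nth 0 s j) (e i).
have /rowV0Pn[v /sub_kermxP vA v0] : kermx A != 0.
  rewrite kermx_eq0 /row_free; apply/negP => /eqP h.
  by have := rank_leq_col A; rewrite h ltnn.
pose x k := v 0 (inord k); pose u0 := \sum_(k < n.+1) x k *: e k.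
have xk (k : 'I_n.+1) : x k = v 0 k by rewrite /x inord_val.
have Du0 : form_dom u0.
  by apply: (si_dom_sum siB _ (F := fun k => x k *: e k)) => k; apply: (si_domZ siB); exact: basis_dom.
have su0 w : w \in s -> dot w u0 = 0.
  move=> ws; have jn : (index w s < n)%N by rewrite index_mem.
  have /matrixP/(_ 0 (Ordinal jn)) := vA; rewrite !mxE => <-.
  rewrite /u0 (si_sumr siD _ (F := fun k => x k *: e k))//; apply: eq_bigr => k _.
  by rewrite (siZr siD)// mxE /= nth_index// xk.
have N0 : 0 < nrm2 dot u0.
  rewrite lt_neqAle (si_ge0 siD)// andbT eq_sym.
  rewrite /u0 (onb_nrm2 siD (hb_orth hbe) x) psumr_neq0; last by move=> *; exact: sqnormc_ge0.
  have /rV0Pn[j vj] := v0; apply/hasP; exists j; first by rewrite mem_index_enum.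
  by rewrite /= xk lt_neqAle sqnormc_ge0 andbT eq_sym sqnormc_eq0.
exists ((Num.sqrt (nrm2 dot u0))^-1%:C *: u0); split.
  split; first exact: (si_domZ siB).
  by move=> w ws; rewrite (siZr siD)// su0// mulr0.
by rewrite (nrm2Z siD)// sqnormc_real exprVn sqr_sqrtr ?(ltW N0)// mulVf// gt_eqF.
Qed.

Lemma orth_dom_lin s a u v : orth_dom s u -> orth_dom s v -> orth_dom s (a *: u + v).
Proof.
move=> [Du su] [Dv sv]; split; first exact: (si_domP siB).
by move=> w ws; rewrite (si_linear siD)// su// sv// mulr0 addr0.
Qed.

Lemma orth_dom0 s : orth_dom s 0.
Proof. by split; [exact: (si_dom0 siB)|move=> v _; rewrite (si0r siD)]. Qed.

(** The direct method: a minimizing sequence has bounded weights, so a subsequence converges in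
    norm, and the parallelogram law upgrades this to convergence for [B]. *)
Lemma minimizer_ex (s : seq V) : exists u, [/\ orth_dom s u, nrm2 dot u = 1 &
  forall w, orth_dom s w -> nrm2 B u * nrm2 dot w <= nrm2 B w].
Proof.
pose S := [set r | exists u, [/\ orth_dom s u, nrm2 dot u = 1 & r = nrm2 B u]].
have S0 : S !=set0.
  by have [u [su u1]] := orth_dom_unit_ex s; exists (nrm2 B u), u.
have Slb : lbound S 0 by move=> _ [u [[Du _] _ ->]]; exact: (si_ge0 siB).
have Sinf : has_inf S by split=> //; exists 0.
set l := inf S.
have l0 : 0 <= l by exact: lb_le_inf.
have lmin w : orth_dom s w -> l * nrm2 dot w <= nrm2 B w.
  move=> sw; have Dw := sw.1.
  have [w0|w0] := eqVneq (nrm2 dot w) 0; first by rewrite w0 mulr0 (si_ge0 siB).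
  have wgt0 : 0 < nrm2 dot w by rewrite lt_neqAle eq_sym w0 (si_ge0 siD).
  pose a := (Num.sqrt (nrm2 dot w))^-1%:C : R[i].
  have a2 : sqnormc a = (nrm2 dot w)^-1.
    by rewrite sqnormc_real exprVn sqr_sqrtr// ltW.
  have : l <= nrm2 B (a *: w).
    apply: ge_inf; first by exists 0.
    exists (a *: w); split=> //; last by rewrite (nrm2Z siD)// a2 mulVf.
    by rewrite -[_ *: _]addr0; apply: orth_dom_lin => //; exact: orth_dom0.
  by rewrite (nrm2Z siB)// a2 mulrC ler_pdivlMr.
have pick j : exists u, [/\ orth_dom s u, nrm2 dot u = 1 & nrm2 B u <= l + harmonic j].
  have [_ [u [su u1 ->]] /ltW ul] := inf_adherent (harmonic_gt0 j) Sinf.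
  by exists u.
have [g gP] := choice pick.
have gs j : orth_dom s (g j) by have [] := gP j.
have gD j : form_dom (g j) by have [] := gs j.
have g1 j : nrm2 dot (g j) = 1 by have [] := gP j.
have gl j : nrm2 B (g j) <= l + harmonic j by have [] := gP j.
have harm_le j k : (j <= k)%N -> harmonic k <= harmonic j :> R.
  by move=> jk; rewrite lef_pV2 ?posrE// ler_nat ltnS.
have harm1 j : harmonic j <= 1 :> R by apply: le_trans (harm_le 0%N j (leq0n j)) _; rewrite /harmonic /= -[leRHS]invr1.
(* The weights are at most c (l + 1 + 1) because harmonic terms are at most 1; the extra 1 lets the
   same constant bound the unit norms. *)
have [||u [phi [phin gu]]] := @weight_compact g (c * (l + 2) + 1).
- by move=> j; rewrite g1 lerDr mulr_ge0 ?(ltW c_gt0)//; lra.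
- move=> j K; apply: le_trans (B_lower (gD j) K) _; rewrite g1.
  apply: le_trans (_ : c * (l + 2) <= _); last by rewrite lerDl.
  by rewrite ler_pM2l//; have := gl j; have := harm1 j; lra.
pose t n := g (phi n).
have tl n : nrm2 B (t n) <= l + harmonic n.
  by apply: le_trans (gl _) _; rewrite lerD2l harm_le.
have tD n : form_dom (t n) by exact: gD.
pose d n := 2 * harmonic n + 2 * l * nrm2 dot (t n - u).
have d0 : d n @[n --> \oo] --> 0 by apply: cvg0_addZ => //; exact: cvg_harmonic.
(* In the parallelogram identity for [B], minimality bounds the value at t n + t p below by l (4 -
   |t n - t p|^2). What remains is the excess over l plus l |t n - t p|^2. *)
have td n p : nrm2 B (t n - t p) <= d n + d p.
  have sB : orth_dom s (t n + t p).
    by rewrite -[t n]scale1r; apply: orth_dom_lin; exact: gs.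
  have := nrm2_parallelogram siB (tD n) (tD p).
  have := lmin _ sB; have := tl n; have := tl p.
  have := nrm2_parallelogram siD (u := t n) (v := t p) I I.
  rewrite ![nrm2 dot (t _)]g1 => e1 h1 h2 h3 h4.
  have : l * nrm2 dot (t n - t p) <= l * (2 * nrm2 dot (t n - u) + 2 * nrm2 dot (t p - u)).
    rewrite ler_wpM2l// [nrm2 dot (t p - u)](nrm2_subC siD)//.
    exact: (nrm2B_le siD).
  have e1' : nrm2 dot (t n + t p) = 4 - nrm2 dot (t n - t p) by lra.
  by rewrite e1' in h3; rewrite /d; lra.
have cauchy_t : cauchy_nrm2 (nrm2 B) t.
  move=> eps e0; have e2 : 0 < eps / 2 by rewrite divr_gt0.
  have /cvgrPdist_le/(_ _ e2)[N _ dN] := d0; exists N => n p nN pN.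
  apply: le_trans (td n p) _.
  have /= := dN n nN; have /= := dN p pN; rewrite !sub0r !normrN !ler_norml; lra.
have [Du tu] := form_complete tD cauchy_t gu.
have Bu : nrm2 B u <= l.
  have := nrm2_cvg siB (FF := eventually_filter) tD Du tu.
  have : l + harmonic n @[n --> \oo] --> l.
    rewrite -[X in _ --> X]addr0; apply: cvgD; [exact: cvg_cst|exact: cvg_harmonic].
  by move=> h1 h2; apply: (ler_cvg_to h2 h1); apply: nearW.
have su : orth_dom s u.
  split=> // v vs; apply: esym; apply: (sqnormc_cvg_unique (F := \oo) (z := fun=> 0)).
    by rewrite subrr sqnormc0; exact: cvg_cst.
  have := form_cvg siD (FF := eventually_filter) (fun=> I) I gu (w := v) I.
  apply: cvg_ext => n; by have [_ /(_ v vs) ->] := gs (phi n).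
exists u; split=> //.
  have h := nrm2_cvg siD (FF := eventually_filter) (fun=> I) I gu.
  by apply: (cvg_unique _ h) => //=; under eq_fun do rewrite g1; exact: cvg_cst.
by move=> w /lmin; apply: le_trans; rewrite ler_wpM2r ?(si_ge0 siD).
Qed.

(** The last clause preserves the minimality of each vector, on which the proof of totality
    rests. *)
Lemma eigenbasis_ex : exists (f : nat -> V) (l : nat -> R),
  [/\ orthonormal dot f, forall n, form_dom (f n), forall n, 0 <= l n,
      forall n u, form_dom u -> B (f n) u = (l n)%:C * dot (f n) u
    & forall n u, form_dom u -> (forall i, (i < n)%N -> dot (f i) u = 0) ->
        l n * nrm2 dot u <= nrm2 B u].
Proof.
have [pick pickP] := choice minimizer_ex.
pose fix fs n := if n is k.+1 then rcons (fs k) (pick (fs k)) else [::] : seq V.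
pose f n := pick (fs n); pose l n := nrm2 B (f n).
have fsP n v : v \in fs n -> exists2 i, (i < n)%N & v = f i.
  elim: n => [//|n IH] /=; rewrite mem_rcons inE => /predU1P[->|/IH[i ltin ->]].
    by exists n.
  by exists i => //; exact: ltnW.
have fsI n i : (i < n)%N -> f i \in fs n.
  elim: n => // n IH; rewrite ltnS leq_eqVlt /= mem_rcons inE.
  by move=> /predU1P[->|/IH ->]; rewrite ?eqxx ?orbT.
have fo n : orth_dom (fs n) (f n) by have [] := pickP (fs n).
have f1 n : nrm2 dot (f n) = 1 by have [] := pickP (fs n).
have fmin n w : orth_dom (fs n) w -> l n * nrm2 dot w <= nrm2 B w.
  by have [_ _] := pickP (fs n); apply.
have fD n : form_dom (f n) by have [] := fo n.
have lt0 i j : (i < j)%N -> dot (f i) (f j) = 0.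
  by move=> ij; have [_ /(_ _ (fsI _ _ ij))] := fo j.
have of_ : orthonormal dot f.
  move=> i j; have [ij|ji|->] := ltngtP i j.
  - exact: lt0.
  - by rewrite (si_conj siD (u := f j))// lt0// conjc0.
  - by rewrite (si_diag siD)// f1.
(* Euler-Lagrange: [B - l n dot] is positive on the admissible space and vanishes at the
   minimizer, so Cauchy-Schwarz kills the pairing. *)
have EL n w : orth_dom (fs n) w -> B w (f n) = (l n)%:C * dot w (f n).
  pose B' u v := B u v - (l n)%:C * dot u v.
  have n2 u : nrm2 B' u = nrm2 B u - l n * nrm2 dot u.
    by rewrite /nrm2 /B' ReD ReN ReMl.
  have si' : semi_inner (orth_dom (fs n)) B'.
    split.
    - exact: orth_dom0.
    - by move=> *; exact: orth_dom_lin.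
    - move=> a u v x [Du _] [Dv _] [Dx _].
      by rewrite /B' (si_linear siB)// (si_linear siD)//; ring.
    - move=> u v [Du _] [Dv _].
      by rewrite /B' (si_conj siB Du Dv) (si_conj siD (u := u))// rmorphB rmorphM /= oppr0.
    - by move=> u su; rewrite n2 subr_ge0 fmin.
  move=> sw; have := si_cauchy_schwarz si' sw (fo n).
  rewrite (n2 (f n)) f1 mulr1 subrr mulr0 => h.
  have : sqnormc (B' w (f n)) == 0 by rewrite eq_le h sqnormc_ge0.
  by rewrite sqnormc_eq0 subr_eq0 => /eqP.
have Bij i j : (i < j)%N -> B (f i) (f j) = 0.
  move=> ij; have fij : orth_dom (fs i) (f j).
    split=> // v /fsP[k ki ->]; apply: lt0; exact: ltn_trans ij.
  rewrite (si_conj siB (u := f j))// (EL i (f j))// (si_conj siD (u := f i))// lt0//.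
  by rewrite conjc0 mulr0 conjc0.
exists f, l; split=> //.
- by move=> n; rewrite /l (si_ge0 siB).
(* The Euler-Lagrange identity covers only vectors orthogonal to the earlier f i. The projection [p]
   onto those pairs to 0 with f n for both products, so u - p may be replaced by u. *)
- move=> n u Du; pose p := \sum_(i < n) dot (f i) u *: f i.
  have Dp : form_dom p.
    by apply: (si_dom_sum siB n (F := fun i => dot (f i) u *: f i)) => k; exact: (si_domZ siB).
  have sup : orth_dom (fs n) (u - p).
    split; first exact: (si_domB siB).
    move=> v /fsP[i ltin ->]; rewrite (siBr siD)//.
    by rewrite (onb_coord siD of_ (fun k => dot (f k) u)) ltin subrr.
  have Bp : B p (f n) = 0.
    rewrite (si_suml siB n (F := fun i => dot (f i) u *: f i))//.
      by rewrite big1// => i _; rewrite (siZl siB)// Bij// mulr0.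
    by move=> k; exact: (si_domZ siB).
  have dp : dot p (f n) = 0.
    rewrite (si_suml siD n (F := fun i => dot (f i) u *: f i))//.
    by rewrite big1// => i _; rewrite (siZl siD)// lt0// mulr0.
  have := EL n _ sup; rewrite (siBl siB)// (siBl siD)// Bp dp !subr0 => h.
  rewrite (si_conj siB (u := u))// h rmorphM /= (si_conj siD (u := u))//.
  by congr (_ * _); rewrite /= oppr0.
- move=> n u Du un; apply: fmin; split=> // v /fsP[i ltin ->]; exact: un.
Qed.

(** * Consequences of the eigenbasis *)

Section Eigenbasis.
Variables (f : nat -> V) (l : nat -> R).
Hypothesis of_ : orthonormal dot f.
Hypothesis fD : forall n, form_dom (f n).
Hypothesis l_ge0 : forall n, 0 <= l n.
Hypothesis fB : forall n u, form_dom u -> B (f n) u = (l n)%:C * dot (f n) u.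
Hypothesis fmin : forall n u, form_dom u ->
  (forall i, (i < n)%N -> dot (f i) u = 0) -> l n * nrm2 dot u <= nrm2 B u.

Let fBf i j : B (f i) (f j) = if i == j then (l i)%:C else 0.
Proof. by rewrite fB// of_; case: eqP => _; rewrite ?mulr1 ?mulr0. Qed.

(* Jensen's inequality for the weights [|<e_k, f_n>|^2] and [x |-> exp (- s x)], by means
   of the tangent line at [c * (l n + 1)], an upper bound for the mean of [W]. *)
Lemma eigen_exp_sum (t : R) : 0 < t ->
  exists M, forall n, \sum_(k < n) expR (- (t * l k)) <= M.
Proof.
(* With this s, s (c (l n + 1)) = t (l n + 1), whence the factor exp t in the bound. *)
move=> t0; pose s := t / c; have s0 : 0 < s by rewrite divr_gt0.
have [M sM] := W_exp_sum s0; exists (expR t * M) => N.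
pose p k n := sqnormc (dot (e k) (f n)).
have p0 k n : 0 <= p k n by exact: sqnormc_ge0.
have f1 n : nrm2 dot (f n) = 1 by rewrite /nrm2 of_ eqxx.
pose a n := c * (l n + 1).
(* The first K coordinates of f n carry mass possibly below 1, so the mass stays explicit; Parseval
   makes it 1 as K grows. *)
have tangent K n : expR (- (s * a n)) * ((1 + s * a n) * (\sum_(k < K) p k n) - s * a n) <=
    \sum_(k < K) p k n * expR (- (s * W k)).
  have Wp : \sum_(k < K) W k * p k n <= a n.
    have := B_lower (fD n) K; rewrite f1.
    by rewrite /nrm2 fBf eqxx.
  apply: le_trans (_ : \sum_(k < K) p k n * (expR (- (s * a n)) * (1 + s * a n - s * W k)) <= _).
    have -> : \sum_(k < K) p k n * (expR (- (s * a n)) * (1 + s * a n - s * W k)) =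
        expR (- (s * a n)) * ((1 + s * a n) * (\sum_(k < K) p k n) -
          s * (\sum_(k < K) W k * p k n)).
      rewrite !mulr_sumr -sumrB mulr_sumr; apply: eq_bigr => k _; ring.
    by rewrite ler_wpM2l ?expR_ge0// lerD2l lerN2 ler_wpM2l// ltW.
  apply: ler_sum => k _; rewrite ler_wpM2l//.
  have -> : - (s * W k) = - (s * a n) + (s * a n - s * W k) by ring.
  rewrite expRD ler_wpM2l ?expR_ge0//.
  by have := expR_ge1Dx (s * a n - s * W k); lra.
have cv : \sum_(n < N) expR (- (s * a n)) * ((1 + s * a n) * (\sum_(k < K) p k n) - s * a n)
    @[K --> \oo] --> \sum_(n < N) expR (- (s * a n)) * ((1 + s * a n) * 1 - s * a n).
  apply: cvg_big => [|n _]; first exact: add_continuous.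
  apply: cvgMr; apply: cvgB; last exact: cvg_cst.
  by apply: cvgMr; rewrite -(f1 n); exact: (@hb_parseval _ _ _ _ hbe (f n)).
have sa n : expR (- (s * a n)) = expR (- t) * expR (- (t * l n)).
  rewrite -expRD /s /a; congr expR; field; rewrite gt_eqF//.
have : \sum_(n < N) expR (- (s * a n)) * ((1 + s * a n) * 1 - s * a n) <= M.
  rewrite -(cvg_lim _ cv)//; apply: limr_le; first by apply/cvg_ex; eexists; exact: cv.
  near=> K; apply: le_trans (sM K).
  apply: le_trans (_ : \sum_(n < N) \sum_(k < K) p k n * expR (- (s * W k)) <= _).
    by apply: ler_sum => n _; exact: tangent.
  rewrite exchange_big /=; apply: ler_sum => k _; rewrite -mulr_suml.
  rewrite -[leRHS]mul1r ler_wpM2r ?expR_ge0//.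
  have <- : nrm2 dot (e k) = 1 by rewrite /nrm2 (hb_orth hbe) eqxx.
  apply: le_trans (bessel siD of_ (e k) N); apply: ler_sum => n _.
  by rewrite /p (si_conj siD (u := f n))// sqnormc_conj.
rewrite (eq_bigr (fun n : 'I_N => expR (- t) * expR (- (t * l n)))); last first.
  by move=> n _; rewrite sa; ring.
rewrite -mulr_sumr => h.
rewrite -(@ler_pM2l _ (expR (- t))) ?expR_gt0// mulrA -expRD addNr expR0 mul1r//.
Unshelve. all: by end_near. Qed.

(** Let u be orthogonal to every f n, and let w n be the part of e k orthogonal to the first n of
    them. Then l n |w n|^2 <= B (w n) <= B (e k), so w n tends to 0 as l n grows, while its product
    with u stays equal to that of e k. *)
Lemma eigen_hilbert_basis : hilbert_basis dot f.
Proof.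
apply: (total_hilbert_basis hbe of_) => u uf; apply: (hb_ext hbe) => k.
rewrite (si0r siD)//.
pose w n := e k - \sum_(i < n) dot (f i) (e k) *: f i.
have Dsum n : form_dom (\sum_(i < n) dot (f i) (e k) *: f i).
  by apply: (si_dom_sum siB n (F := fun i => dot (f i) (e k) *: f i)) => i; exact: (si_domZ siB).
have Dw n : form_dom (w n) by apply: (si_domB siB) => //; exact: basis_dom.
have lw n : l n * nrm2 dot (w n) <= nrm2 B (e k).
  apply: le_trans (fmin (Dw n) _) _.
    move=> i ltin; rewrite /w (siBr siD)//.
    by rewrite (onb_coord siD of_ (fun i => dot (f i) (e k))) ltin subrr.
  rewrite /w (orth_sub_nrm2 (x := fun i => dot (f i) (e k)) siB fD fBf).
  - by rewrite gerBl sumr_ge0// => i _; rewrite mulr_ge0 ?sqnormc_ge0.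
  - exact: basis_dom.
  - by move=> i; rewrite fB//; exact: basis_dom.
have we n : dot (w n) u = dot (e k) u.
  rewrite (siBl siD)// (si_suml siD n (F := fun i => dot (f i) (e k) *: f i))//.
  by rewrite big1 ?subr0// => i _; rewrite (siZl siD)// uf mulr0.
apply/eqP; rewrite -sqnormc_eq0 eq_le sqnormc_ge0 andbT; apply/ler_addgt0Pr => eps e0.
(* Chosen so that Q eps exceeds the product of B (e k) and |u|^2; the added 1 keeps Q positive. *)
rewrite add0r; pose Q := nrm2 B (e k) * nrm2 dot u / eps + 1.
have Q0 : 0 < Q.
  rewrite ltr_wpDl// divr_ge0 ?(ltW e0)// mulr_ge0 ?(si_ge0 siD)// (si_ge0 siB)//.
  exact: basis_dom.
have [n /(_ n (leqnn n)) nQ] := eigenvalues_infty eigen_exp_sum Q.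
rewrite -(we n); apply: le_trans (si_cauchy_schwarz siD (u := w n) (v := u) I I) _.
have w0 := si_ge0 siD (u := w n) I; have u0 := si_ge0 siD (u := u) I.
have h : Q * nrm2 dot (w n) <= nrm2 B (e k).
  by apply: le_trans (lw n); rewrite ler_wpM2r.
rewrite -(ler_pM2l Q0) mulrA; apply: le_trans (ler_wpM2r u0 h) _.
have -> : Q * eps = nrm2 B (e k) * nrm2 dot u + eps by rewrite /Q; field; rewrite gt_eqF.
by rewrite lerDl ltW.
Qed.

(** Testing against f n gives one direction. For the other, u must first be placed in the form
    domain, by convergence of its eigenvector expansion for [B]. *)
Lemma eigen_operatorE u v : form_operator dot (form_closure dot q) u v <->
  forall n, dot (f n) v = (l n)%:C * dot (f n) u.
Proof.
have domE w : dom (form_closure dot q) w <-> form_dom w.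
  split=> [[r /form_closureE[]//]|Dw].
  by exists (nrm2 B w); apply/form_closureE.
have hbf := eigen_hilbert_basis.
split=> [[/domE Du h] n|vE].
  have /h/(polarE siB _ _ _ form_closureE)[_ _ ->] : dom (form_closure dot q) (f n).
    by apply/domE.
  exact: fB.
(* From l <= 1 + l^2: the two terms are the coordinates of u and of v. *)
have lM n : \sum_(k < n) l k * sqnormc (dot (f k) u) <= nrm2 dot u + nrm2 dot v.
  apply: le_trans (lerD (bessel siD of_ u n) (bessel siD of_ v n)).
  rewrite -big_split /=; apply: ler_sum => k _.
  rewrite vE sqnormcM sqnormc_real -{2}[sqnormc _]mul1r -mulrDl ler_wpM2r ?sqnormc_ge0//.
  have := sqr_ge0 (l k - 1); have := l_ge0 k; rewrite sqrrB1; lra.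
have cu := orth_cauchy (x := fun k => dot (f k) u) siB fD fBf l_ge0 lM.
have DN n : form_dom (\sum_(k < n) dot (f k) u *: f k).
  by apply: (si_dom_sum siB n (F := fun i => dot (f i) u *: f i)) => i; exact: (si_domZ siB).
have [Du uB] := form_complete DN cu (hb_expansion hbf u).
split; first exact/domE.
move=> w /domE Dw; apply/(polarE siB _ _ _ form_closureE); split=> //.
have h1 := form_cvg siB (FF := eventually_filter) DN Du uB Dw.
have h2 := form_cvg siD (FF := eventually_filter) (fun=> I) I (hb_expansion hbf v) (w := w) I.
apply: (sqnormc_cvg_unique h2); apply: cvg_ext h1 => n; congr (sqnormc (_ - _)).
rewrite (si_sumr siB n (F := fun i => dot (f i) u *: f i))//; last first.
  by move=> k; exact: (si_domZ siB).
rewrite (si_sumr siD n (F := fun i => dot (f i) v *: f i))//; apply: eq_bigr => k _.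
rewrite (siZr siB)// (siZr siD)// (si_conj siB (u := f k))// fB// (si_conj siD (u := f k))//.
have -> : conjc ((l k)%:C * dot (f k) w) = (l k)%:C * conjc (dot (f k) w).
  by rewrite rmorphM /= oppr0.
by rewrite vE; ring.
Qed.

End Eigenbasis.

Theorem form_spectrum : let H := form_operator dot (form_closure dot q) in
  discrete_spectrum dot H /\
  exists T : R -> V -> V, exp_semigroup dot H T /\
    forall t, 0 < t -> forall b : nat -> V, orthonormal_basis dot b ->
      (trace dot b (T t) < +oo)%E.
Proof.
have [f [l [of_ fD l0 fB fmin]]] := eigenbasis_ex.
have hbf := eigen_hilbert_basis of_ fD l0 fB fmin.
have HE := eigen_operatorE of_ fD l0 fB fmin.
have sl := eigen_exp_sum of_ fD fB.
split; first by apply: (diagonal_discrete hbf HE sl).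
have [T [Tbl TE]] := exp_mult_ex hbf l0; exists T; split.
  exact: (diagonal_exp_semigroup hbf l0 HE Tbl TE).
move=> t t0 b [ob _]; have [M sM] := sl t t0.
exact: (diagonal_trace_lt hbf TE t0 ob sM).
Qed.

End FormSpectrum.

(** * Convergent complex series *)

Section ComplexSeries.
Variable R : realType.
Implicit Types (z w : nat -> R[i]) (a b : R[i]).

(** [csum] takes a default value on divergent series; this relation also records convergence. *)
Definition csum_to z a := sqnormc (\sum_(k < n) z k - a) @[n --> \oo] --> (0 : R).

Lemma csum_toE z a : csum_to z a -> csum z = a.
Proof.
move=> /sqnormc_cvg0[h1 h2]; apply: complex_ext; rewrite /csum /=; apply: cvg_lim => //.
  by apply: cvg_ext h1 => n; rewrite Re_sum /series /= big_mkord.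
by apply: cvg_ext h2 => n; rewrite Im_sum /series /= big_mkord.
Qed.

Lemma csum_to_linear c z w a b : csum_to z a -> csum_to w b ->
  csum_to (fun k => c * z k + w k) (c * a + b).
Proof.
move=> za wb; apply: squeeze0 _ (cvg0_addZ (2 * sqnormc c) 2 za wb) => n.
rewrite sqnormc_ge0 big_split /= -mulr_sumr.
set S := \sum_(k < n) z k; set S' := \sum_(k < n) w k.
have -> : c * S + S' - (c * a + b) = c * (S - a) + (S' - b) by ring.
exact: sqnormcD_le.
Qed.

Lemma csum_to_conj z a : csum_to z a -> csum_to (fun k => conjc (z k)) (conjc a).
Proof.
apply: cvg_ext => n; rewrite -sqnormc_conj rmorphB /= rmorph_sum.
by congr (sqnormc (_ - _)).
Qed.

Lemma csum_to_eventually z a N :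
  (forall n, (N <= n)%N -> \sum_(k < n) z k = a) -> csum_to z a.
Proof.
move=> za; apply: cvg_near_cst; exists N => // n /= Nn.
by rewrite za// subrr sqnormc0.
Qed.

(** Absolute convergence: adding [g] to the real or imaginary parts makes them nonnegative with
    bounded partial sums. *)
Lemma csum_ex z (g : nat -> R) (M : R) : (forall k, sqnormc (z k) <= g k ^+ 2) ->
  (forall k, 0 <= g k) -> (forall n, \sum_(k < n) g k <= M) -> exists a, csum_to z a.
Proof.
move=> zg g0 gM.
have cv (r : nat -> R) : (forall k, r k ^+ 2 <= sqnormc (z k)) ->
    exists l : R, \sum_(k < n) r k @[n --> \oo] --> l.
  move=> rz.
  have rg k : `|r k| <= g k.
    rewrite -(@ler_pXn2r _ 2)// ?nnegrE// real_normK ?num_real//.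
    exact: le_trans (rz k) (zg k).
  have rg0 k : 0 <= r k + g k by have := rg k; rewrite ler_norml; lra.
  have rgM n : \sum_(k < n) (r k + g k) <= M + M.
    rewrite big_split /= lerD ?gM//; apply: le_trans (gM n); apply: ler_sum => k _.
    exact: le_trans (ler_norm _) (rg k).
  have [l1 h1 _] := psum_cvg_ex rg0 rgM.
  have [l2 h2 _] := psum_cvg_ex g0 gM.
  exists (l1 - l2); apply: cvg_ext (cvgB h1 h2) => n /=.
  by rewrite big_split /= addrK.
have [a ha] := cv (fun k => Re (z k)) (fun k => sqr_Re_le _).
have [b hb] := cv (fun k => Im (z k)) (fun k => sqr_Im_le _).
exists (a +i* b); apply/sqnormc_cvg0; split.
  by apply: cvg_ext ha => n; rewrite Re_sum.
by apply: cvg_ext hb => n; rewrite Im_sum.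
Qed.

End ComplexSeries.

(* The inner product of an l^2 direct sum, [pi k] being the k-th component. *)
Section DirectSum.
Variables (R : realType) (V V' : lmodType R[i]) (dot' : V' -> V' -> R[i]).
Hypothesis si' : semi_inner setT dot'.
Variable pi : nat -> V -> V'.
Hypothesis pi_linear : forall k a u v, pi k (a *: u + v) = a *: pi k u + pi k v.
Hypothesis pi_bounded : forall u, exists M : R, forall n,
  \sum_(k < n) nrm2 dot' (pi k u) <= M.

Definition sum_dot u v := csum (fun k => dot' (pi k u) (pi k v)).

(** With x and y the squared norms of the k-th components, Cauchy-Schwarz gives a squared modulus of
    at most x y <= (x + y)^2, so x + y dominates. It serves sequences with scalar components and
    operators with columns as components. *)
Lemma sum_dotP u v : csum_to (fun k => dot' (pi k u) (pi k v)) (sum_dot u v).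
Proof.
have [M uM] := pi_bounded u; have [K vK] := pi_bounded v.
have n0 w k : 0 <= nrm2 dot' (pi k w) by exact: (si_ge0 si').
have [k|k|n|a ha] := @csum_ex _ (fun k => dot' (pi k u) (pi k v))
    (fun k => nrm2 dot' (pi k u) + nrm2 dot' (pi k v)) (M + K).
- apply: le_trans (si_cauchy_schwarz si' (u := pi k u) (v := pi k v) I I) _.
  have := n0 u k; have := n0 v k; rewrite sqrrD.
  set x := nrm2 _ _; set y := nrm2 _ _ => x0 y0.
  have := mulr_ge0 x0 y0; have := sqr_ge0 x; have := sqr_ge0 y; rewrite mulr2n; lra.
- by rewrite addr_ge0.
- by rewrite big_split lerD.
- by rewrite /sum_dot (csum_toE ha).
Qed.

Lemma sum_dot_parseval u :
  \sum_(k < n) nrm2 dot' (pi k u) @[n --> \oo] --> nrm2 sum_dot u.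
Proof.
have /sqnormc_cvg0[h _] := sum_dotP u u.
by apply: cvg_ext h => n; rewrite Re_sum.
Qed.

Lemma sum_dot_si : semi_inner setT sum_dot.
Proof.
split=> //.
- move=> a u v w _ _ _; apply: csum_toE.
  have := csum_to_linear a (sum_dotP u v) (sum_dotP u w).
  by apply: cvg_ext => n; congr sqnormc; congr (_ - _); apply: eq_bigr => k _;
    rewrite pi_linear (si_linear si').
- move=> u v _ _; apply: csum_toE; have := csum_to_conj (sum_dotP u v).
  apply: cvg_ext => n; congr sqnormc; congr (_ - _); apply: eq_bigr => k _.
  by rewrite -(si_conj si').
- move=> u _; have := @psum_le_lim _ (fun k => nrm2 dot' (pi k u)) _ _ (@sum_dot_parseval u) 0%N.
  by rewrite big_ord0; apply=> k; exact: (si_ge0 si').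
Qed.

End DirectSum.

(** * Double series enumerated by the Cantor pairing *)

Section PairSums.
Variable R : realType.
Implicit Type F : nat * nat -> R.

Lemma sum_uniq_le F (s t : seq (nat * nat)) : (forall p, 0 <= F p) ->
  uniq s -> uniq t -> {subset s <= t} ->
  \sum_(p <- s) F p <= \sum_(p <- t) F p.
Proof.
move=> F0 us ut st.
rewrite [leRHS](bigID (mem s)) /= -[leLHS]addr0 lerD ?sumr_ge0//.
have h : perm_eq s [seq i <- t | i \in s].
  apply: uniq_perm; rewrite ?filter_uniq// => p; rewrite mem_filter.
  by case: (boolP (p \in s)) => // /st ->.
by rewrite (perm_big _ h) big_filter.
Qed.

Lemma pair_sum_rect F : (forall p, 0 <= F p) -> forall n, exists N,
  \sum_(k < n) F (Cantor.of_nat k) <= \sum_(j < N) \sum_(i < N) F (i : nat, j : nat).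
Proof.
move=> F0 n; pose g k := Cantor.of_nat k.
pose N := (\max_(k < n) maxn (g k).1 (g k).2).+1; exists N.
rewrite exchange_big (pair_bigA _ (fun i j : 'I_N => F (i : nat, j : nat))) /=.
have -> : \sum_(k < n) F (Cantor.of_nat k) = \sum_(p <- [seq g k | k <- iota 0 n]) F p.
  by rewrite big_map -(big_mkord xpredT (fun k => F (Cantor.of_nat k))) /index_iota subn0.
have -> : \sum_(p : 'I_N * 'I_N) F (p.1 : nat, p.2 : nat) =
    \sum_(p <- [seq (p.1 : nat, p.2 : nat) | p : 'I_N * 'I_N <- enum {: 'I_N * 'I_N}]) F p.
  by rewrite big_map big_enum.
apply: sum_uniq_le => //.
- rewrite map_inj_uniq ?iota_uniq// => x y h.
  by rewrite -(Cantor.cancel_to_of x) -(Cantor.cancel_to_of y) -/(g x) -/(g y) h.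
- by rewrite map_inj_uniq ?enum_uniq// => -[a b] [c d] /= [] /val_inj -> /val_inj ->.
move=> p /mapP[k]; rewrite mem_iota add0n => /andP[_ kn] ->.
have le : (maxn (g k).1 (g k).2 < N)%N.
  by rewrite /N ltnS; exact: (leq_bigmax (F := fun k : 'I_n => maxn (g k).1 (g k).2) (Ordinal kn)).
move: le; rewrite gtn_max => /andP[l1 l2].
apply/mapP; exists (Ordinal l1, Ordinal l2); first by rewrite mem_enum.
by rewrite /=; case: (g k).
Qed.

Lemma rect_pair_sum F : (forall p, 0 <= F p) -> forall J I, exists n,
  \sum_(j < J) \sum_(i < I) F (i : nat, j : nat) <= \sum_(k < n) F (Cantor.of_nat k).
Proof.
move=> F0 J I.
pose n := (\max_(p : 'I_I * 'I_J) Cantor.to_nat (p.1 : nat, p.2 : nat)).+1; exists n.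
rewrite exchange_big (pair_bigA _ (fun (i : 'I_I) (j : 'I_J) => F (i : nat, j : nat))) /=.
have -> : \sum_(k < n) F (Cantor.of_nat k) =
    \sum_(p <- [seq Cantor.of_nat k | k <- iota 0 n]) F p.
  by rewrite big_map -(big_mkord xpredT (fun k => F (Cantor.of_nat k))) /index_iota subn0.
have -> : \sum_(p : 'I_I * 'I_J) F (p.1 : nat, p.2 : nat) =
    \sum_(p <- [seq (p.1 : nat, p.2 : nat) | p : 'I_I * 'I_J <- enum {: 'I_I * 'I_J}]) F p.
  by rewrite big_map big_enum.
apply: sum_uniq_le => //.
- by rewrite map_inj_uniq ?enum_uniq// => -[a b] [c d] /= [] /val_inj -> /val_inj ->.
- rewrite map_inj_uniq ?iota_uniq// => x y h.
  by rewrite -(Cantor.cancel_to_of x) -(Cantor.cancel_to_of y) h.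
move=> p /mapP[[i j] _ ->]; apply/mapP; exists (Cantor.to_nat (i : nat, j : nat)).
  rewrite mem_iota add0n leq0n /= ltnS.
  exact: (leq_bigmax (F := fun p : 'I_I * 'I_J => Cantor.to_nat (p.1 : nat, p.2 : nat)) (i, j)).
by rewrite Cantor.cancel_of_to.
Qed.

(** Rectangles and initial segments of the enumeration are cofinal in each other. This links a basis
    indexed by integers with matrix entries. *)
Lemma pair_sum_leP F (M : R) : (forall p, 0 <= F p) ->
  (forall n, \sum_(k < n) F (Cantor.of_nat k) <= M) <->
  (forall J I, \sum_(j < J) \sum_(i < I) F (i : nat, j : nat) <= M).
Proof.
move=> F0; split=> FM.
  by move=> J I; have [n h] := rect_pair_sum F0 J I; apply: le_trans h (FM n).
by move=> n; have [N h] := pair_sum_rect F0 n; apply: le_trans h (FM N N).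
Qed.

End PairSums.

(** * The canonical basis of l^2 *)

Section L2Basis.
Variable R : realType.
Implicit Types x y : l2 R.
Local Notation dot := (@l2dot R).

Definition cdot (a b : R[i]^o) : R[i] := conjc a * b.

Lemma nrm2_cdot a : nrm2 cdot a = sqnormc a.
Proof. by rewrite /nrm2 /cdot mulJc. Qed.

Lemma cdot_si : semi_inner setT cdot.
Proof.
split=> //.
- by move=> a u v w _ _ _; rewrite /cdot mulrDr mulrCA.
- by move=> u v _ _; rewrite /cdot rmorphM /= conjcK mulrC.
- by move=> u _; rewrite nrm2_cdot sqnormc_ge0.
Qed.

Lemma l2_psum_le x : exists M : R, forall n, \sum_(k < n) sqnormc (x k) <= M.
Proof.
by apply/(nneseries_ltP (a := fun k => sqnormc (x k)) (fun k => sqnormc_ge0 _)); exact/asboolP/l2P.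
Qed.

(** Transparent, so that the coordinates of the vector are convertible to the terms of [x]. *)
Definition l2_of (x : nat -> R[i]) (M : R)
    (xM : forall n, \sum_(k < n) sqnormc (x k) <= M) : l2 R.
Proof.
exists x; apply/asboolP.
by apply/(nneseries_ltP (a := fun k => sqnormc (x k)) (fun k => sqnormc_ge0 _)); exists M.
Defined.

Let pi (k : nat) x : R[i]^o := x k.

Let pi_bounded x : exists M : R, forall n, \sum_(k < n) nrm2 cdot (pi k x) <= M.
Proof.
have [M xM] := l2_psum_le x; exists M => n.
by apply: le_trans (xM n); apply: ler_sum => k _; rewrite nrm2_cdot.
Qed.

Lemma l2dot_si : semi_inner setT dot.
Proof. exact: (sum_dot_si cdot_si (pi := pi) _ pi_bounded). Qed.

Lemma l2dotP x y : csum_to (fun k => conjc (x k) * y k) (dot x y).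
Proof. exact: (sum_dotP cdot_si pi_bounded x y). Qed.

Lemma l2_parseval x : \sum_(k < n) sqnormc (x k) @[n --> \oo] --> nrm2 dot x.
Proof.
have h : \sum_(k < n) nrm2 cdot (pi k x) @[n --> \oo] --> nrm2 dot x.
  exact: (sum_dot_parseval cdot_si pi_bounded).
by apply: cvg_ext h => n; apply: eq_bigr => k _; rewrite nrm2_cdot.
Qed.

Lemma l2_basisE i k : l2_basis R k i = (i == k)%:R.
Proof. by []. Qed.

Lemma l2_coord k x : dot (l2_basis R k) x = x k.
Proof.
apply: csum_toE; apply: (csum_to_eventually (N := k.+1)) => n kn.
rewrite (bigD1 (Ordinal kn)) //= eqxx conjc_nat mul1r big1 ?addr0// => i /negP ik.
case: eqP => [h|_]; last by rewrite conjc_nat mul0r.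
by case: ik; apply/eqP/val_inj.
Qed.

Lemma l2_ext x y : (forall k, x k = y k) -> x = y.
Proof. by move=> xy; apply: val_inj; apply: funext. Qed.

Lemma l2_hilbert_basis : hilbert_basis dot (l2_basis R).
Proof.
split.
- exact: l2dot_si.
- by move=> i j; rewrite l2_coord.
- by move=> u; apply: (cvg_ext _ (@l2_parseval u)) => n; apply: eq_bigr => k _; rewrite l2_coord.
- by move=> x M xM; exists (l2_of (x := x) xM) => k; rewrite l2_coord.
- move=> u u0; apply: l2_ext => k; apply/eqP; rewrite -sqnormc_eq0 eq_le sqnormc_ge0 andbT.
  have := psum_le_lim (fun k => sqnormc_ge0 (u k)) (@l2_parseval u) k.+1; rewrite u0.
  by apply: le_trans; apply: (term_le_psum (a := fun k => sqnormc (u k))) => // i; exact: sqnormc_ge0.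
Qed.

End L2Basis.

(** * Hilbert-Schmidt operators as square summable matrices *)

Section HSBasis.
Variable R : realType.
Implicit Types (eta zeta : hs R) (x y : l2 R).
Local Notation e := (l2_basis R).
Local Notation dot := (@l2dot R).
Let siD := l2dot_si R.

Lemma hs_bounded_linear eta : bounded_linear dot eta.
Proof. by have /asboolP[] := hsP eta. Qed.

Lemma hs_linear eta a x y : eta (a *: x + y) = a *: eta x + eta y.
Proof. by have [lin _] := hs_bounded_linear eta; exact: lin. Qed.

Lemma hs_psum_le eta : exists M : R, forall n, \sum_(k < n) nrm2 dot (eta (e k)) <= M.
Proof.
apply/(nneseries_ltP (a := fun k => nrm2 dot (eta (e k)))); first by move=> k; exact: (si_ge0 siD).
by have /asboolP[] := hsP eta.
Qed.

Lemma hsdot_si : semi_inner setT (@hsdot R).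
Proof.
by apply: (sum_dot_si siD (pi := fun k eta => eta (e k)) _ hs_psum_le) => k a u v.
Qed.

Lemma hs_nrm2_cvg eta :
  \sum_(k < n) nrm2 dot (eta (e k)) @[n --> \oo] --> nrm2 (@hsdot R) eta.
Proof. exact: (sum_dot_parseval siD (pi := fun k eta => eta (e k)) hs_psum_le). Qed.

Lemma hs_sum eta n (a : nat -> R[i]) :
  eta (\sum_(k < n) a k *: e k) = \sum_(k < n) a k *: eta (e k).
Proof.
have eta0 : eta 0 = 0.
  by have := hs_linear eta 1 0 0; rewrite !scale1r addr0 => h; apply: (addrI (eta 0)); rewrite -h addr0.
elim: n => [|n IH]; first by rewrite !big_ord0.
by rewrite !big_ord_recr /= addrC hs_linear IH addrC.
Qed.

Lemma hs_expansion eta x :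
  nrm2 dot (\sum_(k < n) x k *: eta (e k) - eta x) @[n --> \oo] --> (0 : R).
Proof.
have [_ [K etaK]] := hs_bounded_linear eta.
have h := hb_expansion (l2_hilbert_basis R) x.
apply: squeeze0 _ (cvg0_addZ (K ^+ 2) 0 h h) => n; rewrite (si_ge0 siD)//= mul0r addr0.
set s := \sum_(k < n) dot (e k) x *: e k.
have -> : \sum_(k < n) x k *: eta (e k) - eta x = eta (s - x).
  rewrite addrC -scaleN1r -[X in _ = eta X](addrC (- x)) -[- x]scaleN1r hs_linear; congr (_ + _).
  by rewrite /s (hs_sum eta n (fun k => dot (e k) x)); apply: eq_bigr => k _; rewrite l2_coord.
have nE y : nrm2 dot y = nrm dot y ^+ 2 by rewrite sqr_sqrtr// (si_ge0 siD).
rewrite !nE -exprMn lerXn2r// ?nnegrE ?sqrtr_ge0// (le_trans _ (etaK _))// sqrtr_ge0//.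
Qed.

(* The matrix of [eta]: its entry in row [i] and column [j] is [eta (e j) i]. *)
Lemma hs_apply eta x i : csum_to (fun j => eta (e j) i * x j) (eta x i).
Proof.
have h := form_cvg siD (FF := eventually_filter) (fun=> I) I (hs_expansion eta x) (w := e i) I.
apply: cvg_ext h => n; rewrite [dot (e i) (eta x)]l2_coord; congr (sqnormc (_ - _)).
rewrite (si_sumr siD n (F := fun k => x k *: eta (e k)))//; apply: eq_bigr => k _.
by rewrite (siZr siD)// l2_coord mulrC.
Qed.

Lemma hs_ext eta zeta : (forall i j, eta (e j) i = zeta (e j) i) -> eta = zeta.
Proof.
move=> ez; apply: val_inj; apply: funext => x; apply: l2_ext => i.
rewrite -(csum_toE (hs_apply zeta x i)); apply/esym/csum_toE.
by apply: cvg_ext (hs_apply eta x i) => n; congr (sqnormc (_ - _)); apply: eq_bigr => k _; rewrite ez.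
Qed.

(** The operator sends y to its inner products with the rows, and Cauchy-Schwarz on each row bounds
    it. *)
Lemma hs_ex (x : nat * nat -> R[i]) (M : R) :
  (forall J I, \sum_(j < J) \sum_(i < I) sqnormc (x (i : nat, j : nat)) <= M) ->
  exists eta, forall i j, eta (e j) i = x (i, j).
Proof.
move=> xM.
have x0 p : 0 <= sqnormc (x p) by exact: sqnormc_ge0.
have rowM i n : \sum_(j < n) sqnormc (conjc (x (i, j : nat))) <= M.
  apply: le_trans (xM n i.+1); apply: ler_sum => j _; rewrite sqnormc_conj.
  exact: (term_le_psum (a := fun i => sqnormc (x (i, j : nat)))).
(* Conjugated because [l2dot] is conjugate-linear in its first argument. *)
pose row i := l2_of (x := fun j => conjc (x (i, j))) (rowM i).
have rowsM n : \sum_(i < n) nrm2 dot (row i) <= M.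
  have c : \sum_(i < n) \sum_(j < J) sqnormc (row i j) @[J --> \oo] -->
      \sum_(i < n) nrm2 dot (row i).
    by apply: cvg_big => [|i _]; [exact: add_continuous|exact: l2_parseval].
  rewrite -(cvg_lim _ c)//; apply: limr_le; first by apply/cvg_ex; eexists; exact: c.
  near=> J; apply: le_trans (xM J n); rewrite exchange_big /=.
  by apply: ler_sum => j _; apply: ler_sum => i _; rewrite sqnormc_conj.
have yM y n : \sum_(i < n) sqnormc (dot (row i) y) <= M * nrm2 dot y.
  apply: le_trans (_ : (\sum_(i < n) nrm2 dot (row i)) * nrm2 dot y <= _).
    rewrite mulr_suml; apply: ler_sum => i _; exact: (si_cauchy_schwarz siD).
  by rewrite ler_wpM2r ?(si_ge0 siD).
pose f y := l2_of (x := fun i => dot (row i) y) (yM y).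
have fe j i : f (e j) i = x (i, j).
  by rewrite -[LHS]/(dot (row i) (e j)) (si_conj siD (u := e j))// l2_coord conjcK.
have f_hs : f \in @hilbert_schmidt R.
  apply/asboolP; split; first split.
  - move=> a u v; apply: l2_ext => i.
    by rewrite -[LHS]/(dot (row i) (a *: u + v)) (si_linear siD).
  - exists (Num.sqrt M) => y; rewrite /nrm -sqrtrM; last by have := xM 0%N 0%N; rewrite big_ord0.
    by apply: ler_wsqrtr; apply: (psum_lim_le (a := fun k => sqnormc (f y k)) (@l2_parseval _ (f y)) (yM y)).
  - apply/(nneseries_ltP (a := fun k => nrm2 dot (f (e k)))).
      by move=> k; exact: (si_ge0 siD).
    exists M => n.
    have c : \sum_(j < n) \sum_(i < I) sqnormc (f (e j) i) @[I --> \oo] -->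
        \sum_(j < n) nrm2 dot (f (e j)).
      by apply: cvg_big => [|j _]; [exact: add_continuous|exact: l2_parseval].
    rewrite -(cvg_lim _ c)//; apply: limr_le; first by apply/cvg_ex; eexists; exact: c.
    near=> I; apply: le_trans (xM n I).
    by apply: ler_sum => j _; apply: ler_sum => i _; rewrite fe.
by exists (HS f_hs).
Unshelve. all: by end_near. Qed.

Lemma hs_rect_le eta J I :
  \sum_(j < J) \sum_(i < I) sqnormc (eta (e j) i) <= nrm2 (@hsdot R) eta.
Proof.
apply: le_trans (_ : \sum_(j < J) nrm2 dot (eta (e j)) <= _).
  by apply: ler_sum => j _; apply: (psum_le_lim (a := fun k => sqnormc (eta (e j) k)) _ (@l2_parseval _ _) I) => k; exact: sqnormc_ge0.
apply: (psum_le_lim (a := fun k => nrm2 dot (eta (e k))) _ (@hs_nrm2_cvg eta)) => k.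
exact: (si_ge0 siD).
Qed.

Lemma hs_nrm2_le eta (M : R) :
  (forall J I, \sum_(j < J) \sum_(i < I) sqnormc (eta (e j) i) <= M) ->
  nrm2 (@hsdot R) eta <= M.
Proof.
move=> eM; apply: (psum_lim_le (a := fun k => nrm2 dot (eta (e k))) (@hs_nrm2_cvg eta)) => n.
have c : \sum_(j < n) \sum_(i < I) sqnormc (eta (e j) i) @[I --> \oo] -->
    \sum_(j < n) nrm2 dot (eta (e j)).
  by apply: cvg_big => [|j _]; [exact: add_continuous|exact: l2_parseval].
rewrite -(cvg_lim _ c)//; apply: limr_le; first by apply/cvg_ex; eexists; exact: c.
by near=> I; exact: eM.
Unshelve. all: by end_near. Qed.

(** The basis consists of the matrix units, enumerated by the Cantor pairing. *)
Lemma hs_basis_ex : exists2 E : nat -> hs R, hilbert_basis (@hsdot R) E &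
  forall k eta, hsdot (E k) eta = eta (e (Cantor.of_nat k).2) (Cantor.of_nat k).1.
Proof.
have ex k : exists eta : hs R, forall i j,
    eta (e j) i = ((i, j) == Cantor.of_nat k)%:R.
  apply: (@hs_ex (fun p => (p == Cantor.of_nat k)%:R) 1).
  apply/(pair_sum_leP (F := fun p => sqnormc ((p == Cantor.of_nat k)%:R))) => [p|n].
    exact: sqnormc_ge0.
  have <- : nrm2 dot (e k) = 1 by rewrite /nrm2 l2_coord l2_basisE eqxx.
  apply: le_trans (psum_le_lim (a := fun i => sqnormc (e k i)) (fun i => sqnormc_ge0 _) (@l2_parseval _ (e k)) n).
  apply: ler_sum => i _; rewrite l2_basisE.
  case: (eqVneq (Cantor.of_nat i) _) => [h|_]; last by rewrite sqnormc0 sqnormc_ge0.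
  by rewrite -(Cantor.cancel_to_of i) h Cantor.cancel_to_of eqxx.
have [E EP] := choice ex.
have EC k eta : hsdot (E k) eta = eta (e (Cantor.of_nat k).2) (Cantor.of_nat k).1.
  case kE : (Cantor.of_nat k) => [i j] /=.
  have Ej j' : E k (e j') = if j' == j then e i else 0.
    apply: l2_ext => i'; rewrite EP kE xpair_eqE.
    by case: (j' == j); rewrite ?andbT ?andbF.
  apply: csum_toE; apply: (csum_to_eventually (N := j.+1)) => n jn.
  rewrite (bigD1 (Ordinal jn)) //= Ej eqxx l2_coord big1 ?addr0// => j' /negP h.
  rewrite Ej; case: eqP => [h'|_]; first by case: h; apply/eqP/val_inj.
  by rewrite (si_conj siD (u := eta (e j')))// (si0r siD)// conjc0.
have si := hsdot_si.
exists E => //; split=> //.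
- move=> k l; rewrite EC EP -surjective_pairing.
  case: (eqVneq k l) => [->|kl]; first by rewrite eqxx.
  case: eqP => // h; case/eqP: kl.
  by rewrite -(Cantor.cancel_to_of k) h Cantor.cancel_to_of.
- move=> eta.
  have [|n|l hl lM] := @psum_cvg_ex _ (fun k => sqnormc (hsdot (E k) eta)) (nrm2 (@hsdot R) eta).
  + by move=> k; exact: sqnormc_ge0.
  + have F0 p : 0 <= sqnormc (eta (e p.2) p.1) by exact: sqnormc_ge0.
    have /(pair_sum_leP _ F0)/(_ n) := hs_rect_le eta; apply: le_trans.
    by apply: ler_sum => k _; rewrite EC.
  have -> // : nrm2 (@hsdot R) eta = l.
  apply/eqP; rewrite eq_le lM andbT; apply: hs_nrm2_le.
  have F0 p : 0 <= sqnormc (eta (e p.2) p.1) by exact: sqnormc_ge0.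
  apply/(pair_sum_leP _ F0) => n.
  have := @psum_le_lim _ (fun k => sqnormc (hsdot (E k) eta)) _ _ hl n.
  move=> h; apply: le_trans (h _); last by move=> k; exact: sqnormc_ge0.
  by apply: ler_sum => k _; rewrite EC.
- move=> x M xM.
  have [|eta etaE] := @hs_ex (fun p => x (Cantor.to_nat p)) M.
    apply/(pair_sum_leP (F := fun p => sqnormc (x (Cantor.to_nat p)))) => [p|n].
      exact: sqnormc_ge0.
    by apply: le_trans (xM n); apply: ler_sum => k _; rewrite Cantor.cancel_to_of.
  by exists eta => k; rewrite EC etaE -surjective_pairing Cantor.cancel_to_of.
- move=> eta eta0; apply: hs_ext => i j.
  rewrite -[RHS]/(0 : R[i]); apply/eqP; rewrite -sqnormc_eq0 eq_le sqnormc_ge0 andbT.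
  have := hs_rect_le eta j.+1 i.+1; rewrite eta0; apply: le_trans.
  rewrite big_ord_recr big_ord_recr /= addrA lerDr addr_ge0// ?sumr_ge0// => k _.
    by apply: sumr_ge0 => l _; exact: sqnormc_ge0.
  exact: sqnormc_ge0.
Qed.

End HSBasis.

(** * Growth of the weights (i + m)! / i! *)

Section RisingFactorial.
Variable R : realType.

Definition rising (m i : nat) : R := ((i + m) ^_ m)%:R.

Lemma risingS m i : rising m.+1 i = (i + m.+1)%:R * rising m i.
Proof. by rewrite /rising addnS ffactSS natrM. Qed.

Lemma rising0 i : rising 0 i = 1. Proof. by rewrite /rising ffactn0. Qed.

Lemma rising_ge1 m i : 1 <= rising m i.
Proof. by rewrite /rising ler1n ffact_gt0 leq_addl. Qed.

Lemma rising_ge0 m i : 0 <= rising m i.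
Proof. exact: le_trans (rising_ge1 m i). Qed.

Lemma rising_ge_exp m i : i%:R ^+ m <= rising m i.
Proof.
elim: m => [|m IH]; first by rewrite rising0 expr0.
by rewrite risingS exprS ler_pM// ?exprn_ge0// ler_nat leq_addr.
Qed.

Lemma rising_ge_nat m i : (0 < m)%N -> i.+1%:R <= rising m i.
Proof.
case: m => // m _; rewrite risingS -[leLHS]mulr1 ler_pM// ?rising_ge1//.
by rewrite ler_nat addnS ltnS leq_addr.
Qed.

(** The ratio is a product of m ratios tending to 1. Each induction step splits mu into two equal
    factors, one for the new linear term and one for the remaining product. *)
Lemma rising_shift_le (mu : R) m s : 1 < mu ->
  exists N, forall i, (N <= i)%N -> rising m (i + s) <= mu * rising m i.
Proof.
elim: m mu => [|m IH] mu mu1.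
  by exists 0%N => i _; rewrite !rising0 mulr1 ltW.
have nu1 : 1 < Num.sqrt mu by rewrite -[ltLHS]sqrtr1 ltr_sqrt// (lt_trans _ mu1).
have [N hN] := IH _ nu1; set nu := Num.sqrt mu in nu1 hN *.
have [K hK] : exists K : nat, s%:R / (nu - 1) <= K%:R.
  exists (Num.bound (s%:R / (nu - 1))); apply/ltW/archi_boundP.
  by rewrite divr_ge0// subr_ge0 ltW.
exists (maxn N K) => i; rewrite geq_max => /andP[Ni Ki].
have mu0 : 0 <= mu by apply: le_trans (ltW mu1).
have -> : mu = nu * nu by rewrite -expr2 sqr_sqrtr.
rewrite !risingS mulrACA ler_pM// ?rising_ge0// ?hN//.
have h : s%:R <= (nu - 1) * i%:R.
  rewrite -ler_pdivrMl ?subr_gt0// mulrC; apply: le_trans hK _.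
  by rewrite ler_nat.
rewrite addnAC !natrD; set a := i%:R; set b := m.+1%:R; set d := s%:R in h *.
have b0 : 0 <= (nu - 1) * b by rewrite mulr_ge0// subr_ge0 ltW.
lra.
Qed.

(** The finitely many exceptional indices go into [C], which becomes a multiple of |eta|^2 in the
    form bound. *)
Lemma rising_shift_bound (mu : R) m : 1 < mu ->
  exists2 C : R, 0 <= C & forall i, rising m (i + m) <= mu * rising m i + C.
Proof.
move=> mu1; have [N hN] := rising_shift_le m m mu1.
exists (\sum_(i < N) rising m (i + m)); first by apply: sumr_ge0 => i _; exact: rising_ge0.
move=> i; have [Ni|iN] := leqP N i.
  by apply: le_trans (hN i Ni) _; rewrite lerDl sumr_ge0// => k _; exact: rising_ge0.
rewrite -[leLHS]add0r lerD ?mulr_ge0 ?rising_ge0 ?(le_trans _ (ltW mu1))//.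
by apply: (term_le_psum (a := fun i => rising m (i + m))) => // k; exact: rising_ge0.
Qed.

Lemma rising_exp_sum m (t : R) : (0 < m)%N -> 0 < t ->
  exists M, forall n, \sum_(k < n) expR (- (t * rising m k)) <= M.
Proof.
move=> m0 t0; set q := expR (- t); have q0 : 0 < q by exact: expR_gt0.
have q1 : q < 1 by rewrite /q -[ltRHS]expR0 ltr_expR oppr_lt0.
have q1' : 0 < 1 - q by rewrite subr_gt0.
exists ((1 - q)^-1) => n; apply: le_trans (_ : \sum_(k < n) q ^+ k <= _).
  apply: ler_sum => k _; rewrite /q -expRM_natl ler_expR.
  rewrite mulrN lerN2 mulrC ler_wpM2l ?(ltW t0)//.
  by apply: le_trans (rising_ge_nat k m0); rewrite ler_nat.
rewrite -(@ler_pM2l _ (1 - q))// mulfV ?gt_eqF//.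
rewrite -opprB mulNr -subrX1 opprB gerBl exprn_ge0// ltW//.
Qed.

End RisingFactorial.

(** * Powers of creation and their adjoints in coordinates *)

Section CreationCoordinates.
Variable R : realType.
Local Notation e := (l2_basis R).
Local Notation dot := (@l2dot R).
Let siD := l2dot_si R.
Variable m : nat.

Definition creation_coef (n k : nat) : R := Num.sqrt (rising R n k).
Local Notation c := creation_coef.

Lemma sqr_creation_coef n k : c n k ^+ 2 = rising R n k.
Proof. by rewrite sqr_sqrtr// rising_ge0. Qed.

Lemma creation_coefS n k : c n.+1 k = Num.sqrt ((k + n).+1%:R) * c n k.
Proof. by rewrite /c risingS sqrtrM// addnS. Qed.

Definition shift_up n (x : nat -> R[i]) (i : nat) : R[i] :=
  if (i < n)%N then 0 else (c n (i - n))%:C * x (i - n)%N.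

(** The intermediate domain conditions are automatic: undoing a creation step divides by sqrt (k +
    1) >= 1, so it preserves square summability and returns a vector in the domain. *)
Lemma opexp_creationE n (x y : l2 R) :
  opexp (@creation R) n x y <-> forall i, y i = shift_up n x i.
Proof.
elim: n y => [|n IH] y.
  rewrite /shift_up /opexp /=; split=> [-> i|h].
    by rewrite subn0 /c rising0 sqrtr1 mul1r.
  by apply: l2_ext => i; rewrite h subn0 /c rising0 sqrtr1 mul1r.
split=> [[v /IH vE [_ y0 yS]]|yE].
  case=> [|i]; first by rewrite y0.
  rewrite yS vE /shift_up ltnS subSS; case: ltnP => ni; first by rewrite mulr0.
  by rewrite mulrA -rmorphM creation_coefS subnK.
have sq0 k : (Num.sqrt (k.+1%:R : R))%:C != 0 :> R[i].
  by rewrite eq_complex /= eqxx andbT sqrtr_eq0 -ltNge ltr0n.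
pose v k := (Num.sqrt (k.+1%:R : R))^-1%:C * y k.+1.
have [M yM] := l2_psum_le y.
have vk k : k.+1%:R * sqnormc (v k) = sqnormc (y k.+1).
  by rewrite /v sqnormcM sqnormc_real exprVn sqr_sqrtr// mulrA mulfV ?mul1r// pnatr_eq0.
have yM' n' : \sum_(k < n') sqnormc (y k.+1) <= M.
  apply: le_trans (yM n'.+1); rewrite big_ord_recl lerDr; exact: sqnormc_ge0.
have vM n' : \sum_(k < n') sqnormc (v k) <= M.
  apply: le_trans (yM' n'); apply: ler_sum => k _; rewrite -vk -[leLHS]mul1r.
  by rewrite ler_wpM2r ?sqnormc_ge0// ler1n.
exists (l2_of (x := v) vM).
  apply/IH => i; rewrite -[LHS]/(v i) /v yE /shift_up ltnS subSS.
  case: ltnP => ni; first by rewrite mulr0.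
  rewrite mulrA -rmorphM creation_coefS subnK// mulrA mulVf ?mul1r//.
split.
- apply/(nneseries_ltP (a := fun k => k%:R ^+ 1 * sqnormc (v k))).
    by move=> k; rewrite mulr_ge0 ?sqnormc_ge0 ?exprn_ge0.
  exists M => n'; apply: le_trans (yM' n'); apply: ler_sum => k _.
  by rewrite -vk expr1 ler_wpM2r ?sqnormc_ge0// ler_nat.
- by rewrite yE.
- by move=> k; rewrite -[X in _ * X]/(v k) /v mulrA -rmorphM /= mulfV ?mul1r.
Qed.

(** Square summability of the image implies the domain condition, because k^m is at most the weight
    [rising m k]. *)
Lemma creation_powE (x y : l2 R) :
  creation_pow m x y <-> forall i, y i = shift_up m x i.
Proof.
split=> [[_ /opexp_creationE//]|yE]; split; last exact/opexp_creationE.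
have [M yM] := l2_psum_le y.
apply/(nneseries_ltP (a := fun k => k%:R ^+ m * sqnormc (x k))).
  by move=> k; rewrite mulr_ge0 ?sqnormc_ge0 ?exprn_ge0.
exists M => n; apply: le_trans (yM (m + n)%N).
rewrite big_split_ord /= -[leLHS]add0r lerD ?sumr_ge0//.
  by move=> k _; exact: sqnormc_ge0.
apply: ler_sum => k _; rewrite yE /shift_up ltnNge leq_addr /= addKn.
by rewrite sqnormcM sqnormc_real sqr_creation_coef ler_wpM2r ?sqnormc_ge0 ?rising_ge_exp.
Qed.

Lemma adjoint_creation_powE (v w : l2 R) :
  adjoint dot (@creation_pow R m) v w <-> forall k, w k = (c m k)%:C * v (k + m)%N.
Proof.
split=> [h k|wE x y /creation_powE yE].
  have /h : creation_pow m (e k) ((c m k)%:C *: e (k + m)%N).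
    apply/creation_powE => i; rewrite /shift_up -[LHS]/((c m k)%:C * e (k + m)%N i) !l2_basisE.
    case: ltnP => im; first by rewrite ltn_eqF ?mulr0// (leq_trans im)// leq_addl.
    by rewrite -[(i - m)%N == k](eqn_add2r m) subnK//; case: eqP => [->|_]; rewrite ?addnK// !mulr0.
  rewrite (siZr siD)// (si_conj siD (u := e _))// (si_conj siD (u := e k))// !l2_coord.
  move=> /(congr1 (@conjc _)); rewrite rmorphM /= !conjcK oppr0 => <- //.
rewrite -(csum_toE (l2dotP w x)); apply/csum_toE.
have h := l2dotP w x.
(* The first m coordinates of y vanish, so the two series agree after a shift by m. *)
rewrite (csum_toE h); rewrite /csum_to -(cvg_shiftn m).
apply: cvg_ext h => n; congr (sqnormc (_ - _)).
apply: esym; rewrite addnC big_split_ord /= big1 ?add0r; last first.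
  by move=> i _; rewrite yE /shift_up ltn_ord mulr0.
apply: eq_bigr => k _; rewrite wE yE /shift_up ltnNge leq_addr /= addKn [(m + k)%N]addnC.
have -> : conjc ((c m k)%:C * v (k + m)%N) = (c m k)%:C * conjc (v (k + m)%N).
  by rewrite rmorphM /= oppr0.
by ring.
Qed.

End CreationCoordinates.

(** * Left and right multiplication on matrices, and the four norms *)

Section HSCoordinates.
Variable R : realType.
Local Notation e := (l2_basis R).
Local Notation dot := (@l2dot R).
Local Notation c := (@creation_coef R).
Let siD := l2dot_si R.
Variable m : nat.
Implicit Types eta zeta : hs R.

Let csum_to0 : csum_to (fun=> 0 : R[i]) 0.
Proof. by apply: (csum_to_eventually (N := 0%N)) => n _; rewrite big1. Qed.

Lemma hs_apply_eq zeta (x : l2 R) i a :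
  csum_to (fun j => zeta (e j) i * x j) a -> zeta x i = a.
Proof. by move=> h; rewrite -(csum_toE (hs_apply zeta x i)) (csum_toE h). Qed.

(** The relation on columns extends to every x because each row acts on x by a convergent series. *)
Lemma left_comp_creationE eta zeta : left_comp (@creation_pow R m) eta zeta <->
  forall i j, zeta (e j) i = shift_up m (eta (e j)) i.
Proof.
split=> [h i j|h x]; first by have /creation_powE := h (e j).
apply/creation_powE => i; apply: hs_apply_eq; rewrite /shift_up.
case: ltnP => im.
  apply: (csum_to_eventually (N := 0%N)) => n _; rewrite big1// => j _.
  by rewrite h /shift_up im mul0r.
have := csum_to_linear (c m (i - m))%:C (hs_apply eta x (i - m)) csum_to0.
rewrite addr0; apply: cvg_ext => n; congr (sqnormc (_ - _)); apply: eq_bigr => j _.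
by rewrite h /shift_up ltnNge im /= addr0 mulrA.
Qed.

Lemma left_comp_adjointE eta zeta :
  left_comp (adjoint dot (@creation_pow R m)) eta zeta <->
  forall i j, zeta (e j) i = (c m i)%:C * eta (e j) (i + m)%N.
Proof.
split=> [h i j|h x]; first by have /adjoint_creation_powE := h (e j).
apply/adjoint_creation_powE => i; apply: hs_apply_eq.
have := csum_to_linear (c m i)%:C (hs_apply eta x (i + m)) csum_to0.
rewrite addr0; apply: cvg_ext => n; congr (sqnormc (_ - _)); apply: eq_bigr => j _.
by rewrite h addr0 mulrA.
Qed.

Lemma modular_conjE eta zeta :
  modular_conj eta zeta <-> forall i j, zeta (e j) i = conjc (eta (e i) j).
Proof.
split=> [h i j|h x y].
  by have := h (e i) (e j); rewrite l2_coord (si_conj siD (u := e j))// l2_coord => <-.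
have h1 k : dot (eta x) (e k) = dot x (zeta (e k)).
  rewrite (si_conj siD (u := e k))// l2_coord.
  rewrite -(csum_toE (l2dotP x (zeta (e k)))); apply/esym/csum_toE.
  have := csum_to_conj (hs_apply eta x k).
  apply: cvg_ext => n; congr (sqnormc (_ - _)); apply: eq_bigr => j _.
  by rewrite h rmorphM mulrC.
have c1 := form_cvg siD (FF := eventually_filter) (fun=> I) I
  (hb_expansion (l2_hilbert_basis R) y) (w := eta x) I.
have c2 := form_cvg siD (FF := eventually_filter) (fun=> I) I (hs_expansion zeta y) (w := x) I.
apply: (sqnormc_cvg_unique c1); apply: cvg_ext c2 => n; congr (sqnormc (_ - _)).
rewrite (si_sumr siD n (F := fun k => y k *: zeta (e k)))//.
rewrite (si_sumr siD n (F := fun k => dot (e k) y *: e k))//.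
by apply: eq_bigr => k _; rewrite !(siZr siD)// h1 l2_coord.
Qed.

Lemma hs_adj_ex : exists J : hs R -> hs R,
  forall eta i j, J eta (e j) i = conjc (eta (e i) j).
Proof.
suff ex eta : exists zeta : hs R, forall i j, zeta (e j) i = conjc (eta (e i) j).
  by have [J JP] := choice ex; exists J.
apply: (@hs_ex _ (fun p => conjc (eta (e p.1) p.2)) (nrm2 (@hsdot R) eta)) => J I.
rewrite exchange_big /=; apply: le_trans (hs_rect_le eta I J).
by apply: ler_sum => j _; apply: ler_sum => i _; rewrite sqnormc_conj.
Qed.

Variable J : hs R -> hs R.
Hypothesis JE : forall eta i j, J eta (e j) i = conjc (eta (e i) j).

Lemma hs_adjK eta : J (J eta) = eta.
Proof. by apply: hs_ext => i j; rewrite !JE conjcK. Qed.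

Lemma hs_adj_modular_conj eta zeta : modular_conj eta zeta <-> zeta = J eta.
Proof.
split=> [/modular_conjE h|->]; last by apply/modular_conjE.
by apply: hs_ext => i j; rewrite h JE.
Qed.

Lemma right_opE (X : op (hs R)) eta zeta : right_op X eta zeta <-> X (J eta) (J zeta).
Proof.
split=> [[v [u /hs_adj_modular_conj -> Xv] /hs_adj_modular_conj ->]|h].
  by rewrite hs_adjK.
exists (J zeta); last by apply/hs_adj_modular_conj; rewrite hs_adjK.
by exists (J eta) => //; apply/hs_adj_modular_conj.
Qed.

Lemma hs_rect_adj eta K L :
  \sum_(j < K) \sum_(i < L) sqnormc (J eta (e j) i) =
  \sum_(j < L) \sum_(i < K) sqnormc (eta (e j) i).
Proof.
rewrite exchange_big /=; apply: eq_bigr => i _; apply: eq_bigr => j _.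
by rewrite JE sqnormc_conj.
Qed.

Lemma hs_nrm2_adj eta : nrm2 (@hsdot R) (J eta) = nrm2 (@hsdot R) eta.
Proof.
have le zeta : nrm2 (@hsdot R) (J zeta) <= nrm2 (@hsdot R) zeta.
  by apply: hs_nrm2_le => K L; rewrite hs_rect_adj; exact: hs_rect_le.
by apply/le_anti; rewrite le /= -{1}(hs_adjK eta) le.
Qed.

(** For eta it bounds [N1] of the overview; for [J eta], whose rows are the conjugated columns of
    eta, it bounds [N4]. *)
Definition row_bound eta (M : R) := forall K L,
  \sum_(j < K) \sum_(i < L) rising R m i * sqnormc (eta (e j) i) <= M.

Let t0 eta i j : 0 <= rising R m i * sqnormc (eta (e j) i).
Proof. by rewrite mulr_ge0 ?rising_ge0 ?sqnormc_ge0. Qed.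

Lemma shift_up_row_bound eta zeta :
  (forall i j, zeta (e j) i = shift_up m (eta (e j)) i) ->
  row_bound eta (nrm2 (@hsdot R) zeta).
Proof.
move=> zE K L; apply: le_trans (hs_rect_le zeta K (m + L)); apply: ler_sum => j _.
rewrite big_split_ord /= -[leLHS]add0r lerD ?sumr_ge0//.
  by move=> i _; exact: sqnormc_ge0.
apply: ler_sum => i _; rewrite zE /shift_up ltnNge leq_addr /= addKn.
by rewrite sqnormcM sqnormc_real sqr_creation_coef.
Qed.

Lemma shift_up_ex eta M : row_bound eta M -> exists zeta,
  (forall i j, zeta (e j) i = shift_up m (eta (e j)) i) /\ nrm2 (@hsdot R) zeta <= M.
Proof.
move=> eM; pose x (p : nat * nat) := shift_up m (eta (e p.2)) p.1.
have xE i j : sqnormc (x ((m + i)%N, j)) = rising R m i * sqnormc (eta (e j) i).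
  rewrite /x /shift_up ltnNge leq_addr /= addKn.
  by rewrite sqnormcM sqnormc_real sqr_creation_coef.
have xM K L : \sum_(j < K) \sum_(i < L) sqnormc (x (i : nat, j : nat)) <= M.
  apply: le_trans (eM K L); apply: ler_sum => j _.
  apply: le_trans (psum_nd (a := fun i => sqnormc (x (i, j : nat))) _ (leq_addl m L)) _.
    by move=> i; exact: sqnormc_ge0.
  rewrite big_split_ord /= big1 ?add0r.
    by apply: ler_sum => i _; rewrite xE.
  by move=> i _; rewrite /x /shift_up ltn_ord sqnormc0.
have [zeta zE] := hs_ex xM; exists zeta; split; first by move=> i j; rewrite zE.
by apply: hs_nrm2_le => K L; under eq_bigr do under eq_bigr do rewrite zE; exact: xM.
Qed.

Lemma rising_le_shift i k : rising R m i <= rising R m (k + i).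
Proof.
rewrite /rising ler_nat; elim: m => [|n IH]; first by rewrite !ffactn0.
by rewrite !addnS !ffactSS leq_mul// ltnS -addnA leq_addl.
Qed.

(** Monotonicity of the weights gives N3 <= N1, so the adjoint is defined wherever the creation
    power is. *)
Lemma shift_down_ex eta M : row_bound eta M -> exists zeta,
  (forall i j, zeta (e j) i = (c m i)%:C * eta (e j) (i + m)%N) /\
  nrm2 (@hsdot R) zeta <= M.
Proof.
move=> eM; pose x (p : nat * nat) := (c m p.1)%:C * eta (e p.2) (p.1 + m)%N.
have xM K L : \sum_(j < K) \sum_(i < L) sqnormc (x (i : nat, j : nat)) <= M.
  apply: le_trans (eM K (m + L)); apply: ler_sum => j _.
  rewrite [leRHS]big_split_ord /= -[leLHS]add0r lerD//.
    by apply: sumr_ge0 => i _; exact: t0.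
  apply: ler_sum => i _; rewrite /x sqnormcM sqnormc_real sqr_creation_coef [(i + m)%N]addnC.
  by rewrite ler_wpM2r ?sqnormc_ge0// rising_le_shift.
have [zeta zE] := hs_ex xM; exists zeta; split; first by move=> i j; rewrite zE.
by apply: hs_nrm2_le => K L; under eq_bigr do under eq_bigr do rewrite zE; exact: xM.
Qed.

(** The shifted sum misses the first m terms; [C] absorbs them together with the additive error of
    [rising_shift_bound]. *)
Lemma rising_sum_le (mu : R) : 1 < mu -> exists2 C : R, 0 <= C &
  forall (a : nat -> R) L, (forall k, 0 <= a k) ->
    \sum_(i < m + L) rising R m i * a i <=
    mu * (\sum_(i < L) rising R m i * a (i + m)%N) + C * \sum_(i < m + L) a i.
Proof.
move=> mu1; have [C0 C00 hC0] := rising_shift_bound m mu1.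
have r0 i : 0 <= rising R m i by exact: rising_ge0.
pose C1 := \sum_(i < m) rising R m i.
have C10 : 0 <= C1 by exact: sumr_ge0.
exists (C0 + C1) => [|a L a0]; first exact: addr_ge0.
rewrite !big_split_ord /=.
have h1 : \sum_(i < m) rising R m i * a i <= (C0 + C1) * \sum_(i < m) a i.
  rewrite mulr_sumr; apply: ler_sum => i _; rewrite ler_wpM2r//.
  apply: le_trans (_ : C1 <= _); last by rewrite lerDr.
  exact: (term_le_psum (a := fun i => rising R m i)).
have h2 : \sum_(i < L) rising R m (m + i) * a (m + i)%N <=
    mu * (\sum_(i < L) rising R m i * a (i + m)%N) + (C0 + C1) * \sum_(i < L) a (m + i)%N.
  rewrite !mulr_sumr -big_split /=; apply: ler_sum => i _.
  rewrite ![(m + i)%N]addnC mulrA -mulrDl ler_wpM2r// addrA.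
  by apply: le_trans (hC0 i) _; rewrite lerDl.
rewrite mulrDr; lra.
Qed.

(** This is N1 <= mu N3 + C |eta|^2, and N4 <= mu N2 + C |eta|^2 when applied to [J eta]. *)
Lemma shift_up_le_down (mu : R) : 1 < mu -> exists2 C : R, 0 <= C &
  forall eta u d : hs R,
    (forall i j, u (e j) i = shift_up m (eta (e j)) i) ->
    (forall i j, d (e j) i = (c m i)%:C * eta (e j) (i + m)%N) ->
    nrm2 (@hsdot R) u <= mu * nrm2 (@hsdot R) d + C * nrm2 (@hsdot R) eta.
Proof.
move=> mu1; have [C C0 hC] := rising_sum_le mu1; exists C => // eta u d uE dE.
have mu0 : 0 <= mu by rewrite (le_trans _ (ltW mu1)).
apply: hs_nrm2_le => K L.
apply: le_trans (_ : \sum_(j < K) (mu * (\sum_(i < L) sqnormc (d (e j) i)) +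
    C * \sum_(i < m + L) sqnormc (eta (e j) i)) <= _); last first.
  rewrite big_split /= -!mulr_sumr lerD// ler_wpM2l//; exact: hs_rect_le.
apply: ler_sum => j _.
apply: le_trans (_ : \sum_(i < m + L) rising R m i * sqnormc (eta (e j) i) <= _).
  apply: le_trans (psum_nd (a := fun i => sqnormc (u (e j) i)) _ (leq_addl m L)) _.
    by move=> i; exact: sqnormc_ge0.
  rewrite big_split_ord /= big1 ?add0r; last first.
    by move=> i _; rewrite uE /shift_up ltn_ord sqnormc0.
  apply: le_trans (psum_nd (a := fun i => rising R m i * sqnormc (eta (e j) i)) _ (leq_addl m L)).
    apply: ler_sum => i _; rewrite uE /shift_up ltnNge leq_addr /= addKn.
    by rewrite sqnormcM sqnormc_real sqr_creation_coef.
  by move=> i; exact: t0.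
apply: le_trans (hC (fun i => sqnormc (eta (e j) i)) L (fun i => sqnormc_ge0 _)) _.
rewrite lerD2r ler_wpM2l//; apply: ler_sum => i _.
by rewrite dE sqnormcM sqnormc_real sqr_creation_coef.
Qed.

End HSCoordinates.

(** * Comparison of the Dirichlet form with the weights *)

Section DirichletForm.
Variable R : realType.
Local Notation e := (l2_basis R).
Local Notation hdot := (@hsdot R).
Local Notation c := (@creation_coef R).
Let siD := hsdot_si R.
Variables (m : nat) (J : hs R -> hs R) (E : nat -> hs R).
Hypothesis JE : forall eta i j, J eta (e j) i = conjc (eta (e i) j).
Hypothesis hbE : hilbert_basis hdot E.
Hypothesis EE : forall k eta, hdot (E k) eta = eta (e (Cantor.of_nat k).2) (Cantor.of_nat k).1.

Definition pair_weight (k : nat) : R :=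
  rising R m (Cantor.of_nat k).1 + rising R m (Cantor.of_nat k).2.

Lemma pair_weight_ge0 k : 0 <= pair_weight k.
Proof. by apply: addr_ge0; exact: rising_ge0. Qed.

(** The exponential of a sum of weights factorizes into a row series and a column series. *)
Lemma pair_weight_exp_sum (t : R) : (0 < m)%N -> 0 < t ->
  exists M, forall n, \sum_(k < n) expR (- (t * pair_weight k)) <= M.
Proof.
move=> m0 t0; have [M hM] := rising_exp_sum m0 t0; exists (M * M).
pose F (p : nat * nat) := expR (- (t * (rising R m p.1 + rising R m p.2))).
apply/(pair_sum_leP (F := F)) => [p|K L]; first exact: expR_ge0.
have -> : \sum_(j < K) \sum_(i < L) F (i : nat, j : nat) =
    (\sum_(j < K) expR (- (t * rising R m j))) * (\sum_(i < L) expR (- (t * rising R m i))).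
  rewrite mulr_suml; apply: eq_bigr => j _; rewrite mulr_sumr; apply: eq_bigr => i _.
  by rewrite /F -expRD; congr expR; rewrite /=; ring.
by rewrite ler_pM// ?sumr_ge0// => i _; exact: expR_ge0.
Qed.

Local Notation wle := (weight_le hdot E pair_weight).
Local Notation D := (form_dom hdot E pair_weight).

Lemma row_bound_adjE eta M : row_bound m (J eta) M <-> forall K L,
  \sum_(j < K) \sum_(i < L) rising R m j * sqnormc (eta (e j) i) <= M.
Proof.
have E' K L : \sum_(j < K) \sum_(i < L) rising R m i * sqnormc (J eta (e j) i) =
    \sum_(j < L) \sum_(i < K) rising R m j * sqnormc (eta (e j) i).
  rewrite exchange_big /=; apply: eq_bigr => i _; apply: eq_bigr => j _.
  by rewrite JE sqnormc_conj.
by split=> h K L; have := h L K; rewrite E'.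
Qed.

Lemma pair_weightP eta M : wle eta M <-> forall K L,
  \sum_(j < K) \sum_(i < L) (rising R m i + rising R m j) * sqnormc (eta (e j) i) <= M.
Proof.
pose F (p : nat * nat) := (rising R m p.1 + rising R m p.2) * sqnormc (eta (e p.2) p.1).
have F0 p : 0 <= F p by apply: mulr_ge0; [apply: addr_ge0; exact: rising_ge0|exact: sqnormc_ge0].
have PE := pair_sum_leP M F0; split=> [h|/PE h n].
  by apply/PE => n; apply: le_trans (h n); apply: ler_sum => k _; rewrite EE.
by apply: le_trans (h n); apply: ler_sum => k _; rewrite EE.
Qed.

Lemma wle_row_bound eta M : wle eta M -> row_bound m eta M /\ row_bound m (J eta) M.
Proof.
move=> /pair_weightP h; split; last apply/row_bound_adjE; move=> K L;
    apply: le_trans (h K L); apply: ler_sum => j _; apply: ler_sum => i _.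
  by rewrite ler_wpM2r ?sqnormc_ge0// lerDl rising_ge0.
by rewrite ler_wpM2r ?sqnormc_ge0// lerDr rising_ge0.
Qed.

Lemma row_bound_wle eta M K : row_bound m eta M -> row_bound m (J eta) K -> wle eta (M + K).
Proof.
move=> h1 /row_bound_adjE h2; apply/pair_weightP => k l.
apply: le_trans (lerD (h1 k l) (h2 k l)); rewrite -big_split /=.
by apply: ler_sum => j _; rewrite -big_split /=; apply: ler_sum => i _; rewrite mulrDl.
Qed.

(** [U] is 0 where no row bound exists. Its value must not depend on the bound [M], which holds
    because the matrix determines the operator. *)
Lemma shift_up_fun : exists U : hs R -> hs R, forall eta M, row_bound m eta M ->
  (forall i j, U eta (e j) i = shift_up m (eta (e j)) i) /\ nrm2 hdot (U eta) <= M.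
Proof.
suff ex eta : exists zeta : hs R, forall M, row_bound m eta M ->
    (forall i j, zeta (e j) i = shift_up m (eta (e j)) i) /\ nrm2 hdot zeta <= M.
  by have [U UP] := choice ex; exists U.
have [[M0 h0]|no] := pselect (exists M, row_bound m eta M); last first.
  by exists 0 => M h; case: no; exists M.
have [z0 [z0E _]] := shift_up_ex h0; exists z0 => M h.
have [z [zE zM]] := shift_up_ex h.
by have <- : z = z0 by apply: hs_ext => i j; rewrite zE z0E.
Qed.

Lemma shift_down_fun : exists T : hs R -> hs R, forall eta M, row_bound m eta M ->
  (forall i j, T eta (e j) i = (c m i)%:C * eta (e j) (i + m)%N) /\ nrm2 hdot (T eta) <= M.
Proof.
suff ex eta : exists zeta : hs R, forall M, row_bound m eta M ->
    (forall i j, zeta (e j) i = (c m i)%:C * eta (e j) (i + m)%N) /\ nrm2 hdot zeta <= M.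
  by have [T TP] := choice ex; exists T.
have [[M0 h0]|no] := pselect (exists M, row_bound m eta M); last first.
  by exists 0 => M h; case: no; exists M.
have [z0 [z0E _]] := shift_down_ex h0; exists z0 => M h.
have [z [zE zM]] := shift_down_ex h.
by have <- : z = z0 by apply: hs_ext => i j; rewrite zE z0E.
Qed.

Variables U T : hs R -> hs R.
Hypothesis UP : forall eta M, row_bound m eta M ->
  (forall i j, U eta (e j) i = shift_up m (eta (e j)) i) /\ nrm2 hdot (U eta) <= M.
Hypothesis TP : forall eta M, row_bound m eta M ->
  (forall i j, T eta (e j) i = (c m i)%:C * eta (e j) (i + m)%N) /\ nrm2 hdot (T eta) <= M.
Variable lam : R.
Hypothesis lam_gt0 : 0 < lam.

(** On the form domain, [U] and [T] are X and its adjoint, and conjugating them by [J] gives the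
    right multiplications of the form. *)
Definition form_part1 eta := lam%:C *: U eta - lam^-1%:C *: J (T (J eta)).
Definition form_part2 eta := lam^-1%:C *: T eta - lam%:C *: J (U (J eta)).
Definition form_inner u v :=
  hdot (form_part1 u) (form_part1 v) + hdot (form_part2 u) (form_part2 v).

Lemma form_inner_nrm2 u :
  nrm2 form_inner u = nrm2 hdot (form_part1 u) + nrm2 hdot (form_part2 u).
Proof. by rewrite /nrm2 /form_inner ReD. Qed.

Lemma dom_row_bound eta : D eta -> exists2 M, row_bound m eta M & row_bound m (J eta) M.
Proof. by move=> [M /wle_row_bound[h1 h2]]; exists M. Qed.

Lemma hs_linE a (u v : hs R) x i : (a *: u + v) x i = a * u x i + v x i.
Proof. by []. Qed.

Lemma hs_subE (u v : hs R) x i : (u - v) x i = u x i - v x i.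
Proof. by []. Qed.

Lemma hs_scaleE a (u : hs R) x i : (a *: u) x i = a * u x i.
Proof. by []. Qed.

Lemma form_part1E eta i j : D eta -> form_part1 eta (e j) i =
  lam%:C * shift_up m (eta (e j)) i - lam^-1%:C * ((c m j)%:C * eta (e (j + m)%N) i).
Proof.
move=> /dom_row_bound[M /UP[uE _] /TP[tE _]].
rewrite hs_subE !hs_scaleE uE JE tE JE; congr (_ - _ * _).
by rewrite rmorphM /= conjcK oppr0.
Qed.

Lemma form_part2E eta i j : D eta -> form_part2 eta (e j) i =
  lam^-1%:C * ((c m i)%:C * eta (e j) (i + m)%N) -
  lam%:C * conjc (shift_up m (J eta (e i)) j).
Proof.
move=> /dom_row_bound[M /TP[tE _] /UP[uE _]].
by rewrite hs_subE !hs_scaleE tE JE uE.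
Qed.

Lemma form_dom_lin a u v : D u -> D v -> D (a *: u + v).
Proof.
move=> [M uM] [K vK]; exists (2 * sqnormc a * M + 2 * K).
exact: (weight_le_lin hbE pair_weight_ge0).
Qed.

Lemma shift_up_lin a (x y z : nat -> R[i]) i : (forall k, z k = a * x k + y k) ->
  shift_up m z i = a * shift_up m x i + shift_up m y i.
Proof.
move=> zE; rewrite /shift_up; case: ifP => _; first by rewrite mulr0 addr0.
by rewrite zE; ring.
Qed.

Lemma form_part1_lin a u v : D u -> D v ->
  form_part1 (a *: u + v) = a *: form_part1 u + form_part1 v.
Proof.
move=> Du Dv; apply: hs_ext => i j.
rewrite (form_part1E _ _ (form_dom_lin a Du Dv)) [RHS]hs_linE.
rewrite (form_part1E i j Du) (form_part1E i j Dv).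
rewrite (shift_up_lin (a := a) (x := u (e j)) (y := v (e j)))// hs_linE.
have aux (p q k X Y x y : R[i]) : p * (a * X + Y) - q * (k * (a * x + y)) =
    a * (p * X - q * (k * x)) + (p * Y - q * (k * y)) by ring.
exact: aux.
Qed.

Lemma form_part2_lin a u v : D u -> D v ->
  form_part2 (a *: u + v) = a *: form_part2 u + form_part2 v.
Proof.
move=> Du Dv; apply: hs_ext => i j.
rewrite (form_part2E _ _ (form_dom_lin a Du Dv)) [RHS]hs_linE.
rewrite (form_part2E i j Du) (form_part2E i j Dv).
(* [J] is antilinear, so the scalar is conjugated inside and restored by the outer conjugation. *)
rewrite (shift_up_lin (a := conjc a) (x := J u (e i)) (y := J v (e i))).
  set X := shift_up m (J u (e i)) j; set Y := shift_up m (J v (e i)) j.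
  have -> : conjc (conjc a * X + Y) = a * conjc X + conjc Y.
    by rewrite rmorphD rmorphM /= conjcK.
  have aux (p q k x y Z Z' : R[i]) : q * (k * (a * x + y)) - p * (a * Z + Z') =
      a * (q * (k * x) - p * Z) + (q * (k * y) - p * Z') by ring.
  by rewrite hs_linE; exact: aux.
by move=> k; rewrite !JE hs_linE rmorphD rmorphM.
Qed.

Lemma form_inner_si : semi_inner D form_inner.
Proof.
split.
- by exists 0 => n; rewrite big1// => k _; rewrite (si0r siD)// sqnormc0 mulr0.
- exact: form_dom_lin.
- move=> a u v w Du Dv Dw.
  have lin x y z : hdot x (a *: y + z) = a * hdot x y + hdot x z.
    by rewrite (si_linear siD).
  rewrite /form_inner form_part1_lin// form_part2_lin//.
  by rewrite (lin _ (form_part1 v)) (lin _ (form_part2 v)) addrACA -mulrDr.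
- move=> u v Du Dv; rewrite /form_inner (si_conj siD (u := form_part1 u))//.
  by rewrite (si_conj siD (u := form_part2 u))// -rmorphD.
- by move=> u _; rewrite form_inner_nrm2 addr_ge0// (si_ge0 siD).
Qed.

Lemma form_inner_upper u M : wle u M ->
  nrm2 form_inner u <= 4 * (lam ^+ 2 + lam^-1 ^+ 2) * M.
Proof.
move=> /wle_row_bound[h1 h2]; rewrite form_inner_nrm2.
have bd (a b : R) (x y : hs R) : nrm2 hdot x <= M -> nrm2 hdot y <= M ->
    nrm2 hdot (a%:C *: x - b%:C *: y) <= 2 * (a ^+ 2 + b ^+ 2) * M.
  move=> xM yM; apply: le_trans (nrm2D_le siD (u := a%:C *: x) (v := - (b%:C *: y)) I I) _.
  rewrite (nrm2N siD)// !(nrm2Z siD)// !sqnormc_real.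
  have := ler_wpM2l (sqr_ge0 a) xM; have := ler_wpM2l (sqr_ge0 b) yM.
  by move: (nrm2 _ x) (nrm2 _ y) => N N'; lra.
have [_ U1] := UP h1; have [_ T1] := TP h1; have [_ U2] := UP h2; have [_ T2] := TP h2.
have := @bd lam lam^-1 (U u) (J (T (J u))) U1.
have := @bd lam^-1 lam (T u) (J (U (J u))) T1.
rewrite !(hs_nrm2_adj JE) => /(_ U2) b2 /(_ T2) b1.
have -> : 4 * (lam ^+ 2 + lam^-1 ^+ 2) * M = 2 * (lam ^+ 2 + lam^-1 ^+ 2) * M +
    2 * (lam^-1 ^+ 2 + lam ^+ 2) * M by ring.
exact: lerD.
Qed.

(** Here th and ta are lam^2 and its inverse, so ta - 1 = (1 - th) ta. Multiplying the lower bound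
    of q by mu and inserting mu (N2 + N3) >= N1 + N4 - 2 C n leaves the factor ta - mu. *)
Lemma weighted_norm_lower (th ta mu C n N1 N2 N3 N4 q q1 q2 : R) :
  0 <= th -> th <= 1 -> 1 < ta -> th * ta = 1 -> 0 < mu -> 0 <= C -> 0 <= n -> 0 <= q ->
  N1 <= mu * N3 + C * n -> N4 <= mu * N2 + C * n ->
  (th - 1) * N1 + (ta - 1) * N2 <= q1 -> (ta - 1) * N3 + (th - 1) * N4 <= q2 ->
  q = q1 + q2 ->
  (1 - th) * (ta - mu) * (N1 + N4) <= (mu + (1 - th) * ta * 2 * C) * (q + n).
Proof.
move=> th0 th1 ta1 tE mu0 C0 n0 q0 l13 l42 p1 p2 qE.
have c0 : 0 <= (1 - th) * ta by apply: mulr_ge0; lra.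
have qlow : (1 - th) * ta * (N2 + N3) - (1 - th) * (N1 + N4) <= q.
  have -> : (1 - th) * ta = ta - 1 by rewrite mulrBl mul1r tE.
  by lra.
have h3 : (1 - th) * ta * (N1 + N4) <= (1 - th) * ta * (mu * (N2 + N3) + 2 * C * n).
  by rewrite ler_wpM2l//; lra.
have h4 := ler_wpM2l (ltW mu0) qlow.
have h5 : 0 <= mu * n by rewrite mulr_ge0// ltW.
have h6 : 0 <= (1 - th) * ta * 2 * C * q by do 3 apply: mulr_ge0 => //.
lra.
Qed.

(* Since [|lam a - lam^-1 b|^2 = (lam^2 - 1) |a|^2 + (lam^-2 - 1) |b|^2 + |a - b|^2], the
   form is bounded below by differences of weighted norms. *)
Lemma form_inner_lower : lam ^+ 2 < 1 -> exists2 K : R, 0 < K &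
  forall u, D u -> wle u (K * (nrm2 form_inner u + nrm2 hdot u)).
Proof.
move=> lam1; pose th := lam ^+ 2; pose ta := lam^-1 ^+ 2.
have th0 : 0 < th by rewrite exprn_gt0.
have tE : th * ta = 1 by rewrite -exprMn mulfV ?expr1n// gt_eqF.
have ta1 : 1 < ta by rewrite -(ltr_pM2l th0) mulr1 tE.
(* Above 1 for the shift comparison, below ta for the surplus [kap] to be positive. *)
pose mu := (1 + ta) / 2; have mu1 : 1 < mu by rewrite /mu; lra.
have muta : mu < ta by rewrite /mu; lra.
have mu0 : 0 < mu by apply: lt_trans mu1.
have [C C0 hC] := shift_up_le_down m mu1.
pose kap := (1 - th) * (ta - mu); have kap0 : 0 < kap by rewrite mulr_gt0 ?subr_gt0.
pose d := (1 - th) * ta * 2 * C.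
have ta0 : 0 < ta by apply: lt_trans ta1.
have th1 : 0 <= (1 - th) * ta by apply: mulr_ge0; [rewrite subr_ge0 ltW|exact: ltW].
have d0 : 0 <= d by apply: mulr_ge0 => //; apply: mulr_ge0.
exists ((mu + d) / kap); first by rewrite divr_gt0// ltr_pwDl.
move=> u Du; have [M h1 h2] := dom_row_bound Du.
have [U1 _] := UP h1; have [T1 _] := TP h1; have [U2 _] := UP h2; have [T2 _] := TP h2.
have := hC _ _ _ U1 T1; have := hC _ _ _ U2 T2; rewrite (hs_nrm2_adj JE).
set N1 := nrm2 hdot (U u); set N2 := nrm2 hdot (T (J u)); set N3 := nrm2 hdot (T u).
set N4 := nrm2 hdot (U (J u)); set n := nrm2 hdot u => l42 l13.
have wN : wle u (N1 + N4).
  by apply: row_bound_wle; exact: shift_up_row_bound.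
have q0 : 0 <= nrm2 form_inner u by exact: (si_ge0 form_inner_si).
have n0 : 0 <= n by exact: (si_ge0 siD).
have part (a b : R) (x y : hs R) : a * b = 1 ->
    (a ^+ 2 - 1) * nrm2 hdot x + (b ^+ 2 - 1) * nrm2 hdot y <=
    nrm2 hdot (a%:C *: x - b%:C *: y).
  move=> ab; rewrite (nrm2B siD)// !(nrm2Z siD)// !sqnormc_real.
  have E' (z : R[i]) : b%:C * (a%:C * z) = z by rewrite mulrA -rmorphM /= [b * a]mulrC ab mul1r.
  rewrite (siZr siD)// (siZl siD)// conjc_real E'.
  have := si_ge0 siD (u := x - y) I; rewrite (nrm2B siD)//.
  by move: (nrm2 _ x) (nrm2 _ y) (Re _) => N N' r; lra.
have p1 := @part lam lam^-1 (U u) (J (T (J u))) (mulfV (lt0r_neq0 lam_gt0)).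
have p2 := @part lam^-1 lam (T u) (J (U (J u))) (mulVf (lt0r_neq0 lam_gt0)).
rewrite !(hs_nrm2_adj JE) -/th -/ta -/N1 -/N2 -/N3 -/N4 in p1 p2.
have step : kap * (N1 + N4) <= (mu + d) * (nrm2 form_inner u + n).
  apply: (weighted_norm_lower (ltW th0) (ltW lam1) ta1 tE mu0 C0 n0 q0 l13 l42 p1 p2).
  exact: form_inner_nrm2.
move=> k; apply: le_trans (wN k) _.
by rewrite mulrAC ler_pdivlMr// mulrC.
Qed.

(** Left and right multiplication by X alone force the two row bounds, hence the form domain;
    conversely these bounds also provide both adjoint terms. *)
Lemma dirichlet_preformE eta r : dirichlet_preform lam (@creation_pow R m) eta r <->
  D eta /\ r = nrm2 form_inner eta.
Proof.
rewrite /dirichlet_preform; set X := left_comp _; set Xs := left_comp _.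
split=> [[_ _ [a [b [z [d [Xa Xsb Xsz Xd ->]]]]]]|[Deta ->]].
  have /left_comp_creationE aE := Xa; have /left_comp_adjointE zE := Xsz.
  have /(right_opE JE)/left_comp_adjointE bE := Xsb.
  have /(right_opE JE)/left_comp_creationE dE := Xd.
  have r1 := shift_up_row_bound aE; have r2 := shift_up_row_bound dE.
  split; first by exists (nrm2 hdot a + nrm2 hdot (J d)); exact: row_bound_wle.
  have [U1 _] := UP r1; have [T1 _] := TP r1; have [U2 _] := UP r2; have [T2 _] := TP r2.
  rewrite form_inner_nrm2 /form_part1 /form_part2.
  have -> : a = U eta by apply: hs_ext => i j; rewrite aE U1.
  have -> : z = T eta by apply: hs_ext => i j; rewrite zE T1.
  have <- : J b = T (J eta) by apply: hs_ext => i j; rewrite bE T2.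
  have <- : J d = U (J eta) by apply: hs_ext => i j; rewrite dE U2.
  by rewrite !(hs_adjK JE).
have [M h1 h2] := dom_row_bound Deta.
have [U1 _] := UP h1; have [T1 _] := TP h1; have [U2 _] := UP h2; have [T2 _] := TP h2.
have X1 : X eta (U eta) by apply/left_comp_creationE.
have Xs1 : Xs eta (T eta) by apply/left_comp_adjointE.
have X2 : X (J eta) (U (J eta)) by apply/left_comp_creationE.
have Xs2 : Xs (J eta) (T (J eta)) by apply/left_comp_adjointE.
split.
- by split; [exists (U eta)|exists (T eta)].
- exists (J eta); first exact/(hs_adj_modular_conj JE).
  by split; [exists (U (J eta))|exists (T (J eta))].
exists (U eta), (J (T (J eta))), (T eta), (J (U (J eta))); split=> //.
- by apply/(right_opE JE); rewrite (hs_adjK JE).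
- by apply/(right_opE JE); rewrite (hs_adjK JE).
Qed.

End DirichletForm.

(** * Application to the powers of the creation operator *)

Theorem theorem5p2 (R : realType) (beta lam : R) (m : nat)
  (beta_gt0 : 0 < beta) (m_ge1 : (1 <= m)%N) (lam_gt0 : 0 < lam)
  (lam2 : lam ^+ 2 = expR (- (m%:R * beta / 2))) :
  let H := dirichlet_generator lam (@creation_pow R m) in
  discrete_spectrum (@hsdot R) H /\
  exists T : R -> hs R -> hs R,
    exp_semigroup (@hsdot R) H T /\
    forall t, 0 < t -> forall b : nat -> hs R,
      orthonormal_basis (@hsdot R) b ->
      (trace (@hsdot R) b (T t) < +oo)%E.
Proof.
have lam1 : lam ^+ 2 < 1.
  by rewrite lam2 -[ltRHS]expR0 ltr_expR oppr_lt0 divr_gt0// mulr_gt0// ltr0n.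
have [J JE] := hs_adj_ex R; have [E hbE EE] := hs_basis_ex R.
have [U UP] := @shift_up_fun R m; have [T TP] := @shift_down_fun R m.
have [K K0 lower] := form_inner_lower JE hbE EE UP TP lam_gt0 lam1.
have upper := form_inner_upper JE EE UP TP lam.
have siB := form_inner_si JE hbE EE UP TP lam.
pose L := 4 * (lam ^+ 2 + lam^-1 ^+ 2).
have L0 : 0 <= L by rewrite mulr_ge0// addr_ge0// sqr_ge0.
(* A single constant must serve for both comparisons, hence the sum K + L. *)
apply: (form_spectrum hbE (@pair_weight_ge0 R m)
  (fun t => @pair_weight_exp_sum R m t m_ge1) siB (c := K + L)).
- exact: ltr_wpDr.
- move=> u Du k; apply: le_trans (lower u Du k) _.
  rewrite ler_wpM2r ?lerDl// addr_ge0 ?(si_ge0 siB)//.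
  exact: (si_ge0 (hsdot_si R)).
- move=> u M uM; apply: le_trans (upper u M uM) _.
  by rewrite ler_wpM2r ?lerDr ?(ltW K0)//; have := uM 0%N; rewrite big_ord0.
exact: (dirichlet_preformE JE EE UP TP).
Qed.
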